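(* Under the standing assumptions and notation in the context: (i) Suppose either (Assumption U and ((N1) or (N2))) holds, or (N3) holds. Then $\mathfrak{M}_{\mathcal{A}}\cap\mathcal{P}_\circ(\mathcal{Z})\subset\mathcal{P}_*(\mathcal{Z})$, and consequently \[ \rho_*=\max_{\mu\in\mathfrak{M}_{\mathcal{A}}}\int_{\mathcal{Z}}\mathcal{R}(z)\,\mu(\mathrm{d}z)=\sup_{\mu\in\mathcal{P}(\mathcal{Z})}\ \inf_{g\in C^2_c(\mathbb{R}^d)}F(g,\mu). \] (ii) Suppose Assumption U holds and $\sup_{x\in\mathbb{R}^d}\frac{\mathcal{H}(x)}{1+|\varphi_*(x)|}<\infty$. Then \[ \rho_*=\inf_{g\in C^2_c(\mathbb{R}^d)}\ \sup_{\mu\in\mathcal{P}(\mathcal{Z})}F(g,\mu). \]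
   Context: Let $\mathcal{K}$ be a compact metrizable space; controlled diffusion $\mathrm{d}X_t=b(X_t,\xi_t)\mathrm{d}t+\sigma(X_t)\mathrm{d}W_t$ on $\mathbb{R}^d$, $a=\sigma\sigma^{\mathsf T}$, $B_r$ ball of radius $r$ about $0$. Standing assumptions: (A1) $b$ continuous; for each $R>0$ there is $C_R$ with $|b(x,\xi)-b(y,\xi)|+\|\sigma(x)-\sigma(y)\|\le C_R|x-y|$ on $B_R$ uniformly in $\xi$, $\langle\zeta,a(x)\zeta\rangle\ge C_R^{-1}|\zeta|^2$ on $B_R$; $|b(x,\xi)|^2+\|\sigma(x)\|^2\le C_0(1+|x|^2)$. (A2) $c\colon\mathbb{R}^d\times\mathcal{K}\to\mathbb{R}$ continuous, locally Lipschitz in $x$ uniformly in $\xi$, bounded above, $\max_\xi|c(x,\xi)|$ of polynomial growth. (A3) $\rho_*:=\limsup_n\rho_n>\lim_{r\to\infty}\sup_{B_r^c\times\mathcal{K}}c$, where $\rho_r$ is the unique real number for which there is $V_r\in C^2(B_r)\cap C^{0,1}(\bar B_r)$, $V_r>0$, $V_r(0)=1$, with $\tfrac12\operatorname{tr}(a\nabla^2V_r)+\max_\xi[\langle b(x,\xi),\nabla V_r\rangle+c(x,\xi)V_r]=\rho_rV_r$ in $B_r$, $\langle\nabla V_r,\vec n\rangle=0$ on $\partial B_r$. Let $\mathcal{L}_\xi f=\tfrac12\operatorname{tr}(a\nabla^2f)+\langle b(\cdot,\xi),\nabla f\rangle$. There is a positive $\Phi_*\in C^2(\mathbb{R}^d)$,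 unique up to positive multiples, with $\max_\xi[\mathcal{L}_\xi\Phi_*+c(\cdot,\xi)\Phi_*]=\rho_*\Phi_*$; $\varphi_*=\log\Phi_*$, $\mathcal{H}=\tfrac12|\sigma^{\mathsf T}\nabla\varphi_*|^2$. $\mathcal{Z}=\mathbb{R}^d\times\mathcal{K}\times\mathbb{R}^d$; $\mathcal{A}\phi(x,\xi,y)=\tfrac12\operatorname{tr}(a(x)\nabla^2\phi(x))+\langle b(x,\xi)+a(x)y,\nabla\phi(x)\rangle$; $\mathcal{R}(x,\xi,y)=c(x,\xi)-\tfrac12|\sigma^{\mathsf T}(x)y|^2$; $F(g,\mu)=\int_{\mathcal{Z}}(\mathcal{A}g+\mathcal{R})\mathrm{d}\mu$; $\mathcal{P}(\mathcal{Z})$ the Borel probability measures on $\mathcal{Z}$; $\mathfrak{M}_{\mathcal{A}}=\{\mu\in\mathcal{P}(\mathcal{Z}):\int\mathcal{A}f\,\mathrm{d}\mu=0\ \forall f\in C^2_c(\mathbb{R}^d)\}$; $\mathcal{P}_*(\mathcal{Z})=\{\mu:\int\mathcal{H}(x)\mu(\mathrm{d}x,\mathrm{d}\xi,\mathrm{d}y)<\infty\}$; $\mathcal{P}_\circ(\mathcal{Z})=\{\mu:\int\mathcal{R}\,\mathrm{d}\mu>-\infty\}$. Assumption U: $a$ is bounded, has a uniform modulus of continuity on $\mathbb{R}^d$, and its minimum eigenvalue is bounded away from zero on $\mathbb{R}^d$. (N1): $-c$ is inf-compact (sublevel sets compact in $\mathbb{R}^d\times\mathcal{K}$). (N2): $\max_{(x,\xi)\in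 B_r^c\times\mathcal{K}}\frac{\langle b(x,\xi),x\rangle^-}{|x|^2}\to0$ as $r\to\infty$. (N3): there is $\widehat C_0$ with $\frac{\mathcal{H}(x)}{(1+|\varphi_*(x)|)(1+|c(x,\xi)|)}\le\widehat C_0$ for all $(x,\xi)\in\mathbb{R}^d\times\mathcal{K}$. *)

(* Defs.v *)
From HB Require Import structures.
From mathcomp Require Import all_boot all_order all_algebra.
From mathcomp Require Import all_classical all_reals all_analysis.
Set Implicit Arguments. Unset Strict Implicit. Unset Printing Implicit Defensive.
Import Order.TTheory GRing.Theory Num.Theory.
Import numFieldNormedType.Exports.
Local Open Scope classical_set_scope.
Local Open Scope ring_scope.

Definition edot {R : realType} {d : nat} (u v : 'rV[R]_d) : R :=
  \sum_(i < d) u ord0 i * v ord0 i.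
Definition enorm {R : realType} {d : nat} (u : 'rV[R]_d) : R := Num.sqrt (edot u u).
Definition fnorm {R : realType} {m n : nat} (A : 'M[R]_(m, n)) : R :=
  Num.sqrt (\sum_(i < m) \sum_(j < n) A i j ^+ 2).

Definition oball {R : realType} {d : nat} (r : R) : set 'rV[R]_d := [set x | enorm x < r].
Definition cball {R : realType} {d : nat} (r : R) : set 'rV[R]_d := [set x | enorm x <= r].
Definition sphere {R : realType} {d : nat} (r : R) : set 'rV[R]_d := [set x | enorm x = r].

Definition evec {R : realType} {d : nat} (i : 'I_d) : 'rV[R]_d := delta_mx ord0 i.
Definition partial {R : realType} {d : nat} (i : 'I_d) (f : 'rV[R]_d -> R) (x : 'rV[R]_d) : R :=
  derive f x (evec i).
Definition grad {R : realType} {d : nat} (f : 'rV[R]_d -> R) (x : 'rV[R]_d) : 'rV[R]_d :=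
  \row_i partial i f x.

Definition C2on {R : realType} {d : nat} (U : set 'rV[R]_d) (f : 'rV[R]_d -> R) : Prop :=
  [/\ {within U, continuous f},
      (forall i, forall x, U x -> derivable f x (evec i)),
      (forall i, {within U, continuous (partial i f)}),
      (forall i j, forall x, U x -> derivable (partial i f) x (evec j)) &
      (forall i j, {within U, continuous (partial j (partial i f))})].

Definition C2c {R : realType} {d : nat} (g : 'rV[R]_d -> R) : Prop :=
  C2on setT g /\ exists r : R, forall x, r <= enorm x -> g x = 0.

Definition diffm {R : realType} {d m : nat} (sigma : 'rV[R]_d -> 'M[R]_(d, m))
  (x : 'rV[R]_d) : 'M[R]_d := sigma x *m (sigma x)^T.

Definition half_tr {R : realType} {d m : nat} (sigma : 'rV[R]_d -> 'M[R]_(d, m))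
  (f : 'rV[R]_d -> R) (x : 'rV[R]_d) : R :=
  2^-1 * \sum_(i < d) \sum_(j < d) diffm sigma x i j * partial j (partial i f) x.

Definition Lop {R : realType} {d m : nat} {K : Type}
  (b : 'rV[R]_d -> K -> 'rV[R]_d) (sigma : 'rV[R]_d -> 'M[R]_(d, m))
  (f : 'rV[R]_d -> R) (x : 'rV[R]_d) (xi : K) : R :=
  half_tr sigma f x + edot (b x xi) (grad f x).

(* rho is a Neumann eigenvalue of the HJB operator on the ball B_r:
   there is V in C^2(B_r) cap C^{0,1}(closed B_r), V > 0, V(0) = 1, with
   max_xi [L_xi V + c V] = rho V in B_r and zero normal derivative on the sphere
   (inward one-sided normal derivative). *)
Definition neumann_eigen {R : realType} {d m : nat} {K : Type}
  (b : 'rV[R]_d -> K -> 'rV[R]_d) (sigma : 'rV[R]_d -> 'M[R]_(d, m))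
  (c : 'rV[R]_d -> K -> R) (r : R) (rho : R) : Prop :=
  exists V : 'rV[R]_d -> R,
    [/\ C2on (oball r) V,
        ((exists L : R, forall x y, cball r x -> cball r y ->
            `|V x - V y| <= L * enorm (x - y)) /\
         (forall x, cball r x -> 0 < V x)),
        V 0 = 1,
        (forall x, oball r x ->
           (forall xi, Lop b sigma V x xi + c x xi * V x <= rho * V x) /\
           (exists xi, Lop b sigma V x xi + c x xi * V x = rho * V x)) &
        (forall x, sphere r x ->
           (fun t : R => (V (x - t *: ((enorm x)^-1 *: x)) - V x) / t)
             @ at_right 0 --> (0 : R))].

Notation Zsp R d K := ('rV[R]_d * K * 'rV[R]_d)%type (only parsing).
Definition ZB (R : realType) (d : nat) (K : ptopologicalType) :=
  g_sigma_algebraType (@open ('rV[R]_d * K * 'rV[R]_d)%type).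

Definition zx {R : realType} {d : nat} {K : ptopologicalType} (z : Zsp R d K) : 'rV[R]_d := z.1.1.
Definition zxi {R : realType} {d : nat} {K : ptopologicalType} (z : Zsp R d K) : K := z.1.2.
Definition zy {R : realType} {d : nat} {K : ptopologicalType} (z : Zsp R d K) : 'rV[R]_d := z.2.

Definition Aop {R : realType} {d m : nat} {K : ptopologicalType}
  (b : 'rV[R]_d -> K -> 'rV[R]_d) (sigma : 'rV[R]_d -> 'M[R]_(d, m))
  (phi : 'rV[R]_d -> R) (z : Zsp R d K) : R :=
  half_tr sigma phi (zx z)
  + edot (b (zx z) (zxi z) + zy z *m diffm sigma (zx z)) (grad phi (zx z)).

Definition Rfun {R : realType} {d m : nat} {K : ptopologicalType}
  (sigma : 'rV[R]_d -> 'M[R]_(d, m)) (c : 'rV[R]_d -> K -> R) (z : Zsp R d K) : R :=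
  c (zx z) (zxi z) - 2^-1 * (enorm (zy z *m sigma (zx z))) ^+ 2.

(* F(g, mu) = int (A g + R) dmu  (an extended real; the integrand is bounded above) *)
Definition Ffun {R : realType} {d m : nat} {K : ptopologicalType}
  (b : 'rV[R]_d -> K -> 'rV[R]_d) (sigma : 'rV[R]_d -> 'M[R]_(d, m))
  (c : 'rV[R]_d -> K -> R) (g : 'rV[R]_d -> R) (mu : probability (ZB R d K) R) : \bar R :=
  (\int[mu]_z ((Aop b sigma g z + Rfun sigma c z)%:E))%E.

Definition MA {R : realType} {d m : nat} {K : ptopologicalType}
  (b : 'rV[R]_d -> K -> 'rV[R]_d) (sigma : 'rV[R]_d -> 'M[R]_(d, m))
  (mu : probability (ZB R d K) R) : Prop :=
  forall f, C2c f ->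
    mu.-integrable setT (fun z => (Aop b sigma f z)%:E) /\
    (\int[mu]_z ((Aop b sigma f z)%:E) = 0)%E.

Definition Hfun {R : realType} {d m : nat} (sigma : 'rV[R]_d -> 'M[R]_(d, m))
  (Phi : 'rV[R]_d -> R) (x : 'rV[R]_d) : R :=
  2^-1 * (enorm (grad (fun y => ln (Phi y)) x *m sigma x)) ^+ 2.

Definition Pstar {R : realType} {d m : nat} {K : ptopologicalType}
  (sigma : 'rV[R]_d -> 'M[R]_(d, m)) (Phi : 'rV[R]_d -> R)
  (mu : probability (ZB R d K) R) : Prop :=
  (\int[mu]_z ((Hfun sigma Phi (zx z))%:E) < +oo)%E.
Definition Pcirc {R : realType} {d m : nat} {K : ptopologicalType}
  (sigma : 'rV[R]_d -> 'M[R]_(d, m)) (c : 'rV[R]_d -> K -> R)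
  (mu : probability (ZB R d K) R) : Prop :=
  (-oo < \int[mu]_z ((Rfun sigma c z)%:E))%E.

Definition assumption_A1 {R : realType} {d m : nat} {K : ptopologicalType}
  (b : 'rV[R]_d -> K -> 'rV[R]_d) (sigma : 'rV[R]_d -> 'M[R]_(d, m)) : Prop :=
  [/\ continuous (fun p : 'rV[R]_d * K => b p.1 p.2),
      (forall Rr : R, 0 < Rr -> exists CR : R, 0 < CR /\
         (forall x y xi, oball Rr x -> oball Rr y ->
            enorm (b x xi - b y xi) + fnorm (sigma x - sigma y) <= CR * enorm (x - y)) /\
         (forall x (zeta : 'rV[R]_d), oball Rr x ->
            CR^-1 * enorm zeta ^+ 2 <= edot zeta (zeta *m diffm sigma x))) &
      exists C0 : R, forall x xi,
        enorm (b x xi) ^+ 2 + fnorm (sigma x) ^+ 2 <= C0 * (1 + enorm x ^+ 2)].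

Definition assumption_A2 {R : realType} {d : nat} {K : ptopologicalType}
  (c : 'rV[R]_d -> K -> R) : Prop :=
  [/\ continuous (fun p : 'rV[R]_d * K => c p.1 p.2),
      (forall Rr : R, 0 < Rr -> exists CR : R,
         forall x y xi, oball Rr x -> oball Rr y ->
           `|c x xi - c y xi| <= CR * enorm (x - y)),
      (exists M : R, forall x xi, c x xi <= M) &
      exists (C : R) (k : nat), forall x xi, `|c x xi| <= C * (1 + enorm x ^+ k)].

Definition c_sup_outside {R : realType} {d : nat} {K : Type}
  (c : 'rV[R]_d -> K -> R) (n : nat) : \bar R :=
  ereal_sup [set (c x xi)%:E | x in ~` oball n%:R & xi in [set: K]].

Definition assumption_U {R : realType} {d m : nat} (sigma : 'rV[R]_d -> 'M[R]_(d, m)) : Prop :=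
  [/\ (exists M : R, forall x, fnorm (diffm sigma x) <= M),
      (forall eps : R, 0 < eps -> exists del : R, 0 < del /\
         forall x y, enorm (x - y) < del -> fnorm (diffm sigma x - diffm sigma y) < eps) &
      exists del : R, 0 < del /\
         forall x (zeta : 'rV[R]_d), del * enorm zeta ^+ 2 <= edot zeta (zeta *m diffm sigma x)].

Definition cond_N1 {R : realType} {d : nat} {K : ptopologicalType}
  (c : 'rV[R]_d -> K -> R) : Prop :=
  forall t : R, compact [set p : 'rV[R]_d * K | - c p.1 p.2 <= t].

Definition cond_N2 {R : realType} {d : nat} {K : Type}
  (b : 'rV[R]_d -> K -> 'rV[R]_d) : Prop :=
  forall eps : R, 0 < eps -> exists r : R, forall x xi,
    r <= enorm x -> Num.max 0 (- edot (b x xi) x) <= eps * enorm x ^+ 2.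

Definition cond_N3 {R : realType} {d m : nat} {K : Type}
  (sigma : 'rV[R]_d -> 'M[R]_(d, m)) (c : 'rV[R]_d -> K -> R) (Phi : 'rV[R]_d -> R) : Prop :=
  exists C : R, forall x xi,
    Hfun sigma Phi x <= C * ((1 + `|ln (Phi x)|) * (1 + `|c x xi|)).

(* Main.v *)
(** Write φ = ln Φ, H = ½|σᵀ∇φ|² and G[g] = max_ξ (L_ξ g + c) + ½|σᵀ∇g|², so that
    A g + R <= G[g], with equality at y = ∇g.

    Comparison.  If g has compact support and A g + R <= Q, then ρ_r <= Q for every large r:
    the maximum principle applies to V_r exp (- g - ε|x|²), whose Neumann condition has a sign.
    Hence ρ_* <= Q.

    Optimal measure.  By Hahn-Banach this comparison gives a positive functional that kills all
    A f and is at least ρ_* on R; Riesz representation turns it into a measure.  Over a ball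
    in x the superlevel sets of R are compact, and c < ρ_* near infinity, so mass can escape
    only where R < ρ_*, and normalizing gives a probability in M_A with integral of R at least ρ_*.

    Upper bound over M_A.  Test with η T_k(φ), where T_k(s) = k atan (s / k) and η is a cutoff in
    ln (1 + |x|²).  The linear growth of b and σ makes A η of order (1 + |σᵀy|²) / k, and
    A φ + R <= ρ_* - ½|σᵀ(y - ∇φ)|².  Keeping the square and letting k grow (Fatou) bounds the
    integral of H; dropping it then gives that the integral of R is at most ρ_*.

    Part (ii).  The smooth minimum of φ and C - κ ln (1 + |x|²) is, up to a small error, a
    supersolution, tends to -oo, and has gradient energy at most linear in its size because of
    H <= C (1 + |φ|).  A logarithmically slow truncation g of it is, up to a constant, in C²_c and
    still satisfies G[g] <= ρ_* + ε.  The opposite inequality is the comparison applied to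
    Dirac measures. *)

(* Neither φ nor R is bounded, so every limit needs its own control. The functions L_ξ ln (1 + |x|²)
   and |σᵀ∇ ln (1 + |x|²)|² are bounded, so a cutoff of slope e in ln (1 + |x|²) costs O(e). As
   |T_k| <= 2k, slope k^-2 in front of T_k(φ) leaves O(1/k); as |T_k''| <= T_k' / k, truncating φ
   adds only a small multiple of an energy that is already present. In the Hahn-Banach step the
   functional acts on functions of order M - R, and part of it may sit at infinity. There A f,
   affine in y with compact support in x, is negligible against R, quadratic in y: the lost part
   does not spoil the zero mean of A f. In part (ii), φ need not tend to -oo, hence the barrier κ ln
   (1 + |x|²); the gap between c and ρ_* outside a ball pays for it. The truncation has slope - w²
   with w the positive part of 1 - e ln r, and second derivative 2 e w / r; since the energy is
   O(r), the error is O(e). *)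
Require Import Defs.
From HB Require Import structures.
From mathcomp Require Import all_boot all_order all_algebra.
From mathcomp Require Import all_classical all_reals all_analysis.
From mathcomp Require Import measurable_realfun.
From mathcomp Require Import ring lra.
Set Implicit Arguments. Unset Strict Implicit. Unset Printing Implicit Defensive.
Import Order.TTheory GRing.Theory Num.Theory.
Import numFieldNormedType.Exports.
Local Open Scope classical_set_scope.
Local Open Scope ring_scope.

(** * Hahn-Banach *)

Section HahnBanach.
Context {R : realType} {V : lmodType R} (E : set V).
Hypothesis linE : forall a x y, E x -> E y -> E (a *: x + y).

(** The space is a subset [E] of an ambient module rather than a module type: later [V] consists of
    all real functions on a space and [E] of those dominated by a weight. *)
Definition sublinear_on (q : V -> R) :=
  (forall x y, E x -> E y -> q (x + y) <= q x + q y) /\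
  (forall t x, 0 <= t -> E x -> q (t *: x) = t * q x).

Let addE x y : E x -> E y -> E (x + y).
Proof. by move=> Ex Ey; rewrite -[x]scale1r; exact: linE. Qed.

Let E0 x : E x -> E 0.
Proof. by move=> Ex; rewrite -(addNr x) -scaleN1r; exact: linE. Qed.

Let scaleE t x : E x -> E (t *: x).
Proof. by move=> Ex; rewrite -[_ *: _]addr0; exact: linE (E0 Ex). Qed.

Let oppE x : E x -> E (- x).
Proof. by rewrite -scaleN1r; exact: scaleE. Qed.

Lemma sublinear_on0 q x : sublinear_on q -> E x -> q 0 = 0.
Proof. by move=> [_ qZ] Ex; rewrite -(scale0r x) qZ// mul0r. Qed.

Lemma sublinear_on_ge q x : sublinear_on q -> E x -> - q (- x) <= q x.
Proof.
move=> sq Ex; have := sq.1 _ _ Ex (oppE Ex).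
by rewrite subrr (sublinear_on0 sq Ex); lra.
Qed.

(* A minimal sublinear functional q is linear: for fixed y, the functional
   x |-> inf_{t >= 0} (q (x + t y) - t q y) is sublinear and below q. *)
Lemma sublinear_on_shift_inf q y : sublinear_on q -> E y ->
  exists q', [/\ sublinear_on q', (forall x, E x -> q' x <= q x) &
    (forall x, E x -> q' x <= q (x + y) - q y)].
Proof.
move=> sq Ey.
pose S x := [set q (x + t *: y) - t * q y | t in [set t : R | 0 <= t]].
have Sne x : S x !=set0 by exists (q (x + 0 *: y) - 0 * q y); exists 0 => //=.
have Slb x : E x -> lbound (S x) (- q (- x)).
  move=> Ex _ [t /= t0 <-]; rewrite -(sq.2 _ _ t0 Ey).
  have := sq.1 _ _ (addE Ex (scaleE t Ey)) (oppE Ex).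
  by rewrite addrAC subrr add0r; lra.
have Shl x : E x -> has_lbound (S x) by move=> Ex; exists (- q (- x)); exact: Slb.
have infle x t : E x -> 0 <= t -> inf (S x) <= q (x + t *: y) - t * q y.
  by move=> Ex t0; apply: ge_inf; [exact: Shl|exists t].
have infge x e : (forall t, 0 <= t -> e <= q (x + t *: y) - t * q y) -> e <= inf (S x).
  by move=> H; apply: lb_le_inf; [exact: Sne|move=> _ [t /= t0 <-]; exact: H].
exists (fun x => inf (S x)); split.
- split.
  + move=> x1 x2 Ex1 Ex2.
    rewrite -lerBlDr; apply: (infge) => t1 t10.
    rewrite lerBlDr -lerBlDl; apply: (infge) => t2 t20; rewrite lerBlDl.
    apply: (le_trans (infle _ (t2 + t1) (addE Ex1 Ex2) (addr_ge0 t20 t10))).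
    have := sq.1 _ _ (addE Ex1 (scaleE t1 Ey)) (addE Ex2 (scaleE t2 Ey)).
    rewrite addrACA -scalerDl (addrC t1); lra.
  + move=> t x; rewrite le_eqVlt => /predU1P[<- Ex|t0 Ex].
      rewrite scale0r mul0r; apply/eqP; rewrite eq_le; apply/andP; split.
        have := infle 0 0 (E0 Ex) (lexx _).
        by rewrite scale0r addr0 mul0r subr0 (sublinear_on0 sq Ex).
      by apply: (infge) => s s0; rewrite add0r sq.2// subrr.
    apply/eqP; rewrite eq_le; apply/andP; split.
      rewrite -ler_pdivrMl//; apply: (infge) => s s0; rewrite ler_pdivrMl//.
      apply: (le_trans (infle _ (t * s) (scaleE t Ex) (mulr_ge0 (ltW t0) s0))).
      rewrite -scalerA -scalerDr sq.2 ?(ltW t0)//; last exact: addE (scaleE _ _).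
      by rewrite mulrBr mulrA.
    apply: (infge) => s s0.
    apply: (@le_trans _ _ (t * (q (x + (s / t) *: y) - s / t * q y))).
      by rewrite ler_pM2l// infle// divr_ge0// ltW.
    rewrite mulrBr -(sq.2 _ _ (ltW t0)); last exact: addE (scaleE _ _).
    have e : t * (s / t) = s by rewrite mulrC divfK ?gt_eqF.
    by rewrite scalerDr scalerA e [t * (_ * q y)]mulrA e.
- move=> x Ex; have := infle x 0 Ex (lexx _).
  by rewrite scale0r addr0 mul0r subr0.
- move=> x Ex; have := infle x 1 Ex ler01.
  by rewrite scale1r mul1r.
Qed.

(** Zorn's lemma gives a minimal sublinear functional below [p]. Minimality places it below the
    functional of [sublinear_on_shift_inf], and this is the missing half of additivity. *)
Lemma hahn_banach (p : V -> R) : sublinear_on p ->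
  exists L : V -> R, (forall a x y, E x -> E y -> L (a *: x + y) = a * L x + L y) /\
    (forall x, E x -> L x <= p x).
Proof.
move=> sp.
pose T := {q : V -> R | sublinear_on q /\ forall x, E x -> q x <= p x}.
pose t0 : T := exist _ p (conj sp (fun x _ => lexx _)).
(* The order is reversed, so that a maximal element is a minimal functional. *)
pose leT (q1 q2 : T) := `[< forall x, E x -> sval q2 x <= sval q1 x >].
have [||A totA|q qmax] := @ZL_preorder T t0 leT.
- by move=> t; apply/asboolP.
- move=> r s t /asboolP rs /asboolP st; apply/asboolP => x Ex.
  exact: le_trans (st _ Ex) (rs _ Ex).
- have [->|/set0P[a0 Aa0]] := eqVneq A set0; first by exists t0.
  pose S x := [set sval a x | a in A].
  have Sne x : S x !=set0 by exists (sval a0 x); exists a0.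
  have Shl x : E x -> has_lbound (S x).
    move=> Ex; exists (- p (- x)) => _ [a Aa <-]; case: (svalP a) => sa ap.
    apply: le_trans (sublinear_on_ge sa Ex).
    by rewrite lerN2 ap//; exact: oppE.
  have infle a x : A a -> E x -> inf (S x) <= sval a x.
    by move=> Aa Ex; apply: ge_inf; [exact: Shl|exists a].
  have infge x e : (forall a, A a -> e <= sval a x) -> e <= inf (S x).
    by move=> H; apply: lb_le_inf; [exact: Sne|move=> _ [t /= t1 <-]; exact: H].
  have sinf : sublinear_on (fun x => inf (S x)).
    split.
      (* The chain is total: of [a] and [b], the smaller functional serves for both arguments. *)
      move=> x y Ex Ey; rewrite -lerBlDr; apply: (infge) => a Aa.
      rewrite lerBlDr -lerBlDl; apply: (infge) => b Ab; rewrite lerBlDl.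
      have [/asboolP ab|/asboolP ba] := totA _ _ Aa Ab.
        apply: le_trans (infle _ _ Ab (addE Ex Ey)) _.
        apply: le_trans ((svalP b).1.1 _ _ Ex Ey) _.
        by rewrite lerD2r ab.
      apply: le_trans (infle _ _ Aa (addE Ex Ey)) _.
      apply: le_trans ((svalP a).1.1 _ _ Ex Ey) _.
      by rewrite lerD2l ba.
    move=> t x; rewrite le_eqVlt => /predU1P[<- Ex|t1 Ex].
      rewrite scale0r mul0r; apply/eqP; rewrite eq_le; apply/andP; split.
        by rewrite -(sublinear_on0 (svalP a0).1 Ex); apply: infle => //; exact: E0 Ex.
      by apply: (infge) => a Aa; rewrite (sublinear_on0 (svalP a).1 Ex).
    apply/eqP; rewrite eq_le; apply/andP; split.
      rewrite -ler_pdivrMl//; apply: (infge) => a Aa; rewrite ler_pdivrMl//.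
      rewrite -((svalP a).1.2 _ _ (ltW t1) Ex); apply: infle => //; exact: scaleE.
    apply: (infge) => a Aa; rewrite ((svalP a).1.2 _ _ (ltW t1) Ex) ler_pM2l//.
    exact: infle.
  have lep x : E x -> inf (S x) <= p x.
    by move=> Ex; exact: le_trans (infle _ _ Aa0 Ex) ((svalP a0).2 _ Ex).
  exists (exist _ (fun x => inf (S x)) (conj sinf lep)) => a Aa.
  by apply/asboolP => x Ex /=; exact: infle.
have [sq qp] := svalP q.
have qD x y : E x -> E y -> sval q (x + y) = sval q x + sval q y.
  move=> Ex Ey; apply/eqP; rewrite eq_le sq.1//=.
  have [q' [sq' q'q q'y]] := sublinear_on_shift_inf sq Ey.
  have q'p z : E z -> q' z <= p z.
    by move=> Ez; exact: le_trans (q'q _ Ez) (qp _ Ez).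
  have /asboolP/(_ _ Ex) /= qq' := qmax (exist _ q' (conj sq' q'p)) (asboolT q'q).
  by have := q'y _ Ex; lra.
exists (sval q); split=> // a x y Ex Ey.
rewrite qD//; last exact: scaleE.
have [a0|a0] := leP 0 a; first by rewrite sq.2.
(* Negative scalars come from additivity at [a *: x] and [- a *: x]. *)
have := qD _ _ (scaleE a Ex) (scaleE (- a) Ex).
rewrite -scalerDl subrr scale0r (sublinear_on0 sq Ex) (sq.2 (- a)) ?oppr_ge0 ?ltW//.
by lra.
Qed.

End HahnBanach.

(** * Double series and Borel measurability *)

Section NneseriesPair.
Context {R : realType}.
Local Open Scope ereal_scope.

(** The enumeration is chosen before the array [a], so that one and the same enumeration can reorder
    both the values of a functional and the pointwise values of a family of functions. *)
Lemma nneseries_pair : exists e : nat -> nat * nat,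
  forall a : nat -> nat -> \bar R, (forall n k, 0 <= a n k) ->
  \sum_(i <oo) a (e i).1 (e i).2 = \sum_(n <oo) \sum_(k <oo) a n k.
Proof.
have /card_esym/ppcard_eqP[e] := card_nat2; exists e => a a0.
rewrite nneseries_esumT//.
rewrite nneseries_esumT; last by move=> n; apply: nneseries_ge0.
under [RHS]eq_esum do rewrite nneseries_esumT//.
rewrite (esum_esum (J := fun=> setT))//.
rewrite (_ : _ `*`` _ = [set: nat * nat]); last by apply/seteqP; split.
by rewrite (@reindex_esum _ _ _ [set: nat] [set: nat * nat] e (fun k => a k.1 k.2)).
Qed.

End NneseriesPair.

Lemma continuous_measurable_fun_open {R : realType} {T : ptopologicalType}
    (f : T -> R) : continuous f ->
  measurable_fun [set: g_sigma_algebraType (@open T)]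
    (f : g_sigma_algebraType (@open T) -> R).
Proof.
move=> /continuousP cf; apply: (measurability _ (measurable_realfun.RGenOpens.measurableE R)).
move=> _ [_ [a [b ->] <-]]; rewrite setTI.
by apply: sub_sigma_algebra; apply: cf; exact: interval_open.
Qed.

(** * Riesz representation *)

Section CompactSupport.
Context {R : realType} {T : topologicalType}.

Definition Cc (f : T -> R) := continuous f /\
  exists S, compact S /\ forall x, ~ S x -> f x = 0.

Lemma CcD f g : Cc f -> Cc g -> Cc (fun x => f x + g x).
Proof.
move=> [cf [S [cS f0]]] [cg [S' [cS' g0]]]; split.
  by move=> x; apply: cvgD; [exact: cf|exact: cg].
exists (S `|` S'); split; first exact: compactU.
by move=> x /not_orP[nS nS']; rewrite f0// g0// addr0.
Qed.

Lemma CcMl (f g : T -> R) : continuous f -> Cc g -> Cc (fun x => f x * g x).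
Proof.
move=> cf [cg [S [cS g0]]]; split.
  by move=> x; apply: cvgM; [exact: cf|exact: cg].
by exists S; split => // x nS; rewrite g0// mulr0.
Qed.

Lemma CcZ a g : Cc g -> Cc (fun x => a * g x).
Proof. by apply: CcMl => x; exact: cvg_cst. Qed.

Lemma CcN g : Cc g -> Cc (fun x => - g x).
Proof.
move=> /(CcZ (-1)); congr Cc; apply/funext => x; exact: mulN1r.
Qed.

Lemma CcB f g : Cc f -> Cc g -> Cc (fun x => f x - g x).
Proof. by move=> Cf /CcN; exact: CcD. Qed.

Lemma Cc0 : Cc (fun=> 0).
Proof.
split; first by move=> x; exact: cvg_cst.
by exists set0; split => //; exact: compact0.
Qed.

Lemma Cc_sum (f : nat -> T -> R) N : (forall n, Cc (f n)) ->
  Cc (fun x => \sum_(n < N) f n x).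
Proof.
move=> Cf; elim: N => [|N IH].
  by under eq_fun do rewrite big_ord0; exact: Cc0.
by under eq_fun do rewrite big_ord_recr/=; exact: CcD.
Qed.

Lemma Cc_comp0 (f : T -> R) (h : R -> R) : continuous h -> h 0 = 0 -> Cc f ->
  Cc (fun x => h (f x)).
Proof.
move=> ch h0 [cf [S [cS f0]]]; split.
  by move=> x; apply: continuous_comp; [exact: cf|exact: ch].
by exists S; split => // x nS; rewrite f0.
Qed.

Lemma Cc_bounded f : Cc f -> exists M, forall x, f x <= M.
Proof.
move=> [cf [S [cS f0]]].
have [S0|/set0P S0] := eqVneq S set0.
  by exists 0 => x; rewrite f0// S0.
have [|||x0 _ xmax] := @compact_EVT_max T R f S => //.
  by apply: continuous_subspaceT.
exists (Num.max (f x0) 0) => x; rewrite le_max.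
have [Sx|nSx] := pselect (S x); last by rewrite f0// lexx orbT.
by rewrite xmax// inE.
Qed.

(** At each point of the support some partial sum exceeds [g - e]. This persists nearby by
    continuity and for later partial sums because the terms are nonnegative, so compactness, in its
    near-covering form, makes the index uniform. *)
Lemma Cc_dini (g : T -> R) (f : nat -> T -> R) (e : R) : Cc g ->
  (forall n, Cc (f n)) -> (forall n x, 0 <= f n x) -> 0 < e ->
  (forall x, ((g x)%:E <= \sum_(n <oo) (f n x)%:E)%E) ->
  exists N, forall x, g x <= \sum_(n < N) f n x + e.
Proof.
move=> [cg [S [cS g0]]] Cf f0 e0 gf.
have /compact_near_coveringP ncS := cS.
pose P N x := g x <= \sum_(n < N) f n x + e.
have [|N _ NP] := ncS nat \oo P _; last first.
  exists N => x; have [Sx|nSx] := pselect (S x); first exact: NP (leqnn N) _ Sx.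
  by rewrite g0//; apply: addr_ge0; [apply: sumr_ge0|exact: ltW].
move=> x Sx.
have [N0 gN0] : exists N0, g x < \sum_(n < N0) f n x + e.
  apply: contrapT => /forallNP H.
  have {}H N : \sum_(n < N) f n x + e <= g x by rewrite leNgt; apply/negP.
  have : (\sum_(n <oo) (f n x)%:E <= (g x - e)%:E)%E.
    apply: lime_le; first by apply: is_cvg_nneseries => n _ _; rewrite lee_fin.
    by apply: nearW => N; rewrite sumEFin lee_fin lerBrDr big_mkord.
  by move=> /(le_trans (gf x)); rewrite lee_fin; lra.
exists ([set y | g y < \sum_(n < N0) f n y + e], [set N | (N0 <= N)%N]) => /=.
  split; last by exists N0.
  have : {for x, continuous (fun y => \sum_(n < N0) f n y + e - g y)}.
    apply: cvgB; last exact: cg.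
    apply: cvgD; last exact: cvg_cst.
    exact: (Cc_sum N0 Cf).1.
  move=> /cvgr_gt /(_ 0) /=; rewrite subr_gt0 => /(_ gN0).
  by apply: filterS => y /=; rewrite subr_gt0.
move=> [y N] /= [gy N0N]; rewrite /P; apply: le_trans (ltW gy) _.
rewrite lerD2r -!(big_mkord xpredT (fun n => f n y)).
rewrite [leRHS](big_cat_nat _ N0N)//= lerDl sumr_ge0//.
Qed.

End CompactSupport.

(** The last field holds positivity ([e = 0]) and total mass at most one in a single inequality. *)
Record Cc_functional (R : realType) (T : topologicalType) := CcFunctional {
  Cc_fun :> (T -> R) -> R ;
  Cc_funD : forall f g, Cc f -> Cc g -> Cc_fun (fun x => f x + g x) = Cc_fun f + Cc_fun g ;
  Cc_funZ : forall a f, Cc f -> Cc_fun (fun x => a * f x) = a * Cc_fun f ;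
  Cc_fun_le : forall f e, Cc f -> 0 <= e -> (forall x, f x <= e) -> Cc_fun f <= e
}.

Section RieszOuter.
Context {R : realType} {T : ptopologicalType} (L : Cc_functional R T).


Lemma Cc_funB (f g : T -> R) : Cc f -> Cc g -> L (fun x => f x - g x) = L f - L g.
Proof.
move=> Cf Cg; have := Cc_funD L Cf (CcZ (-1) Cg); rewrite Cc_funZ// mulN1r => <-.
by congr (L _); apply/funext => x; rewrite mulN1r.
Qed.

Lemma Cc_fun_homo (f g : T -> R) : Cc f -> Cc g -> (forall x, f x <= g x) -> L f <= L g.
Proof.
move=> Cf Cg fg; rewrite -subr_le0 -Cc_funB//; apply: Cc_fun_le => //.
  exact: CcB.
by move=> x; rewrite subr_le0.
Qed.

Lemma Cc_fun0 : L (fun=> 0) = 0.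
Proof.
rewrite -[RHS](mul0r (L (fun=> 0))) -Cc_funZ; last exact: Cc0.
by congr (L _); apply/funext => x; rewrite mul0r.
Qed.

Lemma Cc_fun_ge0 (f : T -> R) : Cc f -> (forall x, 0 <= f x) -> 0 <= L f.
Proof. by move=> Cf f0; rewrite -Cc_fun0; apply: Cc_fun_homo => //; exact: Cc0. Qed.

Lemma Cc_fun_sum (f : nat -> T -> R) N : (forall n, Cc (f n)) ->
  L (fun x => \sum_(n < N) f n x) = \sum_(n < N) L (f n).
Proof.
move=> Cf; elim: N => [|N IH].
  by rewrite big_ord0 -[RHS]Cc_fun0; congr (L _); apply/funext => x; rewrite big_ord0.
rewrite big_ord_recr/= -IH -Cc_funD//; last exact: Cc_sum.
by congr (L _); apply/funext => x; rewrite big_ord_recr.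
Qed.

(* Dini's theorem makes L sigma-subadditive. *)
Lemma Cc_fun_le_nneseries (g : T -> R) (f : nat -> T -> R) : Cc g ->
  (forall n, Cc (f n)) -> (forall n x, 0 <= f n x) ->
  (forall x, ((g x)%:E <= \sum_(n <oo) (f n x)%:E)%E) ->
  ((L g)%:E <= \sum_(n <oo) (L (f n))%:E)%E.
Proof.
move=> Cg Cf f0 gf; apply/lee_addgt0Pr => e e0.
have [N gN] := Cc_dini Cg Cf f0 e0 gf.
apply: (@le_trans _ _ ((\sum_(n < N) L (f n))%:E + e%:E)%E).
  rewrite -EFinD lee_fin addrC -lerBlDr -(Cc_fun_sum N Cf) -Cc_funB//; last exact: Cc_sum.
  apply: Cc_fun_le; [exact: CcB (Cc_sum _ _)|exact: ltW|].
  by move=> x; rewrite lerBlDr addrC.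
rewrite leeD2r// -sumEFin -(big_mkord xpredT (fun n => (L (f n))%:E)).
by apply: nneseries_lim_ge => n _; rewrite lee_fin Cc_fun_ge0.
Qed.

(** Sets are covered by series of functions instead of open sets. Covers can then be merged for
    subadditivity and multiplied by a function for the Carathéodory splitting, and [L] applies to
    them directly. *)
Definition Cc_cover (A : set T) (f : nat -> T -> R) :=
  [/\ forall n, Cc (f n), forall n x, 0 <= f n x &
    forall x, A x -> (1 <= \sum_(n <oo) (f n x)%:E)%E].

Definition riesz_outer (A : set T) : \bar R :=
  ereal_inf [set (\sum_(n <oo) (L (f n))%:E)%E | f in Cc_cover A].

Local Open Scope ereal_scope.

Lemma Cc_fun_nneseries_ge0 (f : nat -> T -> R) : (forall n, Cc (f n)) ->
  (forall n x, 0 <= f n x)%R -> 0 <= \sum_(n <oo) (L (f n))%:E.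
Proof.
by move=> Cf f0; apply: nneseries_ge0 => n _ _; rewrite lee_fin Cc_fun_ge0.
Qed.

Lemma riesz_outer_le A (f : nat -> T -> R) : Cc_cover A f -> riesz_outer A <= \sum_(n <oo) (L (f n))%:E.
Proof. by move=> Af; apply: ereal_inf_lbound; exists f. Qed.

Lemma riesz_outer_ge0 A : 0 <= riesz_outer A.
Proof. by apply: le_ereal_inf_tmp => _ [f [Cf f0 _] <-]; exact: Cc_fun_nneseries_ge0. Qed.

Lemma riesz_outer0 : riesz_outer set0 = 0.
Proof.
apply/eqP; rewrite eq_le riesz_outer_ge0 andbT.
apply: le_trans (@riesz_outer_le _ (fun _ _ => 0%R) _) _.
  by split => // _; exact: Cc0.
by rewrite eseries0// => n _ _; rewrite Cc_fun0.
Qed.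

Lemma le_riesz_outer : {homo riesz_outer : A B / A `<=` B >-> A <= B}.
Proof.
move=> A B AB; apply: ereal_inf_le_tmp => _ [f [Cf f0 Bf] <-]; exists f => //.
by split => // x /AB; exact: Bf.
Qed.

Lemma riesz_outer_sigma_subadditive : sigma_subadditive riesz_outer.
Proof.
move=> A; have [[i ioo]|] := pselect (exists i, riesz_outer (A i) = +oo).
  rewrite (eseries_pinfty _ _ ioo) ?leey// => n _.
  by rewrite -ltNye (lt_le_trans _ (riesz_outer_ge0 _)).
rewrite -forallNE => Aoo; apply/lee_addgt0Pr => e e0.
apply: le_trans (epsilon_trick _ (fun n => riesz_outer_ge0 (A n)) (ltW e0)).
have [G GP] : {G : nat -> nat -> T -> R & forall n, Cc_cover (A n) (G n) /\
    \sum_(k <oo) (L (G n k))%:E <= riesz_outer (A n) + (e / (2 ^ n.+1)%:R)%:E}.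
  apply: (@choice _ _ (fun n g => Cc_cover (A n) g /\
    \sum_(k <oo) (L (g k))%:E <= riesz_outer (A n) + (e / (2 ^ n.+1)%:R)%:E)) => n.
  have rn : riesz_outer (A n) \is a fin_num.
    by rewrite ge0_fin_numE ?riesz_outer_ge0// ltey; apply/eqP; exact: Aoo.
  have en : (0 < e / (2 ^ n.+1)%:R)%R by rewrite divr_gt0// ltr0n expn_gt0.
  have [_ [g Ag <-] gle] := lb_ereal_inf_adherent en rn.
  by exists g; split => //; exact: ltW.
have [h hE] := @nneseries_pair R.
apply: (@le_trans _ _ (\sum_(n <oo) \sum_(k <oo) (L (G n k))%:E)); last first.
  apply: lee_nneseries => [n _ _|n _]; last exact: (GP n).2.
  by apply: Cc_fun_nneseries_ge0; case: (GP n) => -[].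
rewrite -(hE (fun n k => (L (G n k))%:E)); last first.
  by move=> n k; case: (GP n) => -[C0 G0 _] _; rewrite lee_fin Cc_fun_ge0.
apply: (@riesz_outer_le _ (fun i => G (h i).1 (h i).2)); split.
- by move=> i; case: (GP (h i).1) => -[].
- by move=> i x; case: (GP (h i).1) => -[].
- move=> x [n _ Anx]; rewrite (hE (fun n k => (G n k x)%:E)); last first.
    by move=> j k; case: (GP j) => -[_ G0 _] _; rewrite lee_fin.
  have := (GP n).1; move=> [_ _ /(_ _ Anx)] /le_trans; apply.
  have G0 j k : 0 <= (G j k x)%:E by case: (GP j) => -[_ + _] _; rewrite lee_fin.
  have := @nneseries_lim_ge R (fun n => \sum_(k <oo) (G n k x)%:E) xpredT 0 n.+1.
  rewrite big_nat_recr//=; move=> H; apply: le_trans (H _).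
    by rewrite leeDr// sume_ge0// => j _; apply: nneseries_ge0.
  by move=> j _ _; apply: nneseries_ge0.
Qed.

HB.instance Definition _ := isOuterMeasure.Build R T riesz_outer
  riesz_outer0 riesz_outer_ge0 le_riesz_outer riesz_outer_sigma_subadditive.

End RieszOuter.

Section RieszCaratheodory.
Context {R : realType} {T : ptopologicalType} (L : Cc_functional R T).

Section Ramp.
Variables (h : T -> R) (ch : continuous h) (h0 : forall x, 0 <= h x).

Let hk k x : R := Num.min 1 (k%:R * h x).
Let chk k : continuous (hk k).
Proof.
move=> x; apply: (@continuous_min _ _ (fun=> 1) (fun x => k%:R * h x)); first exact: cvg_cst.
by apply: cvgM; [exact: cvg_cst|exact: ch].
Qed.
Let hk0 x : hk 0 x = 0. Proof. by rewrite /hk mul0r min_r. Qed.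
Let hk1 k x : hk k x <= 1. Proof. by rewrite /hk ge_min lexx. Qed.
Let hk_ge0 k x : 0 <= hk k x. Proof. by rewrite /hk le_min ler01 mulr_ge0. Qed.
Let hkS k x : hk k x <= hk k.+1 x.
Proof.
by rewrite /hk le_min ge_min lexx/= ge_min ler_wpM2r ?orbT// ler_nat.
Qed.
Let hk_eq1 x : 0 < h x -> exists K, forall k, (K <= k)%N -> hk k x = 1.
Proof.
move=> hx; exists (Num.truncn (h x)^-1).+1 => k Kk; rewrite /hk min_l//.
rewrite -ler_pdivrMr// div1r.
apply: (@le_trans _ _ (Num.truncn (h x)^-1).+1%:R); last by rewrite ler_nat.
by apply/ltW/truncnS_gt.
Qed.

Local Open Scope ereal_scope.

(** The functions [hk k] increase from 0 to the indicator of [{h > 0}]. Given a cover [f] of [X],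
    the products of the [f n] with the increments of [hk] cover the part in [{h > 0}], and the
    products [(1 - hk (K n)) * f n] cover the rest, where [h] vanishes. For [K n] large the two
    costs add up to nearly that of [f]. *)
Lemma riesz_outer_caratheodory_pos :
  (riesz_outer L).-caratheodory [set x | (0 < h x)%R].
Proof.
apply: le_caratheodory_measurable => X.
apply: le_ereal_inf_tmp => _ [f [Cf f0 Xf] <-].
pose d k x : R := (hk k.+1 x - hk k x)%R.
have cd k : continuous (d k) by move=> x; apply: cvgB; exact: chk.
have d0 k x : (0 <= d k x)%R by rewrite subr_ge0.
have sumd K x : (\sum_(k < K) d k x = hk K x)%R.
  elim: K => [|K IH]; first by rewrite big_ord0 hk0.
  by rewrite big_ord_recr/= IH /d addrC subrK.
have Cdf k n : Cc (fun x => d k x * f n x)%R by exact: CcMl.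
have df0 k n x : (0 <= d k x * f n x)%R by rewrite mulr_ge0.
have Ckf k n : Cc (fun x => hk k x * f n x)%R by exact: CcMl.
have Ldf K n : (\sum_(k < K) L (fun x => d k x * f n x)%R = L (fun x => hk K x * f n x)%R)%R.
  rewrite -(@Cc_fun_sum _ _ L (fun k x => d k x * f n x)%R)//.
  by congr (L _); apply/funext => x; rewrite -mulr_suml sumd.
pose A n := \sum_(k <oo) (L (fun x => d k x * f n x)%R)%:E.
have A0 n : 0 <= A n by exact: Cc_fun_nneseries_ge0.
have is_cvgA n : cvgn (fun K => \sum_(0 <= k < K) (L (fun x => d k x * f n x)%R)%:E).
  by apply: is_cvg_nneseries => k _ _; rewrite lee_fin Cc_fun_ge0.
have AL n : A n <= (L (f n))%:E.
  apply: lime_le => //; apply: nearW => K.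
  rewrite big_mkord sumEFin Ldf lee_fin; apply: Cc_fun_homo => // x.
  by rewrite ler_piMl.
apply/lee_addgt0Pr => e e0.
have en n : (0 < e / (2 ^ n.+1)%:R)%R by rewrite divr_gt0// ltr0n expn_gt0.
(* The partial sums of [A n] are the values of [L] at [hk K * f n]. If no [K] came within the error
   allotted to [n], then [A n] would be at most itself minus that error. *)
have [K KP] : {K : nat -> nat & forall n,
    A n <= (L (fun x => hk (K n) x * f n x)%R + e / (2 ^ n.+1)%:R)%:E}.
  apply: (@choice _ _ (fun n K => A n <= (L (fun x => hk K x * f n x)%R + e / (2 ^ n.+1)%:R)%:E)).
  move=> n; apply: contrapT => /forallNP H.
  have : A n <= A n - (e / (2 ^ n.+1)%:R)%:E.
    apply: lime_le => //; apply: nearW => K.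
    rewrite leeBrDr// big_mkord sumEFin Ldf -EFinD.
    by apply/ltW; rewrite ltNge; apply/negP; exact: H.
  have [r ->] : exists r, A n = r%:E.
    exists (fine (A n)); rewrite fineK// ge0_fin_numE//.
    exact: le_lt_trans (AL n) (ltry _).
  rewrite -EFinB lee_fin; have := en n; lra.
have [p pE] := @nneseries_pair R.
have H1 : riesz_outer L (X `&` [set x | (0 < h x)%R]) <= \sum_(n <oo) A n.
  rewrite -(pE (fun n k => (L (fun x => d k x * f n x)%R)%:E)); last first.
    by move=> n k; rewrite lee_fin Cc_fun_ge0.
  apply: (@riesz_outer_le _ _ _ _ (fun i x => d (p i).2 x * f (p i).1 x)%R).
  split => // x [Xx hx].
  rewrite (pE (fun n k => (d k x * f n x)%:E)); last by move=> n k; rewrite lee_fin.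
  rewrite (_ : \sum_(n <oo) _ = \sum_(n <oo) (f n x)%:E); first exact: Xf.
  apply: eq_eseriesr => n _; apply/cvg_lim => //; apply: cvg_near_cst.
  have [K0 K0P] := hk_eq1 hx; exists K0 => // k /= /K0P hkx.
  by rewrite big_mkord sumEFin -mulr_suml sumd hkx mul1r.
have C1 n : Cc (fun x => (1 - hk (K n) x) * f n x)%R.
  by apply: CcMl => // x; apply: cvgB; [exact: cvg_cst|exact: chk].
have H2 : riesz_outer L (X `&` ~` [set x | (0 < h x)%R]) <=
    \sum_(n <oo) (L (fun x => (1 - hk (K n) x) * f n x)%R)%:E.
  apply: (@riesz_outer_le _ _ _ _ (fun n x => (1 - hk (K n) x) * f n x)%R); split => //.
    by move=> n x; rewrite mulr_ge0// subr_ge0.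
  move=> x [Xx /= /negP]; rewrite -leNgt => hx.
  have hx0 : h x = 0%R by apply/eqP; rewrite eq_le hx h0.
  have hk0x k : hk k x = 0%R by rewrite /hk hx0 mulr0 min_r.
  by under eq_eseriesr do rewrite hk0x subr0 mul1r; exact: Xf.
apply: le_trans (leeD H1 H2) _; rewrite -nneseriesD//; last first.
  move=> n _ _; rewrite lee_fin Cc_fun_ge0// => x; by rewrite mulr_ge0// subr_ge0.
apply: le_trans (epsilon_trick _ _ (ltW e0)); last first.
  by move=> n; rewrite lee_fin Cc_fun_ge0.
apply: lee_nneseries => [n _ _|n _].
  by rewrite adde_ge0// lee_fin Cc_fun_ge0// => x; rewrite mulr_ge0// subr_ge0.
have -> : L (fun x => (1 - hk (K n) x) * f n x)%R =
    (L (f n) - L (fun x => hk (K n) x * f n x))%R.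
  rewrite -Cc_funB//; congr (L _); apply/funext => x; ring.
apply: (le_trans (leeD2r _ (KP n))); rewrite -!EFinD lee_fin; lra.
Qed.

End Ramp.
End RieszCaratheodory.

Lemma continuous_contract (R : realType) : continuous (@contract R).
Proof.
move=> x; apply/cvgrPdist_lt => e e0.
have : nbhs x (ball x e) by exact: nbhsx_ballx.
by apply: filterS => y; rewrite /ball/= /ereal_ball.
Qed.

(** The distance to the complement is an extended real, infinite when the complement is empty;
    [contract] brings it back to the reals without changing its sign. *)
Lemma open_positivity_set (R : realType) (T : pseudoMetricType R) (U : set T) :
  open U -> exists h : T -> R,
  [/\ continuous h, forall x, 0 <= h x & U = [set x | 0 < h x]].
Proof.
move=> oU; exists (fun x => contract (edist_inf (~` U) x)).
have h0 x : 0 <= contract (edist_inf (~` U) x).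
  by rewrite -(contract0 R) le_contract edist_inf_ge0.
split => //.
  move=> x; apply: continuous_comp; last exact: continuous_contract.
  exact: edist_inf_continuous.
apply/seteqP; split => x /=.
  move=> Ux; rewrite -(contract0 R) lt_contract.
  have /nbhs_ballP[e /= e0 eU] : nbhs x U by exact: open_nbhs_nbhs.
  apply: (@lt_le_trans _ _ e%:E); first by rewrite lte_fin.
  apply: le_ereal_inf_tmp => _ [a nUa <-]; rewrite leNgt; apply/negP => /edist_lt_ball/=.
  by move=> /eU.
move=> hx; apply: contrapT => nUx; move: hx.
by rewrite edist_inf0// contract0 ltxx.
Qed.

Section RieszMeasure.
Context {R : realType} {T : pseudoPMetricType R} (L : Cc_functional R T).

Lemma open_sub_caratheodory :
  <<s @open T >> `<=` (riesz_outer L).-cara.-measurable.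
Proof.
apply: smallest_sub.
  split; first exact: caratheodory_measurable_set0.
    by move=> A mA; rewrite setTD; exact: caratheodory_measurable_setC.
  by move=> A mA; exact: caratheodory_measurable_bigcup.
move=> U /open_positivity_set[h [ch h0 ->]].
exact: riesz_outer_caratheodory_pos.
Qed.

Definition riesz_measure (A : set (g_sigma_algebraType (@open T))) : \bar R :=
  riesz_outer L A.

Let riesz_measure0 : riesz_measure set0 = 0%E. Proof. exact: riesz_outer0. Qed.

Let riesz_measure_ge0 A : (0 <= riesz_measure A)%E. Proof. exact: riesz_outer_ge0. Qed.

Let riesz_measure_semi_sigma_additive : semi_sigma_additive riesz_measure.
Proof.
move=> F mF tF mUF.
apply: (@caratheodory_measure_sigma_additive R T (riesz_outer L) F) => //.
  by move=> i; exact: (open_sub_caratheodory (mF i)).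
exact: (open_sub_caratheodory mUF).
Qed.

HB.instance Definition _ := isMeasure.Build _ _ _ riesz_measure
  riesz_measure0 riesz_measure_ge0 riesz_measure_semi_sigma_additive.

(** The increments of [chi] cover the whole space, and their partial sums telescope to functions at
    most 1, on which [L] is at most 1. *)
Lemma riesz_measure_le (chi : nat -> T -> R) :
  (forall n, Cc (chi n)) -> (forall n x, chi n x <= chi n.+1 x) ->
  (forall n x, chi n x <= 1) -> (forall x, chi 0 x = 0) ->
  (forall x, exists n, chi n x = 1) -> (riesz_measure setT <= 1)%E.
Proof.
move=> Cchi chiS chi1 chi0 chi_eq1.
pose f n x := chi n.+1 x - chi n x.
have Cf n : Cc (f n) by exact: CcB.
have f0 n x : 0 <= f n x by rewrite subr_ge0.
have sumf N x : \sum_(n < N) f n x = chi N x.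
  elim: N => [|N IH]; first by rewrite big_ord0 chi0.
  by rewrite big_ord_recr/= IH /f addrC subrK.
apply: (@le_trans _ _ (\sum_(n <oo) (L (f n))%:E)%E).
  apply: riesz_outer_le; split => // x _.
  have [N chiN] := chi_eq1 x; rewrite -chiN -sumf -sumEFin -(big_mkord xpredT (fun n => (f n x)%:E)).
  by apply: nneseries_lim_ge => n _; rewrite lee_fin.
apply: lime_le.
  by apply: is_cvg_nneseries => n _ _; rewrite lee_fin Cc_fun_ge0.
apply: nearW => N; rewrite big_mkord sumEFin -Cc_fun_sum// lee_fin.
by apply: Cc_fun_le => //; [exact: Cc_sum|move=> x; rewrite sumf].
Qed.

(** For any cover [g] of [A], the function [f] lies below the series of the [e * g n] everywhere, so
    the sigma-subadditivity of [L] applies. *)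
Lemma riesz_measure_ge (f : T -> R) (A : set T) (e : R) : 0 < e -> Cc f ->
  (forall x, 0 <= f x) -> (forall x, f x <= e) -> (forall x, ~ A x -> f x = 0) ->
  ((L f)%:E <= e%:E * riesz_measure A)%E.
Proof.
move=> e0 Cf f0 fe fA; rewrite -lee_pdivrMl//; apply: le_ereal_inf_tmp => _ [g [Cg g0 Ag] <-].
rewrite lee_pdivrMl// -nneseriesZl; last by move=> n _; rewrite lee_fin Cc_fun_ge0.
under eq_eseriesr do rewrite -EFinM -Cc_funZ//.
apply: Cc_fun_le_nneseries => // [n|n x|x]; first exact: CcZ.
  by rewrite mulr_ge0// ltW.
under eq_eseriesr do rewrite EFinM.
rewrite nneseriesZl; last by move=> n _; rewrite lee_fin.
have [Ax|nAx] := pselect (A x).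
  apply: (@le_trans _ _ (e%:E * 1)%E); first by rewrite mule1 lee_fin.
  by rewrite lee_pmul2l//; exact: Ag.
rewrite fA//; apply: mule_ge0; first by rewrite lee_fin ltW.
by apply: nneseries_ge0 => n _ _; rewrite lee_fin.
Qed.

(** The single function [f / e], followed by zeros, is a cover of [A]. *)
Lemma riesz_measure_le_fun (f : T -> R) (A : set T) (e : R) : 0 < e -> Cc f ->
  (forall x, 0 <= f x) -> (forall x, A x -> e <= f x) ->
  (e%:E * riesz_measure A <= (L f)%:E)%E.
Proof.
move=> e0 Cf f0 Af; rewrite -lee_pdivlMl// -EFinM -Cc_funZ//.
pose g n := if n is 0%N then (fun x => e^-1 * f x) else fun=> 0.
rewrite (_ : (L _)%:E = \sum_(n <oo) (L (g n))%:E)%E.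
  apply: riesz_outer_le; split.
  - by move=> [|n]; [exact: CcZ|exact: Cc0].
  - by move=> [|n] x //=; rewrite mulr_ge0// invr_ge0 ltW.
  - move=> x Ax; rewrite nneseries_recl//=; last first.
      by move=> [|n] //=; rewrite lee_fin mulr_ge0// invr_ge0 ltW.
    rewrite eseries_cond/= eseries0 ?adde0; last by case.
    by rewrite lee_fin mulrC ler_pdivlMr// mul1r Af.
rewrite nneseries_recl//=; last first.
  move=> [|n] /=; rewrite lee_fin; last by rewrite Cc_fun0.
  by rewrite Cc_fun_ge0//; [exact: CcZ|move=> x; rewrite mulr_ge0// invr_ge0 ltW].
by rewrite eseries_cond/= eseries0 ?adde0//; case=> // n _ _; rewrite Cc_fun0.
Qed.

End RieszMeasure.

Section RieszIntegral.
Context {R : realType} {T : pseudoPMetricType R} (L : Cc_functional R T).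
Local Notation mu := (riesz_measure L).
Hypothesis mu1 : (mu setT <= 1)%E.

(* Slicing f at the levels i e: each slice is squeezed between e 1_{f > (i+1) e}
   and e 1_{f > i e}, and both L and the integral respect this. *)
Lemma integral_riesz_measure (f : T -> R) : Cc f -> (forall x, 0 <= f x) ->
  (\int[mu]_x (f x)%:E = (L f)%:E)%E.
Proof.
move=> Cf f0; have [M fM] := Cc_bounded Cf.
suff H (e : R) : 0 < e -> (\int[mu]_x (f x)%:E <= (L f)%:E + e%:E)%E /\
    ((L f)%:E <= \int[mu]_x (f x)%:E + e%:E)%E.
  by apply/eqP; rewrite eq_le; apply/andP; split; apply/lee_addgt0Pr => e /H[].
move=> e0.
pose N := Num.bound `|M / e|.
have fN x : f x <= N%:R * e.
  apply: (le_trans (fM x)); rewrite -ler_pdivrMr//.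
  apply: le_trans (ler_norm _) _.
  exact/ltW/archi_boundP.
(* The part of [t] between the levels [i e] and [(i + 1) e]. *)
pose h (i : nat) (t : R) : R := Num.max 0 (Num.min e (t - i%:R * e)).
pose A (i : nat) := [set x | i%:R * e < f x].
have Cfi i : Cc (fun x => h i (f x)).
  apply: Cc_comp0 => //; last first.
    rewrite /h sub0r; apply/max_idPl; rewrite ge_min oppr_le0 mulr_ge0 ?orbT//.
    exact: ltW.
  move=> t; apply: (@continuous_max _ _ (fun=> 0) (fun t => Num.min e (t - i%:R * e))).
    exact: cvg_cst.
  apply: (@continuous_min _ _ (fun=> e) (fun t => t - i%:R * e)); first exact: cvg_cst.
  by apply: cvgB; [exact: cvg_id|exact: cvg_cst].
have hi0 i t : 0 <= h i t by rewrite le_max lexx.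
have hie i t : h i t <= e by rewrite ge_max (ltW e0) ge_min lexx.
have hiA i x : ~ A i x -> h i (f x) = 0.
  move=> /negP; rewrite -leNgt => fx; apply/max_idPl.
  by rewrite ge_min subr_le0 fx orbT.
have hiAS i x : A i.+1 x -> e <= h i (f x).
  rewrite /A/= -natr1 mulrDl mul1r => fx.
  by rewrite le_max le_min lexx/= lerBrDl; apply/orP; right; exact: ltW.
have sumh n (t : R) : 0 <= t -> \sum_(i < n) h i t = Num.min t (n%:R * e).
  move=> t0; elim: n => [|n IH]; first by rewrite big_ord0 mul0r min_r.
  rewrite big_ord_recr/= IH /h -natr1 mulrDl mul1r.
  rewrite /Num.min /Num.max; repeat case: ifPn; rewrite -?leNgt; lra.
have sumhf x : f x = \sum_(i < N) h i (f x) by rewrite sumh// min_l.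
have oA i : open (A i).
  rewrite /A (_ : [set _ | _] = f @^-1` [set t | i%:R * e < t])//.
  by apply: open_comp; [move=> x _; exact: Cf.1|exact: open_gt].
have mA i : measurable (A i : set (g_sigma_algebraType (@open T))).
  exact: sub_sigma_algebra.
have muA i : mu (A i) \is a fin_num.
  rewrite ge0_fin_numE//; apply: (@le_lt_trans _ _ (mu setT)).
    by apply: le_measure => //; rewrite inE.
  exact: le_lt_trans mu1 (ltry _).
pose m i := fine (mu (A i)).
have mE i : mu (A i) = (m i)%:E by rewrite fineK.
have m0 i : 0 <= m i by rewrite fine_ge0.
have m1 i : m i <= 1.
  rewrite -lee_fin -mE; apply: le_trans mu1.
  by apply: le_measure => //; rewrite inE.
have mf i : @measurable_fun _ _ (g_sigma_algebraType (@open T)) (\bar R) setT (fun x => (h i (f x))%:E).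
  by apply/measurable_EFinP; apply: continuous_measurable_fun_open (Cfi i).1.
have Le i : L (fun x => h i (f x)) <= e * m i.
  by rewrite -lee_fin EFinM -mE; apply: riesz_measure_ge => // x; exact: hiA.
have eL i : e * m i.+1 <= L (fun x => h i (f x)).
  by rewrite -lee_fin EFinM -mE; apply: riesz_measure_le_fun => // x; exact: hiAS.
have Ie i : (\int[mu]_x (h i (f x))%:E <= (e * m i)%:E)%E.
  rewrite EFinM -mE -[A i]setIT -integral_indic//.
  rewrite -ge0_integralZl//; last by rewrite lee_fin ltW.
    apply: ge0_le_integral => //.
    - by move=> x _; rewrite lee_fin.
    - by apply: measurable_funeM; apply/measurable_EFinP; exact: measurable_indic.
    - move=> x _; rewrite indicE -EFinM lee_fin.
      by case: (boolP (x \in _)) => [_|]; [rewrite mulr1|rewrite notin_setE => /hiA ->; rewrite mulr0].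
  by apply/measurable_EFinP; exact: measurable_indic.
have eI i : ((e * m i.+1)%:E <= \int[mu]_x (h i (f x))%:E)%E.
  rewrite EFinM -mE -[A _]setIT -integral_indic//.
  rewrite -ge0_integralZl//; last by rewrite lee_fin ltW.
    apply: ge0_le_integral => //.
    - by move=> x _; rewrite -EFinM lee_fin mulr_ge0// ltW.
    - by apply: measurable_funeM; apply/measurable_EFinP; exact: measurable_indic.
    - move=> x _; rewrite indicE -EFinM lee_fin.
      by case: (boolP (x \in _)) => [|_]; [rewrite inE mulr1 => /hiAS|rewrite mulr0].
  by apply/measurable_EFinP; exact: measurable_indic.
have LfE : L f = \sum_(i < N) L (fun x => h i (f x)).
  rewrite -(@Cc_fun_sum _ _ L (fun i x => h i (f x)))//.
  by congr (L _); apply/funext.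
have IfE : (\int[mu]_x (f x)%:E = \sum_(i < N) \int[mu]_x (h i (f x))%:E)%E.
  rewrite -ge0_integral_sum//; last by move=> i x _; rewrite lee_fin.
  by apply: eq_integral => x _; rewrite sumEFin -sumhf.
(* The upper and lower sums differ by [e (m 0 - m N)], at most [e] because the total mass is at most
   one. *)
have S10 : \sum_(i < N) e * m i <= \sum_(i < N) e * m i.+1 + e.
  have -> n : \sum_(i < n) e * m i = \sum_(i < n) e * m i.+1 + (e * m 0%N - e * m n).
    elim: n => [|n IH]; first by rewrite !big_ord0 subrr addr0.
    by rewrite !big_ord_recr/= IH; ring.
  have := m1 0%N; have := m0 N; nra.
split.
  rewrite IfE LfE -EFinD.
  apply: (@le_trans _ _ (\sum_(i < N) e * m i)%:E).
    by rewrite -sumEFin; apply: lee_sum => i _.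
  rewrite lee_fin; apply: le_trans S10 _; rewrite lerD2r; exact: ler_sum.
rewrite IfE LfE.
apply: (@le_trans _ _ (\sum_(i < N) e * m i)%:E).
  by rewrite lee_fin; apply: ler_sum => i _.
apply: (@le_trans _ _ ((\sum_(i < N) e * m i.+1)%:E + e%:E)%E); first by rewrite -EFinD lee_fin.
by rewrite leeD2r// -sumEFin; apply: lee_sum => i _.
Qed.

End RieszIntegral.

(** * Calculus on row vectors *)

Section Euclid.
Context {R : realType}.
Implicit Types d m : nat.

Lemma edotC d (u v : 'rV[R]_d) : edot u v = edot v u.
Proof. by apply: eq_bigr => i _; rewrite mulrC. Qed.

Lemma edotDl d (u v w : 'rV[R]_d) : edot (u + v) w = edot u w + edot v w.
Proof. by rewrite -big_split; apply: eq_bigr => i _; rewrite mxE mulrDl. Qed.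

Lemma edotZl d a (u w : 'rV[R]_d) : edot (a *: u) w = a * edot u w.
Proof. by rewrite mulr_sumr; apply: eq_bigr => i _; rewrite mxE mulrA. Qed.

Lemma edotDr d (u v w : 'rV[R]_d) : edot w (u + v) = edot w u + edot w v.
Proof. by rewrite edotC edotDl !(edotC w). Qed.

Lemma edotZr d a (u w : 'rV[R]_d) : edot w (a *: u) = a * edot w u.
Proof. by rewrite edotC edotZl edotC. Qed.

Lemma edotNl d (u w : 'rV[R]_d) : edot (- u) w = - edot u w.
Proof. by rewrite -scaleN1r edotZl mulN1r. Qed.

Lemma edotNr d (u w : 'rV[R]_d) : edot w (- u) = - edot w u.
Proof. by rewrite edotC edotNl edotC. Qed.

Lemma edot0r d (u : 'rV[R]_d) : edot u 0 = 0.
Proof. by apply: big1 => i _; rewrite mxE mulr0. Qed.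

Lemma edot0l d (u : 'rV[R]_d) : edot 0 u = 0.
Proof. by rewrite edotC edot0r. Qed.

Lemma edot_ge0 d (u : 'rV[R]_d) : 0 <= edot u u.
Proof. by apply: sumr_ge0 => i _; rewrite -expr2 sqr_ge0. Qed.

Lemma enorm_sqr d (u : 'rV[R]_d) : enorm u ^+ 2 = edot u u.
Proof. by rewrite sqr_sqrtr// edot_ge0. Qed.

Lemma enorm_ge0 d (u : 'rV[R]_d) : 0 <= enorm u.
Proof. exact: sqrtr_ge0. Qed.

Lemma enorm0 d : enorm (0 : 'rV[R]_d) = 0.
Proof. by rewrite /enorm edot0r sqrtr0. Qed.

Lemma enormZ d a (u : 'rV[R]_d) : enorm (a *: u) = `|a| * enorm u.
Proof.
by rewrite /enorm edotZl edotZr mulrA -expr2 sqrtrM ?sqr_ge0// sqrtr_sqr.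
Qed.

Lemma enorm_eq0 d (u : 'rV[R]_d) : enorm u = 0 -> u = 0.
Proof.
move=> u0; apply/rowP => i; rewrite mxE; apply/eqP; rewrite -sqrf_eq0 expr2.
have := enorm_sqr u; rewrite u0 expr0n/= => /esym/eqP.
by rewrite psumr_eq0 => [/allP/(_ i)|j _]; [rewrite mem_index_enum; exact|rewrite -expr2 sqr_ge0].
Qed.

Lemma edot_le_enorm d (u v : 'rV[R]_d) : `|edot u v| <= enorm u * enorm v.
Proof.
have [v0|v0] := eqVneq (enorm v) 0.
  by rewrite (enorm_eq0 v0) edot0r normr0 mulr_ge0// enorm_ge0.
have vp : 0 < enorm v ^+ 2 by rewrite exprn_even_gt0/=.
rewrite -(@ler_pXn2r _ 2)// ?nnegrE ?mulr_ge0 ?enorm_ge0// exprMn real_normK ?num_real//.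
have := edot_ge0 (enorm v ^+ 2 *: u - edot u v *: v).
rewrite edotDl !edotDr !edotNl !edotNr !edotZl !edotZr (edotC v u) -!enorm_sqr.
move: (edot u v) (enorm u) (enorm v) vp => p x y y0 H.
rewrite -(ler_pM2l y0); nra.
Qed.

Lemma coord_le_enorm d (u : 'rV[R]_d) i : `|u ord0 i| <= enorm u.
Proof.
rewrite -(@ler_pXn2r _ 2)// ?nnegrE ?enorm_ge0// enorm_sqr real_normK ?num_real//.
by rewrite /edot (bigD1 i)//= expr2 lerDl sumr_ge0// => j _; rewrite -expr2 sqr_ge0.
Qed.

Lemma continuous_addf (T : topologicalType) (f g : T -> R) :
  continuous f -> continuous g -> continuous (fun x => f x + g x).
Proof. by move=> cf cg x; apply: cvgD; [exact: cf|exact: cg]. Qed.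

Lemma continuous_mulf (T : topologicalType) (f g : T -> R) :
  continuous f -> continuous g -> continuous (fun x => f x * g x).
Proof. by move=> cf cg x; apply: cvgM; [exact: cf|exact: cg]. Qed.

Lemma continuous_compf (T : topologicalType) (f : T -> R) (h : R -> R) :
  continuous f -> (forall x, {for f x, continuous h}) -> continuous (fun x => h (f x)).
Proof. by move=> cf ch x; apply: continuous_comp; [exact: cf|exact: ch]. Qed.

Lemma continuous_sum (T : topologicalType) (I : Type) (r : seq I) (f : I -> T -> R) :
  (forall i, continuous (f i)) -> continuous (fun x => \sum_(i <- r) f i x).
Proof.
move=> cf; elim: r => [|i r IH].
  by under eq_fun do rewrite big_nil; move=> x; exact: cvg_cst.
under eq_fun do rewrite big_cons.
by move=> x; apply: cvgD; [exact: cf|exact: IH].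
Qed.

Lemma continuous_edot (T : topologicalType) d (f g : T -> 'rV[R]_d) :
  (forall i, continuous (fun x => f x ord0 i)) ->
  (forall i, continuous (fun x => g x ord0 i)) ->
  continuous (fun x => edot (f x) (g x)).
Proof.
by move=> cf cg; apply: continuous_sum => i x; apply: cvgM; [exact: cf|exact: cg].
Qed.

Lemma continuous_mulmx_coord (T : topologicalType) d m (f : T -> 'rV[R]_d)
    (A : T -> 'M[R]_(d, m)) :
  (forall i, continuous (fun x => f x ord0 i)) ->
  (forall i j, continuous (fun x => A x i j)) ->
  forall j, continuous (fun x => (f x *m A x) ord0 j).
Proof.
move=> cf cA j; under eq_fun do rewrite mxE.
by apply: continuous_sum => i x; apply: cvgM; [exact: cf|exact: cA].
Qed.

Lemma continuous_coord_comp (T : topologicalType) m n (f : T -> 'M[R]_(m, n)) i j :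
  continuous f -> continuous (fun x => f x i j).
Proof.
move=> cf x; apply: (@continuous_comp _ _ _ f (fun M : 'M[R]_(m, n) => M i j)); first exact: cf.
exact: coord_continuous.
Qed.

Lemma continuous_enorm d : continuous (@enorm R d).
Proof.
move=> x; apply: continuous_comp; last exact: sqrt_continuous.
by apply: continuous_edot => i; exact: coord_continuous.
Qed.

Lemma continuous_enorm_comp (T : topologicalType) d (f : T -> 'rV[R]_d) :
  (forall i, continuous (fun x => f x ord0 i)) -> continuous (fun x => enorm (f x)).
Proof.
move=> cf; apply: (@continuous_compf _ (fun x => edot (f x) (f x)) Num.sqrt).
  exact: continuous_edot.
by move=> x; exact: sqrt_continuous.
Qed.

Lemma open_oball d (r : R) : open (@oball R d r).
Proof.
rewrite (_ : oball r = enorm @^-1` [set t | t < r])//.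
by apply: open_comp; [move=> x _; exact: continuous_enorm|exact: open_lt].
Qed.

Lemma compact_cball d (r : R) : compact (@cball R d r).
Proof.
apply: bounded_closed_compact.
  exists r; split; first exact: num_real.
  move=> M rM x /= xr.
  rewrite [leLHS]/Num.norm/= mx_normrE.
  apply/bigmax_leP; split.
    by apply: le_trans (ltW rM); apply: le_trans xr; exact: enorm_ge0.
  by move=> [i j] _ /=; rewrite ord1; apply: le_trans (coord_le_enorm _ _) (le_trans xr (ltW rM)).
rewrite (_ : cball r = enorm @^-1` [set t | t <= r])//.
apply: closed_comp; last exact: closed_le.
by move=> x _; exact: continuous_enorm.
Qed.

(* With a = S S^T, [Gam S u v] is the pairing <u, a v>. *)
Definition Gam d m (S : 'M[R]_(d, m)) (u v : 'rV[R]_d) : R := edot (u *m S) (v *m S).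

Lemma GamC d m (S : 'M[R]_(d, m)) u v : Gam S u v = Gam S v u.
Proof. exact: edotC. Qed.

Lemma GamDl d m (S : 'M[R]_(d, m)) u v w : Gam S (u + v) w = Gam S u w + Gam S v w.
Proof. by rewrite /Gam mulmxDl edotDl. Qed.

Lemma GamDr d m (S : 'M[R]_(d, m)) u v w : Gam S w (u + v) = Gam S w u + Gam S w v.
Proof. by rewrite /Gam mulmxDl edotDr. Qed.

Lemma GamZl d m (S : 'M[R]_(d, m)) a u w : Gam S (a *: u) w = a * Gam S u w.
Proof. by rewrite /Gam -scalemxAl edotZl. Qed.

Lemma GamZr d m (S : 'M[R]_(d, m)) a u w : Gam S w (a *: u) = a * Gam S w u.
Proof. by rewrite /Gam -scalemxAl edotZr. Qed.

Lemma GamNl d m (S : 'M[R]_(d, m)) u w : Gam S (- u) w = - Gam S u w.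
Proof. by rewrite -scaleN1r GamZl mulN1r. Qed.

Lemma GamNr d m (S : 'M[R]_(d, m)) u w : Gam S w (- u) = - Gam S w u.
Proof. by rewrite -scaleN1r GamZr mulN1r. Qed.

Lemma Gam0r d m (S : 'M[R]_(d, m)) u : Gam S u 0 = 0.
Proof. by rewrite -(scale0r 0) GamZr mul0r. Qed.

Lemma Gam_ge0 d m (S : 'M[R]_(d, m)) u : 0 <= Gam S u u.
Proof. exact: edot_ge0. Qed.

Lemma enorm_mulmx_sqr d m (S : 'M[R]_(d, m)) u : enorm (u *m S) ^+ 2 = Gam S u u.
Proof. exact: enorm_sqr. Qed.

Lemma edot_mulmx_tr d m (u : 'rV[R]_m) (S : 'M[R]_(d, m)) (v : 'rV[R]_d) :
  edot (u *m S^T) v = edot u (v *m S).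
Proof.
rewrite /edot.
under eq_bigr do rewrite mxE mulr_suml.
rewrite exchange_big/=; apply: eq_bigr => k _.
rewrite mxE mulr_sumr; apply: eq_bigr => i _; rewrite mxE; ring.
Qed.

Lemma edot_diffm d m (S : 'rV[R]_d -> 'M[R]_(d, m)) x u v :
  edot (u *m diffm S x) v = Gam (S x) u v.
Proof. by rewrite /diffm mulmxA edot_mulmx_tr. Qed.

Lemma sum_diffm d m (S : 'rV[R]_d -> 'M[R]_(d, m)) x (u v : 'rV[R]_d) :
  \sum_i \sum_j diffm S x i j * (u ord0 i * v ord0 j) = Gam (S x) u v.
Proof.
rewrite -edot_diffm /edot exchange_big/=; apply: eq_bigr => j _.
rewrite mxE mulr_suml; apply: eq_bigr => i _; ring.
Qed.

Lemma fnorm_ge_coord m n (A : 'M[R]_(m, n)) i j : `|A i j| <= fnorm A.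
Proof.
rewrite -(@ler_pXn2r _ 2)// ?nnegrE ?sqrtr_ge0// sqr_sqrtr; last first.
  by apply: sumr_ge0 => k _; apply: sumr_ge0 => l _; exact: sqr_ge0.
rewrite real_normK ?num_real// (bigD1 i)//= (bigD1 j)//= -addrA lerDl addr_ge0// sumr_ge0//.
  by move=> k _; exact: sqr_ge0.
by move=> k _; apply: sumr_ge0 => l _; exact: sqr_ge0.
Qed.

(* Cauchy-Schwarz on each column. *)
Lemma Gam_le_fnorm d m (S : 'M[R]_(d, m)) u : Gam S u u <= fnorm S ^+ 2 * enorm u ^+ 2.
Proof.
rewrite sqr_sqrtr; last first.
  by apply: sumr_ge0 => k _; apply: sumr_ge0 => l _; exact: sqr_ge0.
rewrite exchange_big/= mulr_suml /Gam /edot; apply: ler_sum => j _.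
have := edot_le_enorm u (\row_i S i j).
have -> : edot u (\row_i S i j) = (u *m S) ord0 j.
  by rewrite mxE; apply: eq_bigr => i _; rewrite mxE.
move=> /(lerXn2r 2); rewrite !nnegrE normr_ge0 mulr_ge0 ?enorm_ge0// => /(_ isT isT).
rewrite real_normK ?num_real// exprMn expr2 => /le_trans; apply.
rewrite mulrC (enorm_sqr (\row_i _)) ler_wpM2r ?sqr_ge0//.
by apply: ler_sum => i _; rewrite !mxE -expr2.
Qed.

End Euclid.

(** * Derivatives along lines *)

Section DirectionalDerivatives.
Context {R : realType}.

Lemma is_derive_line (V : normedModType R) (f : V -> R) (x v : V) (t df : R) :
  is_derive (x + t *: v) v f df -> is_derive t 1 (fun s => f (x + s *: v)) df.
Proof.
have E : (fun h : R => h^-1 *: (((fun s => f (x + s *: v)) \o shift t) (h *: 1) - f (x + t *: v))) =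
    (fun h : R => h^-1 *: ((f \o shift (x + t *: v)) (h *: v) - f (x + t *: v))).
  apply/funext => h; congr (_ *: (f _ - _)) => /=.
  by rewrite [h *: 1]mulr1 scalerDl addrCA.
by move=> [H1 H2]; split; [rewrite /derivable E|rewrite -H2 /derive E].
Qed.

(** Only the derivative of [f] in the direction [v] is assumed, so the chain rule is taken on the
    line [s ↦ x + s v]. *)
Lemma is_derive_compR (V : normedModType R) (f : V -> R) (T : R -> R) (x v : V) (df dT : R) :
  is_derive x v f df -> is_derive (f x) 1 T dT -> is_derive x v (T \o f) (dT * df).
Proof.
move=> df' dT'.
have H : is_derive (0 : R) 1 (T \o (fun s => f (x + s *: v))) (dT * df).
  apply: is_derive1_comp; first by rewrite scale0r addr0.
  by apply: is_derive_line; rewrite scale0r addr0.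
have E : (fun h : R => h^-1 *: (((T \o (fun s => f (x + s *: v))) \o shift 0) (h *: 1) -
      (T \o (fun s => f (x + s *: v))) 0)) =
    (fun h : R => h^-1 *: (((T \o f) \o shift x) (h *: v) - (T \o f) x)).
  apply/funext => h /=; congr (_ *: (_ - _)).
    by rewrite addr0 [h *: 1]mulr1 addrC.
  by rewrite scale0r addr0.
case: H => H1 H2; split; first by rewrite /derivable -E.
by rewrite -H2 /derive E.
Qed.

(** If [w2] were positive, [w1] would be positive just to the right of 0, and the mean value theorem
    would lift [w] above its maximum. *)
Lemma derive_at_local_max (w w1 : R -> R) (w2 : R) :
  (\forall s \near (0 : R), is_derive (s : R) (1 : R) w (w1 s)) -> is_derive (0 : R) 1 w1 w2 ->
  (\forall s \near (0 : R), w s <= w 0) -> w1 0 = 0 /\ w2 <= 0.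
Proof.
move=> /nbhs_ballP[r1 /= r10 dw] dw1 /nbhs_ballP[r2 /= r20 wmax].
pose r := Num.min r1 r2.
have r0 : 0 < r by rewrite lt_min r10.
have bE s : `|s| < r -> ball (0 : R) r1 s /\ ball (0 : R) r2 s.
  by rewrite lt_min => /andP[s1 s2]; rewrite /ball/= sub0r normrN.
have w10 : w1 0 = 0.
  have [||||_ E] := @derive1_at_max R w (- (r / 2)) (r / 2) 0.
  - lra.
  - move=> t; rewrite in_itv/= => /andP[t1 t2].
    have [|/dw + _] := bE t; first by rewrite ltr_norml; apply/andP; split; lra.
    by move=> -[].
  - by rewrite in_itv/=; apply/andP; split; lra.
  - move=> t; rewrite in_itv/= => /andP[t1 t2].
    have [|_ /wmax//] := bE t; by rewrite ltr_norml; apply/andP; split; lra.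
  - have [|/dw + _] := bE 0; first by rewrite normr0.
    by move=> [_ <-]; exact: E.
split => //; rewrite leNgt; apply/negP => w20.
have c1 : (fun h : R => h^-1 *: ((w1 \o shift 0) (h *: 1) - w1 0)) @ 0^' --> w2.
  by case: dw1 => + <-; rewrite /derivable /derive.
have := cvgr_gt _ c1 _ w20; rewrite near_withinE => /(_ _)/nbhs_ballP[r3 /= r30 H3].
pose s := Num.min r r3 / 2.
have m0 : 0 < Num.min r r3 by rewrite lt_min r0.
have s0 : 0 < s by rewrite /s; lra.
have sr : s < r by apply: (@lt_le_trans _ _ (Num.min r r3)); [rewrite /s; lra|rewrite ge_min lexx].
have sr3 : s < r3 by apply: (@lt_le_trans _ _ (Num.min r r3)); [rewrite /s; lra|rewrite ge_min lexx orbT].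
have dws t : t \in `[0, s] -> is_derive t 1 w (w1 t).
  rewrite in_itv/= => /andP[t1 t2].
  by have [|/dw + _] := bE t; first by rewrite ltr_norml; apply/andP; split; lra.
have dwo t : t \in `]0, s[ -> is_derive t 1 w (w1 t).
  by move=> /subset_itv_oo_cc; exact: dws.
have cw : {within `[0, s], continuous w}.
  apply: derivable_within_continuous => t ts.
  by case: (dws t ts).
have [c] := MVT s0 dwo cw.
rewrite in_itv/= => /andP[c0 cs] wsE.
have : 0 < c^-1 *: ((w1 \o shift 0) (c *: 1) - w1 0).
  apply: H3; last by rewrite gt_eqF.
  by rewrite /ball/= sub0r normrN gtr0_norm//; lra.
rewrite /= addr0 [c *: 1]mulr1 w10 subr0 => wc.
have wc0 : 0 < w1 c by rewrite -(@pmulr_rgt0 _ c^-1)// invr_gt0.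
have [|_ /wmax] := bE s; first by rewrite gtr0_norm.
rewrite -subr_le0 wsE subr0 leNgt => /negP; apply.
by rewrite mulr_gt0.
Qed.

End DirectionalDerivatives.

Section TotalDerivative.
Context {R : realType} {d : nat}.
Implicit Types (f : 'rV[R]_d -> R) (x v : 'rV[R]_d).

Let trunc (k : nat) v : 'rV[R]_d := \row_i (if (i < k)%N then v ord0 i else 0).

Let truncS k (kd : (k < d)%N) v :
  trunc k.+1 v = trunc k v + v ord0 (Ordinal kd) *: evec (Ordinal kd).
Proof.
apply/rowP => i; rewrite !mxE eqxx/= ltnS leq_eqVlt -val_eqE/=.
case: eqVneq => [ik|_]; last by rewrite mulr0 addr0.
by rewrite ik ltnn add0r mulr1; congr (v _ _); apply/val_inj.
Qed.

Let trunc_full v : trunc d v = v.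
Proof. by apply/rowP => i; rewrite mxE ltn_ord. Qed.

Let mem_ball_coord (x y : 'rV[R]_d) (r : R) : 0 < r -> (forall i, `|x ord0 i - y ord0 i| < r) -> ball x r y.
Proof. by move=> r0 H; rewrite /ball/=; split => // i j; rewrite ord1; exact: H. Qed.

(* Moving one coordinate at a time and using the mean value theorem. *)
Lemma taylor1 f x (e : R) : 0 < e ->
  (\forall y \near x, forall i, derivable f y (evec i)) ->
  (forall i, {for x, continuous (partial i f)}) ->
  nbhs (0 : 'rV[R]_d) [set v : 'rV[R]_d |
    `|f (x + v) - f x - edot v (grad f x)| <= e * \sum_i `|v ord0 i|].
Proof.
move=> e0 df cf.
have : \forall y \near x, (forall i, derivable f y (evec i)) /\
    forall i, `|partial i f x - partial i f y| < e.
  apply: filterI; first exact: df.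
  refine (@filter_forall _ _ (fun i y => `|partial i f x - partial i f y| < e) (nbhs x) _ _) => i.
  by move/cvgrPdist_lt : (cf i) => /(_ e e0).
move=> /nbhs_ballP[r /= r0 H].
apply/nbhs_ballP; exists r => // v /= vr.
have vi i : `|v ord0 i| < r.
  by have := vr.2 ord0 i; rewrite /ball/= mxE sub0r normrN.
suff main k : (k <= d)%N ->
    `|f (x + trunc k v) - f x - edot (trunc k v) (grad f x)| <= e * \sum_i `|trunc k v ord0 i|.
  by have := main d (leqnn d); rewrite trunc_full.
elim: k => [_|k IH kd].
  have -> : trunc 0 v = 0 by apply/rowP => i; rewrite !mxE.
  by rewrite addr0 subrr edot0l subrr normr0; apply: mulr_ge0; [exact: ltW|exact: sumr_ge0].
have {}IH := IH (ltnW kd).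
set i0 := Ordinal kd; set a : R := v ord0 i0.
pose y0 : 'rV[R]_d := x + trunc k v.
(* Balls are those of the sup norm, so a path that switches on one coordinate of [v] at a time stays
   in the ball. *)
have Hy (t : R) : t \in `[0, 1] -> ball x r (y0 + t *: (a *: evec i0)).
  rewrite in_itv/= => /andP[t0 t1]; apply: mem_ball_coord => // i.
  rewrite /y0 !mxE eqxx/= opprD opprD addrA addrA subrr sub0r.
  rewrite -opprD normrN.
  case: (eqVneq i i0) => [->|_]/=.
    rewrite ltnn add0r mulr1 normrM (ger0_norm t0).
    by apply: le_lt_trans (vi i0); rewrite ler_piMl.
  rewrite mulr0 mulr0 addr0; case: ifP => _; first exact: vi.
  by rewrite normr0.
have dg (t : R) : t \in `[0, 1] ->
    is_derive (t : R) (1 : R) (fun s : R => f (y0 + s *: (a *: evec i0))) (a * partial i0 f (y0 + t *: (a *: evec i0))).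
  move=> /Hy/H[dfy _].
  have -> : (fun s : R => f (y0 + s *: (a *: evec i0))) =
      (fun s : R => f (y0 + s *: evec i0)) \o (fun s : R => s * a).
    by apply/funext => s /=; rewrite scalerA.
  rewrite mulrC; apply: is_derive1_comp; last first.
    have := @is_deriveM _ _ (id : R -> R) (cst a) t 1 1 0 (is_derive_id _ _) (is_derive_cst _ _ _).
    by rewrite scaler0 add0r [_ *: 1]mulr1.
  apply: is_derive_line; rewrite -scalerA.
  by apply: DeriveDef => //; exact: dfy.
have dgo (t : R) : t \in `]0, 1[ ->
    is_derive (t : R) (1 : R) (fun s : R => f (y0 + s *: (a *: evec i0))) (a * partial i0 f (y0 + t *: (a *: evec i0))).
  by move=> /subset_itv_oo_cc; exact: dg.
have cg : {within `[0, 1], continuous (fun s : R => f (y0 + s *: (a *: evec i0)))}.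
  by apply: derivable_within_continuous => t tI; case: (dg t tI).
have [t tI] := MVT_segment ler01 dgo cg.
rewrite scale1r scale0r addr0 subr0 mulr1 => E.
have eS : edot (trunc k.+1 v) (grad f x) = edot (trunc k v) (grad f x) + a * partial i0 f x.
  rewrite truncS edotDl edotZl; congr (_ + _ * _).
  rewrite /edot (bigD1 i0)//= big1 ?addr0; last first.
    by move=> i ii0; rewrite !mxE eqxx/= (negbTE ii0) mul0r.
  by rewrite !mxE !eqxx mul1r.
have sS : \sum_i `|trunc k.+1 v ord0 i| = \sum_i `|trunc k v ord0 i| + `|a|.
  rewrite (bigD1 i0)//= [X in _ = X + _](bigD1 i0)//= !mxE/= ltnSn ltnn normr0 add0r addrC.
  congr (_ + _); apply: eq_bigr => i ii0; rewrite !mxE ltnS leq_eqVlt.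
  by rewrite -val_eqE/= in ii0; rewrite (negbTE ii0).
rewrite eS sS truncS addrA -/y0 mulrDr.
have -> : f (y0 + a *: evec i0) - f x - (edot (trunc k v) (grad f x) + a * partial i0 f x) =
    (f y0 - f x - edot (trunc k v) (grad f x)) +
    a * (partial i0 f (y0 + t *: (a *: evec i0)) - partial i0 f x).
  by rewrite mulrBr -E; ring.
apply: le_trans (ler_normD _ _) _; apply: lerD => //.
rewrite normrM mulrC ler_wpM2r// distrC; apply/ltW.
by have [_] := H _ (Hy t tI); apply.
Qed.

(** [C2on] speaks of the coordinate directions only; continuity of the partial derivatives gives all
    the others, which the maximum principle needs. *)
Lemma is_derive_edot_grad f x v :
  (\forall y \near x, forall i, derivable f y (evec i)) ->
  (forall i, {for x, continuous (partial i f)}) ->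
  is_derive x v f (edot v (grad f x)).
Proof.
move=> df cf.
have c : (fun h : R => h^-1 *: ((f \o shift x) (h *: v) - f x)) @ 0^' --> edot v (grad f x).
  apply/cvgrPdist_le => e e0.
  pose S := \sum_i `|v ord0 i|.
  have S0 : 0 <= S by apply: sumr_ge0.
  have eS : 0 < e / (S + 1) by rewrite divr_gt0// ltr_wpDl.
  have := taylor1 eS df cf => T1.
  have : \forall h \near (0 : R), `|f (x + h *: v) - f x - edot (h *: v) (grad f x)| <=
      e / (S + 1) * \sum_i `|(h *: v) ord0 i|.
    have : (fun h : R => h *: v) @ (0 : R) --> (0 : 'rV[R]_d).
      by rewrite -[X in _ --> X](scale0r v); apply: cvgZr_tmp; exact: cvg_id.
    by move=> /(_ _ T1).
  move=> T2; rewrite near_withinE; apply: filterS T2 => h H h0.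
  have hn : 0 < `|h| by rewrite normr_gt0.
  rewrite /= (addrC _ x) distrC.
  have -> : h^-1 *: (f (x + h *: v) - f x) - edot v (grad f x) =
      h^-1 * (f (x + h *: v) - f x - edot (h *: v) (grad f x)).
    by rewrite edotZl [_ *: _]/(_ * _) mulrBr mulKf.
  rewrite normrM normfV ler_pdivrMl//; apply: le_trans H _.
  have -> : \sum_i `|(h *: v) ord0 i| = `|h| * S.
    by rewrite mulr_sumr; apply: eq_bigr => i _; rewrite mxE normrM.
  rewrite mulrCA ler_pM2l// -mulrA; apply: ler_piMr; first exact: ltW.
  by rewrite mulrC ler_pdivrMr ?mul1r; lra.
split; first by apply/cvg_ex; exists (edot v (grad f x)).
exact/cvg_lim.
Qed.

End TotalDerivative.

Section C2Calculus.
Context {R : realType} {d : nat}.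
Implicit Types (f g : 'rV[R]_d -> R) (x : 'rV[R]_d).
Local Notation C2 := (C2on (@setT 'rV[R]_d)).

Lemma within_setT_continuous f : {within setT, continuous f} <-> continuous f.
Proof.
rewrite (continuous_open_subspace f openT); split => [cf x|cf x _]; last exact: cf.
by apply: cf; rewrite in_setT.
Qed.

(* Not a class, unlike is_derive, so that "apply" leaves it as a goal. *)
Definition has_partial i f x (df : R) : Prop := is_derive x (evec i) f df.

(** Regularity and the formulas for the derivatives come out together, so each rule of calculus is
    proved once from explicit candidates [g] and [h]. *)
Lemma C2_intro f (g : 'I_d -> 'rV[R]_d -> R) (h : 'I_d -> 'I_d -> 'rV[R]_d -> R) :
  continuous f -> (forall i x, has_partial i f x (g i x)) ->
  (forall i, continuous (g i)) -> (forall i j x, has_partial j (g i) x (h i j x)) ->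
  (forall i j, continuous (h i j)) ->
  [/\ C2 f, forall i, partial i f = g i & forall i j, partial j (partial i f) = h i j].
Proof.
move=> cf df cg dg ch.
have pf i : partial i f = g i by apply/funext => x; case: (df i x).
have ppf i j : partial j (partial i f) = h i j.
  by rewrite pf; apply/funext => x; case: (dg i j x).
split => //; split.
- exact/within_setT_continuous.
- by move=> i x _; case: (df i x).
- by move=> i; rewrite pf; exact/within_setT_continuous.
- by move=> i j x _; rewrite pf; case: (dg i j x).
- by move=> i j; rewrite ppf; exact/within_setT_continuous.
Qed.

Section Elim.
Variables (f : 'rV[R]_d -> R) (C2f : C2 f).

Lemma C2_continuous : continuous f.
Proof. by apply/within_setT_continuous; case: C2f. Qed.

Lemma C2_is_derive i x : is_derive x (evec i) f (partial i f x).
Proof. by apply: DeriveDef => //; case: C2f => _ + _ _ _; apply. Qed.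

Lemma C2_continuous_partial i : continuous (partial i f).
Proof. by apply/within_setT_continuous; case: C2f. Qed.

Lemma C2_is_derive2 i j x : is_derive x (evec j) (partial i f) (partial j (partial i f) x).
Proof. by apply: DeriveDef => //; case: C2f => _ _ _ + _; apply. Qed.

Lemma C2_continuous_partial2 i j : continuous (partial j (partial i f)).
Proof. by apply/within_setT_continuous; case: C2f. Qed.

End Elim.

Lemma C2_cst (a : R) : [/\ C2 (fun=> a), forall i, partial i ((fun=> a) : 'rV[R]_d -> R) = (fun=> 0) &
  forall i j, partial j (partial i ((fun=> a) : 'rV[R]_d -> R)) = (fun=> 0)].
Proof.
apply: (@C2_intro (fun=> a) (fun _ _ => 0) (fun _ _ _ => 0)).
- exact: cst_continuous.
- by move=> i x; exact: (is_derive_cst a x (evec i)).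
- by move=> i; exact: cst_continuous.
- by move=> i j x; exact: (is_derive_cst (0 : R) x (evec j)).
- by move=> i j; exact: cst_continuous.
Qed.

Lemma C2D f g : C2 f -> C2 g -> [/\ C2 (fun x => f x + g x),
  forall i, partial i (fun x => f x + g x) = (fun x => partial i f x + partial i g x) &
  forall i j, partial j (partial i (fun x => f x + g x)) =
    (fun x => partial j (partial i f) x + partial j (partial i g) x)].
Proof.
move=> Cf Cg.
have cf := C2_continuous Cf; have cg := C2_continuous Cg.
have cf1 := C2_continuous_partial Cf; have cg1 := C2_continuous_partial Cg.
have cf2 := C2_continuous_partial2 Cf; have cg2 := C2_continuous_partial2 Cg.
apply: C2_intro.
- exact: continuous_addf.
- by move=> i x; exact: (is_deriveD (C2_is_derive Cf i x) (C2_is_derive Cg i x)).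
- by move=> i; exact: continuous_addf.
- by move=> i j x; exact: (is_deriveD (C2_is_derive2 Cf i j x) (C2_is_derive2 Cg i j x)).
- by move=> i j; exact: continuous_addf.
Qed.

Lemma C2M f g : C2 f -> C2 g -> [/\ C2 (fun x => f x * g x),
  forall i, partial i (fun x => f x * g x) = (fun x => f x * partial i g x + g x * partial i f x) &
  forall i j, partial j (partial i (fun x => f x * g x)) =
    (fun x => (f x * partial j (partial i g) x + partial i g x * partial j f x) +
              (g x * partial j (partial i f) x + partial i f x * partial j g x))].
Proof.
move=> Cf Cg.
have cf := C2_continuous Cf; have cg := C2_continuous Cg.
have cf1 := C2_continuous_partial Cf; have cg1 := C2_continuous_partial Cg.
have cf2 := C2_continuous_partial2 Cf; have cg2 := C2_continuous_partial2 Cg.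
apply: C2_intro.
- exact: continuous_mulf.
- by move=> i x; exact: (is_deriveM (C2_is_derive Cf i x) (C2_is_derive Cg i x)).
- by move=> i; apply: continuous_addf; exact: continuous_mulf.
- move=> i j x; exact: (is_deriveD
    (is_deriveM (C2_is_derive Cf j x) (C2_is_derive2 Cg i j x))
    (is_deriveM (C2_is_derive Cg j x) (C2_is_derive2 Cf i j x))).
- by move=> i j; apply: continuous_addf; apply: continuous_addf; exact: continuous_mulf.
Qed.

(** The outer function is constrained only at the values of [f], so that [ln] or the inverse may be
    composed with a positive [f]. *)
Lemma C2_comp f (T T1 T2 : R -> R) : C2 f ->
  (forall x, is_derive (f x) (1 : R) T (T1 (f x))) ->
  (forall x, is_derive (f x) (1 : R) T1 (T2 (f x))) ->
  (forall x, {for f x, continuous T2}) ->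
  [/\ C2 (fun x => T (f x)),
  forall i, partial i (fun x => T (f x)) = (fun x => T1 (f x) * partial i f x) &
  forall i j, partial j (partial i (fun x => T (f x))) =
    (fun x => T1 (f x) * partial j (partial i f) x + partial i f x * (T2 (f x) * partial j f x))].
Proof.
move=> Cf dT dT1 cT2.
have cf := C2_continuous Cf.
have cf1 := C2_continuous_partial Cf.
have cf2 := C2_continuous_partial2 Cf.
have cder (h : R -> R) y (dh : R) : is_derive y (1 : R) h dh -> {for y, continuous h}.
  by move=> [H _]; apply: differentiable_continuous; apply/derivable1_diffP.
have cT1f : continuous (fun x => T1 (f x)).
  by apply: continuous_compf => // x; exact: cder (dT1 x).
apply: C2_intro.
- by apply: continuous_compf => // x; exact: cder (dT x).
- by move=> i x; exact: (is_derive_compR (C2_is_derive Cf i x) (dT x)).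
- by move=> i; exact: continuous_mulf.
- move=> i j x; exact: (is_deriveM (is_derive_compR (C2_is_derive Cf j x) (dT1 x))
    (C2_is_derive2 Cf i j x)).
- move=> i j; apply: continuous_addf; apply: continuous_mulf => //.
  by apply: continuous_mulf => //; exact: continuous_compf.
Qed.

Lemma is_derive_coord k (x v : 'rV[R]_d) : is_derive x v (fun x => x ord0 k) (v ord0 k).
Proof.
have E : (fun h : R => h^-1 *: (((fun x : 'rV[R]_d => x ord0 k) \o shift x) (h *: v) - x ord0 k)) @ 0^'
    --> v ord0 k.
  apply: cvg_near_cst; rewrite near_withinE; apply: nearW => h h0 /=.
  by rewrite !mxE addrK [_ *: _]mulKf.
split; first by apply/cvg_ex; exists (v ord0 k).
exact/cvg_lim.
Qed.

Lemma C2_sqr : [/\ C2 (fun x => edot x x),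
  forall i, partial i (fun x => edot x x) = (fun x => 2 * x ord0 i) &
  forall i j, partial j (partial i (fun x : 'rV[R]_d => edot x x)) = (fun=> 2 * (i == j)%:R)].
Proof.
apply: C2_intro.
- by apply: continuous_edot => i; exact: coord_continuous.
- move=> i x.
  have := @is_derive_sum _ _ _ d (fun k => (fun x => x ord0 k) * (fun x => x ord0 k)) x (evec i)
    (fun k => x ord0 k *: (evec i : 'rV[R]_d) ord0 k + x ord0 k *: (evec i : 'rV[R]_d) ord0 k).
  have E1 : \sum_(k < d) (fun x : 'rV[R]_d => x ord0 k) * (fun x => x ord0 k) = fun x => edot x x.
    by apply/funext => y; rewrite fct_sumE.
  have E2 : \sum_(k < d) (x ord0 k *: (evec i : 'rV[R]_d) ord0 k + x ord0 k *: (evec i : 'rV[R]_d) ord0 k)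
      = 2 * x ord0 i.
    rewrite (bigD1 i)//= big1 ?addr0; last first.
      by move=> k ki; rewrite !mxE eqxx/= (negbTE ki) !scaler0 addr0.
    by rewrite !mxE !eqxx/= ![_ *: _]mulr1; ring.
  by rewrite E1 E2; apply => k; exact: is_deriveM (is_derive_coord k _ _) (is_derive_coord k _ _).
- by move=> i; apply: continuous_mulf; [exact: cst_continuous|exact: coord_continuous].
- move=> i j x.
  have := is_deriveM (is_derive_cst (2 : R) x (evec j)) (is_derive_coord i x (evec j)).
  by rewrite scaler0 addr0 !mxE eqxx/=.
- by move=> i j; exact: cst_continuous.
Qed.

End C2Calculus.

Section Operators.
Context {R : realType} {d m : nat} {K : Type}.
Variables (b : 'rV[R]_d -> K -> 'rV[R]_d) (S : 'rV[R]_d -> 'M[R]_(d, m)).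
Implicit Types (f g : 'rV[R]_d -> R) (x : 'rV[R]_d) (xi : K).
Local Notation C2 := (C2on (@setT 'rV[R]_d)).

Lemma grad_cst (a : R) x : grad (fun=> a) x = 0 :> 'rV[R]_d.
Proof. by apply/rowP => i; rewrite !mxE; case: (@C2_cst R d a) => _ -> _. Qed.

Lemma Lop_cst (a : R) x xi : Lop b S (fun=> a) x xi = 0.
Proof.
rewrite /Lop grad_cst edot0r addr0 /half_tr.
case: (@C2_cst R d a) => _ _ E.
rewrite big1 ?mulr0// => i _; rewrite big1// => j _.
by rewrite [partial j _]E mulr0.
Qed.

Lemma gradD f g x : C2 f -> C2 g -> grad (fun x => f x + g x) x = grad f x + grad g x.
Proof. by move=> Cf Cg; apply/rowP => i; rewrite !mxE; case: (C2D Cf Cg) => _ -> _. Qed.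

Lemma LopD f g x xi : C2 f -> C2 g ->
  Lop b S (fun x => f x + g x) x xi = Lop b S f x xi + Lop b S g x xi.
Proof.
move=> Cf Cg; rewrite /Lop gradD// edotDr addrACA; congr (_ + _).
rewrite /half_tr -mulrDr -big_split; congr (_ * _); apply: eq_bigr => i _ /=.
rewrite -big_split; apply: eq_bigr => j _ /=.
by case: (C2D Cf Cg) => _ _ ->; rewrite mulrDr.
Qed.

Lemma C2Z a f : C2 f -> C2 (fun x => a * f x).
Proof. by move=> Cf; case: (C2M (let: And3 C _ _ := C2_cst a in C) Cf). Qed.

Lemma gradM f g x : C2 f -> C2 g ->
  grad (fun x => f x * g x) x = f x *: grad g x + g x *: grad f x.
Proof. by move=> Cf Cg; apply/rowP => i; rewrite !mxE; case: (C2M Cf Cg) => _ -> _. Qed.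

Lemma LopM f g x xi : C2 f -> C2 g ->
  Lop b S (fun x => f x * g x) x xi =
  f x * Lop b S g x xi + g x * Lop b S f x xi + Gam (S x) (grad f x) (grad g x).
Proof.
move=> Cf Cg; rewrite /Lop gradM// edotDr !edotZr.
suff -> : half_tr S (fun x => f x * g x) x =
    f x * half_tr S g x + g x * half_tr S f x + Gam (S x) (grad f x) (grad g x).
  move: (half_tr S f x) (half_tr S g x) (Gam _ _ _) (edot _ (grad f x)) (edot _ (grad g x)) (f x) (g x).
  by move=> p1 p2 p3 p4 p5 p6 p7; ring.
(* Writing the pairing as the mean of its two orders makes the double sums agree term by term. *)
have -> : Gam (S x) (grad f x) (grad g x) =
    2^-1 * (Gam (S x) (grad f x) (grad g x) + Gam (S x) (grad g x) (grad f x)).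
  by rewrite (GamC _ (grad g x)); move: (Gam _ _ _) => p; field.
rewrite -!sum_diffm /half_tr !(mulrCA _ 2^-1) -!mulrDr; congr (_ * _).
rewrite !mulr_sumr -!big_split; apply: eq_bigr => i _ /=.
rewrite !mulr_sumr -!big_split; apply: eq_bigr => j _ /=.
case: (C2M Cf Cg) => _ _ ->; rewrite !mxE.
move: (diffm S x i j) (partial j (partial i f) x) (partial j (partial i g) x) (partial i f x)
  (partial i g x) (partial j f x) (partial j g x) (f x) (g x).
by move=> p0 p1 p2 p3 p4 p5 p6 p7 p8; ring.
Qed.

Lemma gradZ a f x : C2 f -> grad (fun x => a * f x) x = a *: grad f x.
Proof.
move=> Cf; have [Ca _ _] := @C2_cst R d a.
by rewrite (gradM x Ca Cf) [grad (fun=> a) x]grad_cst scaler0 addr0.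
Qed.

Lemma LopZ a f x xi : C2 f -> Lop b S (fun x => a * f x) x xi = a * Lop b S f x xi.
Proof.
move=> Cf; have [Ca _ _] := @C2_cst R d a.
by rewrite (LopM x xi Ca Cf) [grad (fun=> a) x]grad_cst GamC Gam0r (Lop_cst a x xi) mulr0 !addr0.
Qed.

Section Comp.
Variables (f : 'rV[R]_d -> R) (T T1 T2 : R -> R).
Hypotheses (Cf : C2 f) (dT : forall x, is_derive (f x) (1 : R) T (T1 (f x)))
  (dT1 : forall x, is_derive (f x) (1 : R) T1 (T2 (f x)))
  (cT2 : forall x, {for f x, continuous T2}).

Lemma C2_compose : C2 (fun x => T (f x)).
Proof. by case: (C2_comp Cf dT dT1 cT2). Qed.

Lemma grad_comp x : grad (fun x => T (f x)) x = T1 (f x) *: grad f x.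
Proof. by apply/rowP => i; rewrite !mxE; case: (C2_comp Cf dT dT1 cT2) => _ -> _. Qed.

Lemma Lop_comp x xi : Lop b S (fun x => T (f x)) x xi =
  T1 (f x) * Lop b S f x xi + T2 (f x) * (2^-1 * Gam (S x) (grad f x) (grad f x)).
Proof.
rewrite /Lop grad_comp edotZr.
suff -> : half_tr S (fun x => T (f x)) x = T1 (f x) * half_tr S f x +
    T2 (f x) * (2^-1 * Gam (S x) (grad f x) (grad f x)).
  move: (half_tr S f x) (Gam _ _ _) (edot _ _) (T1 (f x)) (T2 (f x)) => p1 p2 p3 p4 p5; ring.
rewrite -!sum_diffm /half_tr !(mulrCA _ 2^-1) -!mulrDr; congr (_ * _).
rewrite !mulr_sumr -!big_split; apply: eq_bigr => i _ /=.
rewrite !mulr_sumr -!big_split; apply: eq_bigr => j _ /=.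
case: (C2_comp Cf dT dT1 cT2) => _ _ ->; rewrite !mxE.
move: (diffm S x i j) (partial j (partial i f) x) (partial i f x) (partial j f x) (T1 (f x)) (T2 (f x)).
by move=> p0 p1 p2 p3 p4 p5; ring.
Qed.

End Comp.

Lemma grad_sqr x : grad (fun x => edot x x) x = 2 *: x.
Proof. by apply/rowP => i; rewrite !mxE; case: (@C2_sqr R d) => _ -> _. Qed.

Lemma Lop_sqr x xi :
  Lop b S (fun x => edot x x) x xi = fnorm (S x) ^+ 2 + 2 * edot (b x xi) x.
Proof.
rewrite /Lop grad_sqr edotZr; congr (_ + _).
rewrite /half_tr sqr_sqrtr; last first.
  by apply: sumr_ge0 => k _; apply: sumr_ge0 => l _; exact: sqr_ge0.
rewrite mulr_sumr; apply: eq_bigr => i _; case: (@C2_sqr R d) => _ _ E.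
rewrite mulr_sumr (bigD1 i)//= big1 ?addr0; last first.
  by move=> j ji; rewrite [partial j _]E eq_sym (negbTE ji) !mulr0.
rewrite [partial i _]E eqxx mulr1 mulrCA mulVf// mulr1 mxE.
by apply: eq_bigr => k _; rewrite mxE expr2.
Qed.

End Operators.

Section AopLop.
Context {R : realType} {d m : nat} {K : ptopologicalType}.
Variables (b : 'rV[R]_d -> K -> 'rV[R]_d) (S : 'rV[R]_d -> 'M[R]_(d, m)).

Lemma AopE f (z : Zsp R d K) :
  Aop b S f z = Lop b S f (zx z) (zxi z) + Gam (S (zx z)) (zy z) (grad f (zx z)).
Proof. by rewrite /Aop /Lop edotDl edot_diffm addrA. Qed.

End AopLop.

(** * Comparison with the Neumann eigenvalues *)

Section MaximumPrinciple.
Context {R : realType} {d m : nat}.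
Implicit Types (f g : 'rV[R]_d -> R) (x v : 'rV[R]_d).

Lemma C2on_subset (U : set 'rV[R]_d) f : C2on setT f -> C2on U f.
Proof.
by move=> [c0 d1 c1 d2 c2]; split;
  [exact: continuous_subspaceW c0|move=> i x _; exact: d1|
   move=> i; exact: continuous_subspaceW (c1 i)|move=> i j x _; exact: d2|
   move=> i j; exact: continuous_subspaceW (c2 i j)].
Qed.

Lemma edot_evec i (u : 'rV[R]_d) : edot (evec i) u = u ord0 i.
Proof.
rewrite /edot (bigD1 i)//= big1 ?addr0; last first.
  by move=> k ki; rewrite !mxE eqxx/= (negbTE ki) mul0r.
by rewrite mxE !eqxx mul1r.
Qed.

(** The second derivative at [x] along the line of direction [v]. *)
Definition hess_form f x v : R := \sum_i v ord0 i * edot v (grad (partial i f) x).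

Section Line.
Variables (U : set 'rV[R]_d) (oU : open U) (f : 'rV[R]_d -> R) (Cf : C2on U f).

Let near_U x : U x -> nbhs x U. Proof. by move=> Ux; exact: open_nbhs_nbhs. Qed.

Lemma C2on_is_derive x v : U x -> is_derive x v f (edot v (grad f x)).
Proof.
move=> Ux; have [_ d1 c1 _ _] := Cf; apply: is_derive_edot_grad.
  by apply: filterS (near_U Ux) => y Uy i; exact: d1.
move=> i; have := c1 i; rewrite (continuous_open_subspace _ oU); apply.
by rewrite inE.
Qed.

Lemma C2on_is_derive_partial x v i : U x ->
  is_derive x v (partial i f) (edot v (grad (partial i f) x)).
Proof.
move=> Ux; have [_ _ _ d2 c2] := Cf; apply: is_derive_edot_grad.
  by apply: filterS (near_U Ux) => y Uy j; exact: d2.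
move=> j; have := c2 i j; rewrite (continuous_open_subspace _ oU); apply.
by rewrite inE.
Qed.

Lemma near_line x v : U x -> \forall s \near (0 : R), U (x + s *: v).
Proof.
move=> Ux.
have c : (fun s : R => x + s *: v) @ (0 : R) --> x.
  rewrite -[X in _ --> X](addr0 x); apply: cvgD; first exact: cvg_cst.
  by rewrite -[X in _ --> X](scale0r v); apply: cvgZr_tmp; exact: cvg_id.
by have := c _ (near_U Ux).
Qed.

Lemma is_derive_line_edot x v s : U (x + s *: v) ->
  is_derive (s : R) (1 : R) (fun t => f (x + t *: v)) (edot v (grad f (x + s *: v))).
Proof. by move=> Us; apply: is_derive_line; exact: C2on_is_derive. Qed.

Lemma is_derive_edot_line x v : U x ->
  is_derive (0 : R) (1 : R) (fun s => edot v (grad f (x + s *: v))) (hess_form f x v).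
Proof.
move=> Ux.
have -> : (fun s => edot v (grad f (x + s *: v))) =
    \sum_(i < d) (v ord0 i \*: (fun s => partial i f (x + s *: v))).
  by apply/funext => s; rewrite fct_sumE; apply: eq_bigr => i _; rewrite mxE.
apply: is_derive_sum => i; apply: is_deriveZ; apply: is_derive_line.
by rewrite scale0r addr0; exact: C2on_is_derive_partial.
Qed.

End Line.

Lemma C2on_max (U : set 'rV[R]_d) f g x : open U -> C2on U f -> C2on U g -> U x ->
  (forall y, U y -> f y - g y <= f x - g x) ->
  grad f x = grad g x /\ forall v, hess_form f x v <= hess_form g x v.
Proof.
move=> oU Cf Cg Ux fgx.
have H v : edot v (grad f x) = edot v (grad g x) /\ hess_form f x v <= hess_form g x v.
  pose w (s : R) : R := f (x + s *: v) - g (x + s *: v).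
  pose w1 (s : R) : R := edot v (grad f (x + s *: v)) - edot v (grad g (x + s *: v)).
  have H1 : \forall s \near (0 : R), is_derive (s : R) (1 : R) w (w1 s).
    apply: filterS (near_line oU v Ux) => s Us.
    exact: (is_deriveB (is_derive_line_edot oU Cf Us) (is_derive_line_edot oU Cg Us)).
  have H2 := is_deriveB (is_derive_edot_line oU Cf v Ux) (is_derive_edot_line oU Cg v Ux).
  have H3 : \forall s \near (0 : R), w s <= w 0.
    apply: filterS (near_line oU v Ux) => s Us.
    by rewrite /w scale0r addr0; exact: fgx.
  have [] := derive_at_local_max H1 H2 H3.
  rewrite /w1 scale0r addr0 => /eqP; rewrite subr_eq0 => /eqP -> h.
  by split; [reflexivity|move: h; rewrite subr_le0].
split; last by move=> v; case: (H v).
by apply/rowP => i; have [] := H (evec i); rewrite !edot_evec.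
Qed.

(** With [σ_k] the columns of [σ], tr(a D²f) is the sum over [k] of D²f(σ_k, σ_k). An inequality
    between Hessian forms therefore passes to the second-order part without any diagonalization. *)
Lemma half_tr_hess_form (S : 'rV[R]_d -> 'M[R]_(d, m)) f x :
  half_tr S f x = 2^-1 * \sum_k hess_form f x (\row_i S x i k).
Proof.
rewrite /half_tr; congr (_ * _); rewrite exchange_big/= exchange_big/=.
under eq_bigr do under eq_bigr do rewrite mxE mulr_suml.
under [RHS]eq_bigr do rewrite /hess_form.
rewrite [RHS]exchange_big/=; apply: eq_bigr => i _.
rewrite exchange_big/=; apply: eq_bigr => k _.
rewrite mxE mulr_sumr; apply: eq_bigr => j _; rewrite !mxE mulrA; ring.
Qed.

Lemma half_tr_le_max (S : 'rV[R]_d -> 'M[R]_(d, m)) f g x :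
  (forall v, hess_form f x v <= hess_form g x v) -> half_tr S f x <= half_tr S g x.
Proof.
move=> H; rewrite 2!half_tr_hess_form ler_pM2l; last by rewrite invr_gt0.
by apply: ler_sum => k _; exact: H.
Qed.

End MaximumPrinciple.

Section NeumannComparison.
Context {R : realType} {d m : nat} {K : ptopologicalType}.
Variables (b : 'rV[R]_d -> K -> 'rV[R]_d) (S : 'rV[R]_d -> 'M[R]_(d, m)) (c : 'rV[R]_d -> K -> R).

Lemma lipschitz_within_continuous (A : set 'rV[R]_d) (V : 'rV[R]_d -> R) (L : R) :
  (forall x y, A x -> A y -> `|V x - V y| <= L * enorm (x - y)) ->
  {within A, continuous V}.
Proof.
move=> VL; apply/subspace_continuousP => x Ax.
apply/cvgrPdist_lt => e e0; rewrite /within/=.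
have ce : continuous (fun y : 'rV[R]_d => (`|L| + 1) * enorm (x - y)).
  apply: continuous_mulf; first exact: cst_continuous.
  apply: continuous_enorm_comp => i; under eq_fun do rewrite !mxE.
  apply: continuous_addf; first exact: cst_continuous.
  by move=> y; apply: continuousN; exact: coord_continuous.
have c0 := ce x.
rewrite /continuous_at subrr enorm0 mulr0 in c0.
have H : nbhs x [set y | (`|L| + 1) * enorm (x - y) < e] by apply: (cvgr_lt _ c0 _ e0).
suff : nbhs x [set y | A y -> `|V x - V y| < e] by [].
apply: filterS H => y /= ye Ay.
apply: le_lt_trans ye; apply: le_trans (VL _ _ Ax Ay) _.
rewrite ler_wpM2r ?enorm_ge0//; apply: le_trans (ler_norm _) _.
by rewrite lerDl.
Qed.

Lemma Lop_exp f x xi : C2on setT f -> Lop b S (fun x => expR (f x)) x xi =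
  expR (f x) * (Lop b S f x xi + 2^-1 * Gam (S x) (grad f x) (grad f x)).
Proof.
move=> Cf; rewrite mulrDr.
have d1 y : is_derive (f y) (1 : R) expR (expR (f y)) by exact: is_derive_expR.
have c1 y : {for f y, continuous expR} by exact: continuous_expR.
exact: (Lop_comp b S Cf d1 d1 c1 x xi).
Qed.

Lemma C2_exp f : C2on setT f -> C2on setT (fun x : 'rV[R]_d => expR (f x)).
Proof.
move=> Cf.
have d1 y : is_derive (f y) (1 : R) expR (expR (f y)) by exact: is_derive_expR.
have c1 y : {for f y, continuous expR} by exact: continuous_expR.
exact: (C2_compose Cf d1 d1 c1).
Qed.

(* The quotient V / Psi with Psi = exp (g + eps |x|^2) has no maximum on the
   sphere, because Psi has a positive normal derivative there. *)
Lemma neumann_quotient_max (eps r r0 M : R) (V g : 'rV[R]_d -> R) (x : 'rV[R]_d) :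
  0 < eps -> 0 < M -> 0 < r -> r0 < r -> (forall x, r0 <= enorm x -> g x = 0) ->
  (forall x, cball r x -> V x <= M * expR (g x + eps * edot x x)) ->
  V x = M * expR (g x + eps * edot x x) -> enorm x = r ->
  ~ ((fun t : R => (V (x - t *: ((enorm x)^-1 *: x)) - V x) / t) @ at_right 0 --> (0 : R)).
Proof.
move=> eps0 M0 r_gt0 r0r g0 VM Vx xr cV.
(* [V] touches [M Psi] from below at [x], so its inward difference quotient is at most that of
   [M Psi], which is at most [- M eps r] for small steps. A limit 0 would make it larger. *)
have k0 : - (M * (eps * r)) < 0 by rewrite oppr_lt0 !mulr_gt0.
have := cvgr_gt _ cV _ k0; rewrite near_withinE => /(_ _)/nbhs_ballP[e /= e0 H].
(* Short enough to be seen by the limit, to stay in the ball and to stay where [g] vanishes. *)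
pose t := Num.min e (Num.min r (r - r0)) / 2.
have m0 : 0 < Num.min e (Num.min r (r - r0)) by rewrite !lt_min e0 r_gt0 subr_gt0.
have t0 : 0 < t by rewrite divr_gt0.
have tm : t < Num.min e (Num.min r (r - r0)) by rewrite /t; lra.
have te : t < e by apply: lt_le_trans tm _; rewrite ge_min lexx.
have tr : t < r by apply: lt_le_trans tm _; rewrite ge_min ge_min lexx orbT.
have trr : t < r - r0 by apply: lt_le_trans tm _; rewrite !ge_min lexx !orbT.
have := H t; rewrite /ball/= sub0r normrN gtr0_norm// => /(_ te t0).
have -> : x - t *: ((enorm x)^-1 *: x) = (1 - t / r) *: x.
  by rewrite scalerA scalerBl scale1r xr.
have f0 : 0 <= 1 - t / r by rewrite subr_ge0 ler_pdivrMr// mul1r ltW.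
have xtE : enorm ((1 - t / r) *: x) = r - t.
  by rewrite enormZ ger0_norm// xr mulrBl mul1r divfK// gt_eqF.
have xin : cball r ((1 - t / r) *: x) by rewrite /cball/= xtE; lra.
have := VM _ xin; rewrite Vx (g0 x) ?xr ?(ltW r0r)// g0; last by rewrite xtE; lra.
rewrite -!enorm_sqr xtE xr !add0r => V1.
rewrite ltr_pdivlMr// => V2.
(* This is [1 + u <= exp u], with [u] the drop of [eps |x|²] along the step. *)
have E1 : expR (eps * (r - t) ^+ 2) * (1 + (eps * r ^+ 2 - eps * (r - t) ^+ 2)) <= expR (eps * r ^+ 2).
  rewrite -[in leRHS](subrK (eps * (r - t) ^+ 2) (eps * r ^+ 2)) expRD mulrC ler_pM2r ?expR_gt0//.
  exact: expR_ge1Dx.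
have E2 : 1 <= expR (eps * (r - t) ^+ 2).
  by rewrite -expR0 ler_expR mulr_ge0 ?sqr_ge0// ltW.
move: (expR (eps * (r - t) ^+ 2)) (expR (eps * r ^+ 2)) E1 E2 V1 V2 => p q E1 E2 V1 V2.
have E3 : eps * r ^+ 2 - eps * (r - t) ^+ 2 = eps * t * (r + (r - t)) by ring.
rewrite E3 in E1.
have E4 : eps * r * t <= p * (eps * t * (r + (r - t))).
  have : 0 <= eps * t * (r - t) by rewrite !mulr_ge0// ?subr_ge0 ltW.
  have : 0 <= eps * t * r by rewrite !mulr_ge0// ltW.
  nra.
have : M * p - M * q <= M * - (eps * r * t).
  by rewrite -mulrBr ler_pM2l//; lra.
lra.
Qed.

End NeumannComparison.

Section NeumannBound.
Context {R : realType} {d m : nat} {K : ptopologicalType}.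
Variables (b : 'rV[R]_d -> K -> 'rV[R]_d) (S : 'rV[R]_d -> 'M[R]_(d, m)) (c : 'rV[R]_d -> K -> R).
Variable C0 : R.
Hypothesis growth : forall x xi, enorm (b x xi) ^+ 2 + fnorm (S x) ^+ 2 <= C0 * (1 + enorm x ^+ 2).

Lemma edot_le_sqr (u v : 'rV[R]_d) : 2 * edot u v <= enorm u ^+ 2 + enorm v ^+ 2.
Proof.
have := edot_ge0 (u - v); rewrite edotDl !edotDr !edotNl !edotNr (edotC v u) -!enorm_sqr; lra.
Qed.

Lemma Gam_le_sqr (A : 'M[R]_(d, m)) (u v : 'rV[R]_d) : 2 * Gam A u v <= Gam A u u + Gam A v v.
Proof.
have := Gam_ge0 A (u - v); rewrite GamDl !GamDr !GamNl !GamNr (GamC _ v u); lra.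
Qed.

Lemma grad_sqr_bounded (g : 'rV[R]_d -> R) r : C2on setT g ->
  exists2 G, 0 <= G & forall x, cball r x -> enorm (grad g x) ^+ 2 <= G.
Proof.
move=> Cg.
have cg : continuous (fun x : 'rV[R]_d => enorm (grad g x) ^+ 2).
  apply: (@continuous_compf _ _ (fun x => enorm (grad g x)) (fun t => t ^+ 2)); last first.
    by move=> x; exact: exprn_continuous.
  apply: continuous_enorm_comp => i; under eq_fun do rewrite mxE.
  exact: C2_continuous_partial.
have [B0|/set0P B0] := eqVneq (cball r : set 'rV[R]_d) set0.
  by exists 0 => // x; rewrite B0.
have [x0 _ xmax] := @compact_EVT_max _ R _ _ B0 (@compact_cball R d r)
  (continuous_subspaceT cg).
exists (enorm (grad g x0) ^+ 2); first exact: sqr_ge0.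
by move=> x xr; apply: xmax; rewrite inE.
Qed.

Let q eps (g : 'rV[R]_d -> R) x := g x + eps * edot x x.

(** The contribution of [eps |x|²] divided by [eps]; the bound does not depend on [eps], so this
    contribution disappears as [eps] tends to 0. *)
Lemma Aop_sqr_le G r eps x (xi : K) (u : 'rV[R]_d) : 0 <= eps -> eps <= 1 -> 0 <= r ->
  enorm x <= r -> enorm u ^+ 2 <= G -> 
  Lop b S (fun x => edot x x) x xi + Gam (S x) (u + eps *: (2 *: x)) (2 *: x) <=
  `|C0| * (1 + r ^+ 2) * (2 + G + 5 * r ^+ 2) + r ^+ 2.
Proof.
move=> eps0 eps1 r0 xr uG.
set P := `|C0| * (1 + r ^+ 2).
have xr2 : enorm x ^+ 2 <= r ^+ 2 by rewrite ler_pXn2r// nnegrE enorm_ge0.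
have P0 : 0 <= P by rewrite mulr_ge0// addr_ge0// sqr_ge0.
have bP : enorm (b x xi) ^+ 2 + fnorm (S x) ^+ 2 <= P.
  apply: (le_trans (growth x xi)).
  apply: (@le_trans _ _ (`|C0| * (1 + enorm x ^+ 2))).
    by rewrite ler_wpM2r ?ler_norm// addr_ge0// sqr_ge0.
  by rewrite ler_wpM2l// lerD2l.
have b0 := sqr_ge0 (enorm (b x xi)); have s0 := sqr_ge0 (fnorm (S x)).
rewrite Lop_sqr GamDl !GamZl !GamZr.
have e1 := edot_le_sqr (b x xi) x.
have e2 := Gam_le_sqr (S x) u x.
have gx : Gam (S x) x x <= P * r ^+ 2.
  apply: (le_trans (Gam_le_fnorm _ _)); apply: ler_pM => //; first exact: sqr_ge0.
  by lra.
have gu : Gam (S x) u u <= P * G.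
  apply: (le_trans (Gam_le_fnorm _ _)); apply: ler_pM => //; first exact: sqr_ge0.
  by lra.
have gx0 := Gam_ge0 (S x) x.
have e3 : eps * (2 * (2 * Gam (S x) x x)) <= 4 * (P * r ^+ 2).
  apply: (@le_trans _ _ (1 * (2 * (2 * Gam (S x) x x)))).
    by rewrite ler_wpM2r// !mulr_ge0.
  lra.
move: (edot _ _) (Gam _ _ _) (Gam _ _ _) (Gam _ _ _) (enorm (b x xi) ^+ 2) (fnorm (S x) ^+ 2) (enorm x ^+ 2)
  xr2 bP b0 s0 e1 e2 gx gu gx0 e3 => p1 p2 p3 p4 p5 p6 p7 *.
lra.
Qed.

(** At an interior maximum of [V / exp q], with q = g + ε|x|², the gradients of [V] and [M exp q]
    agree and the Hessians are ordered, so the eigenvalue equation gives rho <= L q + ½|σᵀ∇q|² + c.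
    The boundary is excluded by [neumann_quotient_max]. *)
Lemma neumann_eigen_le (r r0 rho S0 : R) (g : 'rV[R]_d -> R) : 0 < r -> r0 < r ->
  neumann_eigen b S c r rho -> C2on setT g -> (forall x, r0 <= enorm x -> g x = 0) ->
  (forall z : Zsp R d K, Aop b S g z + Rfun S c z <= S0) -> rho <= S0.
Proof.
move=> r_gt0 r0r [V [CV [[L VL] V0] _ HJB bV]] Cg g0 gS0.
have [G G0 gG] := grad_sqr_bounded r Cg.
set C := `|C0| * (1 + r ^+ 2) * (2 + G + 5 * r ^+ 2) + r ^+ 2.
have C_ge0 : 0 <= C.
  have h := sqr_ge0 r; apply: addr_ge0 => //; apply: mulr_ge0; last lra.
  by apply: mulr_ge0; [exact: normr_ge0|lra].
suff H eps : 0 < eps -> eps <= 1 -> rho <= S0 + eps * C.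
  apply/ler_addgt0Pr => e e0.
  have m0 : 0 < Num.min 1 (e / (C + 1)) by rewrite lt_min ltr01 divr_gt0//; lra.
  apply: le_trans (H _ m0 _) _; first by rewrite ge_min lexx.
  rewrite lerD2l; apply: (@le_trans _ _ (e / (C + 1) * C)).
    by rewrite ler_wpM2r// ge_min lexx orbT.
  by rewrite mulrAC ler_pdivrMr; nra.
move=> eps0 eps1.
have [C2s _ _] := @C2_sqr R d.
have Ceps := C2Z eps C2s.
have [Cq _ _] : [/\ C2on setT (q eps g), True & True] by case: (C2D Cg Ceps).
have gradq x : grad (q eps g) x = grad g x + eps *: (2 *: x).
  by rewrite (gradD x Cg Ceps) (gradZ eps x C2s) grad_sqr.
have Lopq x xi : Lop b S (q eps g) x xi =
    Lop b S g x xi + eps * Lop b S (fun x => edot x x) x xi.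
  by rewrite (LopD b S x xi Cg Ceps) (LopZ b S eps x xi C2s).
have CP := C2_exp Cq.
pose W x := V x / expR (q eps g x).
have cW : {within cball r, continuous W}.
  have c1 := lipschitz_within_continuous VL.
  have c2 : {within cball r, continuous (fun x : 'rV[R]_d => (expR (q eps g x))^-1)}.
    apply: continuous_subspaceT; apply: (@continuous_compf _ _ _ GRing.inv).
      exact: C2_continuous CP.
    by move=> x; apply: inv_continuous; rewrite gt_eqF// expR_gt0.
  by move=> x; apply: cvgM; [exact: c1|exact: c2].
have B0 : (cball r : set 'rV[R]_d) !=set0 by exists 0; rewrite /cball/= enorm0 ltW.
have [x0 + Wmax] := compact_EVT_max B0 (@compact_cball R d r) cW.
rewrite inE => x0r.
set M := W x0.
have M0 : 0 < M by rewrite divr_gt0 ?expR_gt0// V0.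
have VM x : cball r x -> V x <= M * expR (q eps g x).
  by move=> xr; rewrite -ler_pdivrMr ?expR_gt0//; apply: Wmax; rewrite inE.
have Vx0 : V x0 = M * expR (q eps g x0) by rewrite divfK// gt_eqF// expR_gt0.
move: x0r; rewrite /cball/= le_eqVlt => /predU1P[x0r|x0r].
  by case: (neumann_quotient_max eps0 M0 r_gt0 r0r g0 VM Vx0 x0r); exact: bV.
have CMP : C2on (oball r) (fun x => M * expR (q eps g x)).
  by apply: C2on_subset; exact: C2Z.
have [|gradE hessE] := C2on_max (@open_oball R d r) CV CMP x0r.
  move=> y yr; rewrite [X in _ <= X - _]Vx0 subrr subr_le0; apply: VM.
  exact: ltW.
(* A control attaining the maximum turns the equation into an upper bound for [rho]. *)
have [_ [xi Hxi]] := HJB _ x0r.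
have Lle : Lop b S V x0 xi <= M * (expR (q eps g x0) *
    (Lop b S (q eps g) x0 xi + 2^-1 * Gam (S x0) (grad (q eps g) x0) (grad (q eps g) x0))).
  rewrite -(Lop_exp b S x0 xi Cq) -(LopZ b S M x0 xi CP) /Lop gradE lerD2r.
  exact: half_tr_le_max.
rewrite mulrA -Vx0 in Lle.
have Vp : 0 < V x0 by apply: V0; exact: ltW.
have rhole : rho <= Lop b S (q eps g) x0 xi +
    2^-1 * Gam (S x0) (grad (q eps g) x0) (grad (q eps g) x0) + c x0 xi.
  rewrite -(ler_pM2l Vp) mulrC -Hxi mulrDr [c x0 xi * _]mulrC lerD2r.
  exact: Lle.
apply: (le_trans rhole).
(* Taking y = ∇q instead of ∇g makes the discrepancy exactly [eps] times A applied to |x|², the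
   quantity bounded in [Aop_sqr_le]. *)
have := gS0 (x0, xi, grad (q eps g) x0).
rewrite AopE /Rfun enorm_mulmx_sqr /zx/= /zy/= /zxi/= => gS.
have := Aop_sqr_le xi (ltW eps0) eps1 (ltW r_gt0) (ltW x0r) (gG x0 (ltW x0r)).
rewrite -gradq -/C => HC.
have GE : Gam (S x0) (grad (q eps g) x0) (grad (q eps g) x0) =
    Gam (S x0) (grad (q eps g) x0) (grad g x0) + eps * Gam (S x0) (grad (q eps g) x0) (2 *: x0).
  by rewrite -[eps * _]GamZr -GamDr -gradq.
rewrite Lopq.
move: (Gam _ (grad (q eps g) x0) (grad (q eps g) x0)) GE gS => p GE gS.
have {}HC := ler_wpM2l (ltW eps0) HC.
rewrite mulrDr in HC.
move: (Lop _ _ _ _ _) (Lop _ _ _ _ _) (Gam _ _ _) (Gam _ _ (grad g x0)) (c _ _) GE gS HC => p1 p2 p3 p4 p5 *.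
lra.
Qed.

End NeumannBound.

(** * Existence of an optimal measure *)

Section OccupationFunctional.
Context {R : realType} {T : Type}.
Variables (w : T -> R) (A : set (T -> R)) (M rho : R).
Hypotheses (w1 : forall z, 1 <= w z) (A0 : A (fun=> 0))
  (Alin : forall (a : R) f g, A f -> A g -> A (fun z => a * f z + g z))
  (Asmall : forall f, A f -> exists C, forall z, `|f z| <= C * w z)
  (dual : forall f Q, A f -> (forall z, f z + (M - w z) <= Q) -> rho <= Q).

(** In this section [M - w] stands for the reward R and [A] for the functions A f; [w >= 1] measures
    how negative R is. *)
Definition dominated_by (f : T -> R) := exists C, forall z, `|f z| <= C * w z.
Local Notation E := dominated_by.

Lemma dominated_lin (a : R) f g : E f -> E g -> E (fun z => a * f z + g z).
Proof.
move=> [C fC] [D gD]; exists (`|a| * C + D) => z.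
apply: le_trans (ler_normD _ _) _; rewrite mulrDl normrM lerD// -mulrA.
by rewrite ler_wpM2l.
Qed.

Lemma dominated_cst (a : R) : E (fun=> a).
Proof. by exists `|a| => z; rewrite ler_peMr. Qed.

Lemma dominated_pos f : E f -> exists2 C, 0 < C & forall z, `|f z| <= C * w z.
Proof.
move=> [C fC]; exists (`|C| + 1); first by rewrite ltr_wpDl.
move=> z; apply: (le_trans (fC z)); rewrite ler_wpM2r//.
  exact: le_trans ler01 (w1 z).
by apply: le_trans (ler_norm _) _; rewrite lerDl.
Qed.

(** The infimum [p] of this set is a superhedging price. A linear [L] below it is at most the
    supremum of its argument ([g = 0], [s = 0]), kills [A] (cancel [f] by [g = - f]), and has
    [L (M - w - rho) >= 0] ([s = 1]). *)
Let P (f : T -> R) : set R := [set t | exists g s, [/\ A g, 0 <= s &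
  forall z, f z + g z + s * (M - w z - rho) <= t]].

(** This is where the comparison enters. From [- C w <= f] one gets
    [g + (s + C) (M - w) <= t + s rho + C M]; dividing by [s + C], positive since [C] is, allows
    [dual] to be applied. *)
Let P_ge f C t : 0 < C -> (forall z, `|f z| <= C * w z) -> P f t -> C * (rho - M) <= t.
Proof.
move=> C0 fC [g [s [Ag s0 gst]]].
have sC : 0 < s + C by rewrite ltr_wpDl.
have Ag' : A (fun z => (s + C)^-1 * g z + 0) by exact: Alin.
have := dual (Q := (t + s * rho + C * M) / (s + C)) Ag'.
have H z : (s + C)^-1 * g z + 0 + (M - w z) <= (t + s * rho + C * M) / (s + C).
  rewrite ler_pdivlMr// addr0 mulrDl mulrAC mulVf ?gt_eqF// mul1r.
  have := gst z; have := fC z; rewrite ler_norml => /andP[+ _].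
  move: (f z) (g z) (w z) => p q u; lra.
by move=> /(_ H); rewrite ler_pdivlMr//; lra.
Qed.

Let Plb f : E f -> has_lbound (P f).
Proof.
move=> /dominated_pos[C C0 fC]; exists (C * (rho - M)) => t; exact: P_ge.
Qed.

Let Pne f : E f -> P f !=set0.
Proof.
move=> /dominated_pos[C C0 fC]; exists (C * (M - rho)), (fun=> 0), C.
split => //; first exact: ltW.
move=> z; have := fC z; rewrite ler_norml => /andP[_ ].
move: (f z) (w z) => p u; lra.
Qed.

Let p f := inf (P f).

Let p_le f t : E f -> P f t -> p f <= t.
Proof. by move=> Ef Pt; apply: ge_inf => //; exact: Plb. Qed.

Let p_ge f t : E f -> (forall s, P f s -> t <= s) -> t <= p f.
Proof. by move=> Ef H; apply: lb_le_inf; [exact: Pne|exact: H]. Qed.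

Let VT : lmodType R := (T -> R^o)%type.

Let linE : forall (a : R) (x y : VT), E x -> E y -> E (a *: x + y).
Proof. by move=> a x y Ex Ey; exact: dominated_lin. Qed.

Let psub : sublinear_on (V := VT) E p.
Proof.
split.
- move=> f g Ef Eg.
  have Efg : E (f + g).
    by have := linE 1 Ef Eg; rewrite scale1r.
  rewrite -lerBlDr; apply: p_ge => // t [g1 [s1 [Ag1 s10 H1]]].
  rewrite lerBlDr -lerBlDl; apply: p_ge => // u [g2 [s2 [Ag2 s20 H2]]].
  rewrite lerBlDl; apply: p_le => //.
  exists (fun z => 1 * g1 z + g2 z), (s1 + s2); split; [exact: Alin|exact: addr_ge0|].
  move=> z; have := H1 z; have := H2 z; have -> : (f + g) z = (f : T -> R) z + (g : T -> R) z by [].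
  move: (f z) (g z) (g1 z) (g2 z) (w z) => p1 p2 p3 p4 p5; lra.
- have homo (t : R) (f : VT) : 0 < t -> E f -> p (t *: f) <= t * p f.
    move=> t0 Ef; rewrite -ler_pdivrMl//; apply: p_ge => // u [g [s [Ag s0 H]]].
    rewrite ler_pdivrMl//; apply: p_le.
      by have := linE t Ef (dominated_cst 0); rewrite addr0.
    exists (fun z => t * g z + 0), (t * s); split; [exact: Alin|rewrite mulr_ge0// ltW//|].
    move=> z; have := H z; rewrite -(ler_pM2l t0).
    have -> : (t *: f) z = t * (f : T -> R) z by [].
    move: (f z) (g z) (w z) => p1 p2 u'; lra.
  (* The zero function is dominated with every constant, so the lower bound [k (rho - M)] holds for
     arbitrarily small [k]. *)
  have p0 : p 0 = 0.
    have E0 : E 0 by exact: dominated_cst.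
    apply/eqP; rewrite eq_le; apply/andP; split.
      apply: p_le => //; exists (fun=> 0), 0; split => // z.
      by rewrite mul0r !addr0.
    apply: p_ge => // t Pt; apply/ler_addgt0Pr => e e0.
    have k0 : 0 < e / (`|rho - M| + 1) by rewrite divr_gt0// ltr_wpDl.
    have := P_ge k0 _ Pt; set k := e / _ => H.
    have : k * (rho - M) <= t.
      by apply: H => z; rewrite normr0 mulr_ge0 ?ltW// (lt_le_trans ltr01).
    have : - e <= k * (rho - M).
      rewrite -lerN2 opprK -mulrN /k mulrAC ler_pdivrMr ?ltr_wpDl// ler_pM2l//.
      by rewrite -normrN; apply: le_trans (ler_norm _) _; rewrite lerDl.
    lra.
  move=> t f; rewrite le_eqVlt => /predU1P[<- Ef|t0 Ef].
    by rewrite scale0r p0 mul0r.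
  apply/eqP; rewrite eq_le homo//=.
  have Etf : E (t *: f) by have := linE t Ef (dominated_cst 0); rewrite addr0.
  have := homo t^-1 _ _ Etf; rewrite invr_gt0 scalerA mulVf ?gt_eqF// scale1r => /(_ t0).
  by rewrite ler_pdivlMl.
Qed.

Lemma exists_occupation_functional : exists L : (T -> R) -> R,
  [/\ forall (a : R) f g, E f -> E g -> L (fun z => a * f z + g z) = a * L f + L g,
      forall f t, E f -> (forall z, f z <= t) -> L f <= t,
      forall f, A f -> L f = 0 & rho <= M - L w].
Proof.
have [L [Llin Lp]] := hahn_banach linE psub.
have Lle f t : E f -> (forall z, f z <= t) -> L f <= t.
  move=> Ef ft; apply: le_trans (Lp _ Ef) _; apply: p_le => //.
  by exists (fun=> 0), 0; split => // z; rewrite mul0r !addr0.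
have LA f : A f -> L f <= 0.
  move=> Af; have Ef : E f by exact: Asmall.
  apply: le_trans (Lp _ Ef) _; apply: p_le => //.
  exists (fun z => -1 * f z + 0), 0; split => //; first exact: Alin.
  by move=> z; rewrite mul0r !addr0 mulN1r subrr.
exists L; split => //.
- move=> f Af; apply/eqP; rewrite eq_le LA//=.
  have := LA _ (Alin (-1) Af A0).
  have := Llin (-1) f (fun=> 0) (Asmall Af) (dominated_cst 0).
  have -> : L (fun=> 0) = 0.
    apply/eqP; rewrite eq_le LA//=.
    have := Llin (-1) (fun=> 0) (fun=> 0) (dominated_cst 0) (dominated_cst 0).
    have -> : (-1 *: (fun=> 0) + (fun=> 0) : VT) = (fun=> 0).
      by apply/funext => z; change ((-1 : R) * 0 + 0 = 0); rewrite mulr0 addr0.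
    have := LA _ A0; lra.
  have -> : (-1 *: (f : VT) + (fun=> 0) : VT) = (fun z => -1 * f z + 0) by [].
  by move=> ->; lra.
- have Ew : E w by exists 1 => z; rewrite mul1r ger0_norm// (le_trans ler01).
  have := Lp w Ew => H.
  suff : p w <= M - rho by lra.
  apply: p_le => //; exists (fun=> 0), 1; split => // z.
  by rewrite mul1r addr0; lra.
Qed.

End OccupationFunctional.

Section Normalization.
Context d (T : measurableType d) (R : realType).
Variables (mu : {measure set T -> \bar R}) (P : probability T R) (theta : R).
Hypotheses (theta0 : 0 < theta) (mutheta : mu setT = theta%:E).
Local Open Scope ereal_scope.

Let k0 : (0 <= theta^-1)%R. Proof. by rewrite invr_ge0 ltW. Qed.
Let k : {nonneg R} := NngNum k0.

Let mnormalizeE U : mnormalize mu P U = mscale k mu U.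
Proof.
rewrite /mnormalize mutheta /mscale/= eqe gt_eqF//= muleC.
by congr (_ * _).
Qed.

Let ge0_integral_mnormalize f : measurable_fun setT f -> (forall x, 0 <= f x) ->
  \int[mnormalize mu P]_x f x = theta^-1%:E * \int[mu]_x f x.
Proof.
move=> mf f0; rewrite [LHS](eq_measure_integral (mscale k mu)); last first.
  by move=> A mA _; exact: mnormalizeE.
by rewrite ge0_integral_mscale.
Qed.

Lemma integral_mnormalize f : mu.-integrable setT f ->
  (mnormalize mu P).-integrable setT f /\
  \int[mnormalize mu P]_x f x = theta^-1%:E * \int[mu]_x f x.
Proof.
move=> If; have mf := measurable_int _ If; split.
  apply/integrableP; split => //; rewrite ge0_integral_mnormalize//; last first.
    exact: measurableT_comp.
  apply: lte_mul_pinfty; [by rewrite lee_fin|by []|].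
  by case/integrableP: If.
rewrite [LHS]integralE [in RHS]integralE muleBr//; last exact: integrable_add_def.
by rewrite !ge0_integral_mnormalize//; [exact: measurable_funeneg|exact: measurable_funepos].
Qed.

End Normalization.

Section OccupationMeasure.
Context {R : realType} {T : pseudoPMetricType R}.
Variables (e w : T -> R).
Hypotheses (ce : continuous e) (cw : continuous w) (e0 : forall z, 0 <= e z)
  (w1 : forall z, 1 <= w z)
  (cpt : forall r : R, compact [set z | e z <= r /\ w z <= r]).

Lemma dominated_Cc f : Cc f -> dominated_by w f.
Proof.
move=> Cf; have [M1 fM1] := Cc_bounded Cf; have [M2 fM2] := Cc_bounded (CcN Cf).
exists (`|M1| + `|M2|) => z.
apply: (@le_trans _ _ (`|M1| + `|M2|)); last by rewrite ler_peMr// addr_ge0.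
have := fM1 z; have := fM2 z; have := ler_norm M1; have := ler_norm M2.
have := normr_ge0 M1; have := normr_ge0 M2.
by rewrite ler_norml => *; apply/andP; split; lra.
Qed.

Definition cutoff (n : nat) (z : T) : R := Num.max 0 (Num.min 1 (n%:R - (e z + w z))).

Lemma cutoff_ge0 n z : 0 <= cutoff n z. Proof. by rewrite le_max lexx. Qed.

Lemma cutoff_le1 n z : cutoff n z <= 1.
Proof. by rewrite ge_max ler01 ge_min lexx. Qed.

Lemma cutoffS n z : cutoff n z <= cutoff n.+1 z.
Proof.
rewrite /cutoff ge_max le_max lexx/= le_max; apply/orP; right.
by rewrite le_min !ge_min lexx/= lerD2r ler_nat leqnSn orbT.
Qed.

Lemma cutoff_continuous n : continuous (cutoff n).
Proof.
move=> z; apply: (@continuous_max _ _ (fun=> 0) (fun z => Num.min 1 (n%:R - (e z + w z)))).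
  exact: cvg_cst.
apply: (@continuous_min _ _ (fun=> 1) (fun z => n%:R - (e z + w z))); first exact: cvg_cst.
apply: cvgB; first exact: cvg_cst.
by apply: cvgD; [exact: ce|exact: cw].
Qed.

Lemma cutoff0 z : cutoff 0 z = 0.
Proof.
apply/max_idPl; rewrite ge_min; apply/orP; right.
by have := e0 z; have := w1 z; lra.
Qed.

Lemma cutoff_eq0 n z : n%:R <= e z + w z -> cutoff n z = 0.
Proof. by move=> nz; apply/max_idPl; rewrite ge_min subr_le0 nz orbT. Qed.

Lemma cutoff_eq1 n z : e z + w z + 1 <= n%:R -> cutoff n z = 1.
Proof.
move=> nz; have H : 1 <= n%:R - (e z + w z) by lra.
by rewrite /cutoff min_l// max_r.
Qed.

Lemma cutoff_near1 z : \forall n \near \oo, cutoff n z = 1.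
Proof.
exists (Num.bound (e z + w z + 1)) => // n /= nz; apply: cutoff_eq1; apply/ltW.
have H : 0 <= e z + w z + 1 by have := e0 z; have := w1 z; lra.
by apply: (lt_le_trans (archi_boundP H)); rewrite ler_nat.
Qed.

Lemma Cc_cutoff n (f : T -> R) : continuous f -> Cc (fun z => f z * cutoff n z).
Proof.
move=> cf; split.
  by move=> z; apply: cvgM; [exact: cf|exact: cutoff_continuous].
exists [set z | e z <= n%:R /\ w z <= n%:R]; split; first exact: cpt.
move=> z /= H; rewrite cutoff_eq0 ?mulr0// leNgt; apply/negP => ewn; apply: H.
by have := e0 z; have := w1 z; split; lra.
Qed.

Variable L : (T -> R) -> R.
Hypotheses (Llin : forall (a : R) f g, dominated_by w f -> dominated_by w g ->
     L (fun z => a * f z + g z) = a * L f + L g)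
  (Lle : forall f t, dominated_by w f -> (forall z, f z <= t) -> L f <= t).

Lemma occupation_funD f g : dominated_by w f -> dominated_by w g ->
  L (fun z => f z + g z) = L f + L g.
Proof.
move=> Ef Eg; have := Llin 1 Ef Eg; rewrite mul1r => <-.
by congr (L _); apply/funext => z; rewrite mul1r.
Qed.

Lemma occupation_fun0 : L (fun=> 0) = 0.
Proof.
have E0 := dominated_cst w1 0.
have := Llin (-1) E0 E0.
have -> : (fun _ : T => -1 * 0 + 0) = (fun=> 0) :> (T -> R).
  by apply/funext => z; rewrite mulr0 addr0.
lra.
Qed.

Lemma occupation_funZ a f : dominated_by w f -> L (fun z => a * f z) = a * L f.
Proof.
move=> Ef; have := Llin a Ef (dominated_cst w1 0); rewrite occupation_fun0 addr0 => <-.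
by congr (L _); apply/funext => z; rewrite addr0.
Qed.

Lemma occupation_fun_homo f g : dominated_by w f -> dominated_by w g ->
  (forall z, f z <= g z) -> L f <= L g.
Proof.
move=> Ef Eg fg.
have := Llin (-1) Eg Ef.
have : L (fun z => -1 * g z + f z) <= 0.
  by apply: Lle => [|z]; [exact: dominated_lin|have := fg z; lra].
lra.
Qed.

Definition occupation_Cc : Cc_functional R T :=
  @CcFunctional R T L
    (fun f g Cf Cg => occupation_funD (dominated_Cc Cf) (dominated_Cc Cg))
    (fun a f Cf => occupation_funZ a (dominated_Cc Cf))
    (fun f t Cf _ ft => Lle (dominated_Cc Cf) ft).

Local Notation BT := (g_sigma_algebraType (@open T)).
Local Notation mu := (riesz_measure occupation_Cc).

Lemma occupation_measure_le1 : (mu setT <= 1)%E.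
Proof.
have C1 n : Cc (cutoff n).
  have -> : cutoff n = (fun z => 1 * cutoff n z) by apply/funext => z; rewrite mul1r.
  by apply: (@Cc_cutoff n (fun=> 1)) => z; exact: cvg_cst.
apply: riesz_measure_le C1 cutoffS cutoff_le1 cutoff0 _ => z.
by have [N _ NP] := cutoff_near1 z; exists N; apply: NP => /=.
Qed.

Lemma measurable_EFin_continuous (f : T -> R) : continuous f ->
  measurable_fun [set: BT] (fun x : BT => (f x)%:E : \bar R).
Proof. by move=> cf; apply/measurable_EFinP; exact: continuous_measurable_fun_open. Qed.

(** Only an inequality can hold: [L] may have a part at infinity that the measure does not see. It
    follows by monotone convergence along the cutoffs, where the two agree. *)
Lemma integral_occupation_le (f : T -> R) : continuous f -> dominated_by w f -> (forall z, 0 <= f z) ->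
  (\int[mu]_x (f x)%:E <= (L f)%:E)%E.
Proof.
move=> cf Ef f0.
have Ccf n := Cc_cutoff n cf.
have fc0 n z : 0 <= f z * cutoff n z by rewrite mulr_ge0// cutoff_ge0.
have -> : (\int[mu]_x (f x)%:E = \int[mu]_x (limn (fun n => (f x * cutoff n x)%:E)))%E.
  apply: eq_integral => x _; apply/esym/cvg_lim => //; apply: cvg_near_cst.
  by apply: filterS (cutoff_near1 x) => n ->; rewrite mulr1.
rewrite monotone_convergence//.
- apply: lime_le.
    apply: ereal_nondecreasing_is_cvgn => i j ij; apply: ge0_le_integral => //.
    + by move=> x _; rewrite lee_fin.
    + exact: (measurable_EFin_continuous (Ccf i).1).
    + exact: (measurable_EFin_continuous (Ccf j).1).
    + move=> x _; rewrite lee_fin ler_wpM2l//.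
      by have /nondecreasing_seqP := fun n => cutoffS n x; apply.
  apply: nearW => n; rewrite integral_riesz_measure//; last exact: occupation_measure_le1.
  rewrite lee_fin; apply: occupation_fun_homo => //; first exact: dominated_Cc.
  by move=> z; rewrite ler_piMr// cutoff_le1.
- by move=> n; exact: (measurable_EFin_continuous (Ccf n).1).
- by move=> n x _; rewrite lee_fin.
- move=> x _ i j ij; rewrite lee_fin ler_wpM2l//.
  by have /nondecreasing_seqP := fun n => cutoffS n x; apply.
Qed.

Lemma integrable_occupation (f : T -> R) : continuous f -> dominated_by w f ->
  mu.-integrable setT (EFin \o f).
Proof.
move=> cf [C fC]; apply/integrableP; split; first exact: measurable_EFin_continuous.
have Ef : dominated_by w (fun z => `|f z|) by exists C => z; rewrite normr_id.
apply: (@le_lt_trans _ _ (L (fun z => `|f z|))%:E); last exact: ltry.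
have := @integral_occupation_le (fun z => `|f z|) _ Ef (fun z => normr_ge0 _).
by apply => z; apply: cvg_norm; exact: cf.
Qed.

Lemma integral_occupation_Cc f : Cc f -> (\int[mu]_x (f x)%:E = (L f)%:E)%E.
Proof.
move=> Cf.
pose fp z := Num.max 0 (f z); pose fn z := Num.max 0 (- f z).
have cm : continuous (fun t : R => Num.max 0 t).
  by move=> t; apply: (@continuous_max _ _ (fun=> 0) id); [exact: cvg_cst|exact: cvg_id].
have Cp : Cc fp by apply: (Cc_comp0 cm) => //; rewrite maxxx.
have Cn : Cc fn.
  by apply: (Cc_comp0 cm (f := fun z => - f z)) => //; [rewrite maxxx|exact: CcN].
have p0 z : 0 <= fp z by rewrite le_max lexx.
have n0 z : 0 <= fn z by rewrite le_max lexx.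
have fE : f = fun z => fp z - fn z.
  apply/funext => z; rewrite /fp /fn; have [f0|f0] := leP 0 (f z).
    by rewrite max_l ?subr0// oppr_le0.
  by rewrite max_r ?oppr_ge0 ?(ltW f0)// sub0r opprK.
rewrite fE.
under eq_integral do rewrite EFinB.
rewrite integralB_EFin//; last 2 first.
- by apply: integrable_occupation; [exact: Cp.1|exact: dominated_Cc].
- by apply: integrable_occupation; [exact: Cn.1|exact: dominated_Cc].
rewrite !integral_riesz_measure//; try exact: occupation_measure_le1.
by rewrite -EFinB -(Cc_funB occupation_Cc Cp Cn).
Qed.

Lemma integral_occupation_cutoff_cvg (f : T -> R) : continuous f -> dominated_by w f ->
  (L (fun z => f z * cutoff n z))%:E @[n --> \oo] --> (\int[mu]_x (f x)%:E)%E.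
Proof.
move=> cf Ef.
have H := @dominated_convergence _ BT R mu setT measurableT
  (fun n x => (f x * cutoff n x)%:E) (fun x => (f x)%:E) (fun x => `|(f x)%:E|%E).
have [|||||_ _] := H.
- by move=> n; exact: (measurable_EFin_continuous (Cc_cutoff n cf).1).
- exact: measurable_EFin_continuous.
- apply: aeW => x _; apply: cvg_near_cst.
  by apply: filterS (cutoff_near1 x) => n ->; rewrite mulr1.
- by apply: integrable_abse; exact: integrable_occupation.
- apply: aeW => x n _; rewrite lee_fin normrM ler_piMr// ger0_norm ?cutoff_ge0//.
  exact: cutoff_le1.
have -> : (fun n => (L (fun z => f z * cutoff n z))%:E) =
    (fun n => \int[mu]_x (f x * cutoff n x)%:E)%E.
  by apply/funext => n; rewrite (integral_occupation_Cc (Cc_cutoff n cf)).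
exact.
Qed.

End OccupationMeasure.

Section ExistsOccupationProbability.
Context {R : realType} {T : pseudoPMetricType R}.
Variables (e w : T -> R) (A : set (T -> R)) (M rho : R).
Hypotheses (ce : continuous e) (cw : continuous w) (e0 : forall z, 0 <= e z)
  (w1 : forall z, 1 <= w z)
  (cpt : forall r : R, compact [set z | e z <= r /\ w z <= r])
  (A0 : A (fun=> 0))
  (Alin : forall (a : R) f g, A f -> A g -> A (fun z => a * f z + g z))
  (Acont : forall f, A f -> continuous f)
  (Asupp : forall f, A f -> exists r, forall z, r <= e z -> f z = 0)
  (Asmall : forall f, A f -> forall del, 0 < del -> exists C, forall z, `|f z| <= C + del * w z)
  (dual : forall f Q, A f -> (forall z, f z + (M - w z) <= Q) -> rho <= Q)
  (infty : exists del r0, 0 < del /\ forall z, r0 <= e z -> M - w z <= rho - del).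
Local Notation BT := (g_sigma_algebraType (@open T)).

(** The measure represents [L] on compactly supported functions and may have lost mass. The loss
    does not affect the functions of [A], which are small against [w] where mass can escape, and it
    cannot lower the mean of [M - w], because mass escapes only where [M - w < rho]. *)
Lemma exists_occupation_probability : exists mu : probability BT R,
  [/\ forall f, A f -> mu.-integrable setT (fun z : BT => (f z)%:E) /\ (\int[mu]_z (f z)%:E = 0)%E,
    mu.-integrable setT (fun z : BT => (M - w z)%:E) &
    (rho%:E <= \int[mu]_z (M - w z)%:E)%E].
Proof.
have Adom f : A f -> dominated_by w f.
  move=> Af; have [C fC] := Asmall Af ltr01; exists (`|C| + 1) => z.
  apply: (le_trans (fC z)); rewrite mul1r mulrDl mul1r lerD2r.
  by apply: le_trans (ler_norm C) _; rewrite ler_peMr.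
have [L [Llin Lle LA Lw]] := exists_occupation_functional w1 A0 Alin Adom dual.
pose mu : {measure set BT -> \bar R} := riesz_measure (occupation_Cc w1 Llin Lle).
have mu1 : (mu setT <= 1)%E by exact: (occupation_measure_le1 ce cw e0 w1 cpt Llin Lle).
have mufin : mu setT \is a fin_num.
  by rewrite ge0_fin_numE//; exact: le_lt_trans mu1 (ltry _).
pose theta := fine (mu setT).
have thetaE : mu setT = theta%:E by rewrite fineK.
have Edom : dominated_by w w by exists 1 => z; rewrite mul1r ger0_norm// (le_trans ler01).
have E1 := dominated_cst w1.
have Lcst a : L (fun=> a) <= a by apply: (Lle) => //; exact: (E1 a).
have Lcst1 a : L (fun=> a) = a.
  apply/eqP; rewrite eq_le Lcst/=.
  have := occupation_funZ w1 Llin (-1) (E1 a); have := Lcst (- a).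
  have -> : (fun _ : T => -1 * a) = (fun=> - a) by apply/funext => z; rewrite mulN1r.
  lra.
have Lw0 : 0 <= L w.
  apply: (@le_trans _ _ (L (fun=> 0))); first by rewrite Lcst1.
  apply: (occupation_fun_homo Llin Lle (E1 0) Edom) => z.
  exact: le_trans ler01 (w1 z).
have intmu f := @integrable_occupation R T e w ce cw e0 w1 cpt L Llin Lle f.
have HA f : A f -> mu.-integrable setT (EFin \o f) /\ (\int[mu]_z (f z)%:E = 0)%E.
  move=> Af; have cf := Acont Af; have Ef := Adom _ Af.
  split; first exact: intmu.
  have H1 := @integral_occupation_cutoff_cvg R T e w ce cw e0 w1 cpt L Llin Lle f cf Ef.
  apply: (cvg_unique _ H1); first exact: ereal_hausdorff.
  apply: cvg_EFin; first exact: nearW.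
  have -> : fine \o (fun n => (L (fun z => f z * cutoff e w n z))%:E) =
      (fun n => L (fun z => f z * cutoff e w n z)) by [].
  apply/cvgrPdist_le => eps eps0.
  (* Makes [2 del L w] at most [eps]. *)
  pose del := eps / (2 * (L w + 1)).
  have L2 : 0 < 2 * (L w + 1) by lra.
  have del0 : 0 < del by rewrite divr_gt0.
  have [C fC] := Asmall Af del0.
  have [r fr] := Asupp Af.
  exists (Num.bound (1 + `|r| + `|C| / del)) => // n /= Nn.
  have nb : 1 + `|r| + `|C| / del <= n%:R.
    have H : 0 <= 1 + `|r| + `|C| / del by rewrite !addr_ge0// divr_ge0// ltW.
    by apply/ltW; apply: (lt_le_trans (archi_boundP H)); rewrite ler_nat.
  pose g z := f z * cutoff e w n z.
  have Eg : dominated_by w g.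
    by apply: (dominated_Cc w1); exact: (Cc_cutoff ce cw e0 w1 cpt).
  have dw0 z : 0 <= 2 * del * w z.
    by apply: mulr_ge0; [apply: mulr_ge0 => //; exact: ltW|exact: le_trans ler01 (w1 z)].
  (* Where [f] is nonzero and the cutoff is not 1, [e < r] forces [w] to be large; the constant in
     [|f| <= C + del w] is then absorbed into a second [del w]. *)
  have fg z : `|f z - g z| <= 2 * del * w z.
    have -> : f z - g z = f z * (1 - cutoff e w n z) by rewrite /g; ring.
    have [/fr -> |ez] := leP r (e z).
      by rewrite mul0r normr0.
    have [ew|ew] := leP (e z + w z + 1) n%:R.
      by rewrite cutoff_eq1// subrr mulr0 normr0.
    have Cd : `|C| <= del * w z.
      rewrite -ler_pdivrMl// mulrC.
      have := ler_norm r; lra.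
    rewrite normrM; apply: (@le_trans _ _ `|f z|).
      rewrite ler_piMr// ger0_norm ?subr_ge0 ?cutoff_le1//.
      by rewrite lerBlDr lerDl cutoff_ge0.
    have := fC z; have := ler_norm C; lra.
  have Efg : dominated_by w (fun z => -1 * g z + f z) by exact: dominated_lin.
  have L1 : L (fun z => -1 * g z + f z) = - L g.
    by rewrite (Llin _ _ _ Eg Ef) (LA _ Af) addr0 mulN1r.
  have Ew2 a : dominated_by w (fun z => a * w z).
    by exists `|a| => z; rewrite normrM (@ger0_norm _ (w z))// (le_trans ler01).
  have LZw a : L (fun z => a * w z) = a * L w by exact: (occupation_funZ w1 Llin).
  rewrite sub0r normrN -normrN -L1 ler_norml.
  have H3 : 2 * del * L w <= eps.
    have dE : del * (2 * (L w + 1)) = eps by rewrite divfK// gt_eqF.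
    by move: (L w) dE => l dE; lra.
  apply/andP; split.
    apply: (@le_trans _ _ (- (2 * del) * L w)); first by rewrite mulNr lerN2.
    rewrite -LZw; apply: (occupation_fun_homo Llin Lle (Ew2 _) Efg) => z.
    by have := fg z; rewrite ler_norml => /andP[+ _]; lra.
  apply: le_trans H3; rewrite -LZw; apply: (occupation_fun_homo Llin Lle Efg (Ew2 _)) => z.
  by have := fg z; rewrite ler_norml => /andP[_]; lra.
have [del [r0 [del0 Hinf]]] := infty.
(* Nonnegative far out, so its negative part is compactly supported and integrates exactly to its
   value under [L]; for the positive part an inequality remains, in the favourable direction. *)
pose u z := (rho - del) - (M - w z).
pose up z := Num.max 0 (u z); pose un z := Num.max 0 (- u z).
have cu : continuous u.
  move=> z; apply: cvgB; first exact: cvg_cst.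
  by apply: cvgB; [exact: cvg_cst|exact: cw].
have cup : continuous up.
  by move=> z; apply: (@continuous_max _ _ (fun=> 0) u); [exact: cvg_cst|exact: cu].
have cun : continuous un.
  move=> z; apply: (@continuous_max _ _ (fun=> 0) (fun z => - u z)); first exact: cvg_cst.
  by apply: cvgN; exact: cu.
have up0 z : 0 <= up z by rewrite le_max lexx.
have un0 z : 0 <= un z by rewrite le_max lexx.
have upn z : u z = up z - un z.
  rewrite /up /un; have [u0|u0] := leP 0 (u z).
    by rewrite max_l ?subr0// oppr_le0.
  by rewrite max_r ?oppr_ge0 ?(ltW u0)// sub0r opprK.
have Cun : Cc un.
  split; first exact: cun.
  exists [set z | e z <= Num.max r0 (M - rho + del) /\ w z <= Num.max r0 (M - rho + del)].
  split; first exact: cpt.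
  move=> z /= H; apply/max_idPl; rewrite oppr_le0 leNgt; apply/negP => uz; apply: H.
  rewrite !le_max; split; apply/orP; [left|right; rewrite /u in uz; lra].
  rewrite leNgt; apply/negP => /ltW/Hinf; rewrite /u in uz; lra.
have Edun : dominated_by w un by exact: dominated_Cc.
have Edu : dominated_by w u.
  have -> : u = fun z => 1 * w z + (rho - del - M).
    by apply/funext => z; rewrite /u; ring.
  exact: dominated_lin.
have Edup : dominated_by w up.
  have -> : up = fun z => 1 * u z + un z by apply/funext => z; rewrite upn; ring.
  exact: dominated_lin.
have Lu : L up - L un <= - del.
  have H : L u = L up - L un.
    have -> : u = fun z => -1 * un z + up z by apply/funext => z; rewrite upn; ring.
    by rewrite Llin//; ring.
  have : L u = L w + (rho - del - M).
    have -> : u = fun z => 1 * w z + (rho - del - M) by apply/funext => z; rewrite /u; ring.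
    by rewrite Llin// Lcst1 mul1r.
  lra.
have Iun : (\int[mu]_z (un z)%:E = (L un)%:E)%E.
  exact: (@integral_occupation_Cc R T e w ce cw e0 w1 cpt L Llin Lle un Cun).
have Iup : (\int[mu]_z (up z)%:E <= (L up)%:E)%E.
  exact: (@integral_occupation_le R T e w ce cw e0 w1 cpt L Llin Lle up cup Edup up0).
have Lup0 : 0 <= L up.
  apply: (@le_trans _ _ (L (fun=> 0))); first by rewrite Lcst1.
  exact: (occupation_fun_homo Llin Lle (E1 0) Edup).
(* Since [L un >= L up + del > 0], the bounded function [un] has a positive integral, so some mass
   is left. *)
have theta0 : 0 < theta.
  have [K unK] := Cc_bounded Cun.
  have : (\int[mu]_z (un z)%:E <= \int[mu]_z (`|K|)%:E)%E.
    apply: ge0_le_integral => //.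
    - by move=> z _; rewrite lee_fin.
    - exact: measurable_EFin_continuous.
    - by move=> z _; rewrite lee_fin; apply: le_trans (unK z) (ler_norm _).
  rewrite Iun integral_cst// thetaE -EFinM lee_fin => H.
  have t0 : 0 <= theta by rewrite fine_ge0.
  rewrite lt_neqAle t0 andbT; apply/negP => /eqP th; move: H; rewrite -th mulr0; lra.
pose P : probability BT R := mnormalize mu (dirac point).
have intP f (If : mu.-integrable setT f) := integral_mnormalize (dirac point) theta0 thetaE If.
exists P; split.
- move=> f /HA[If If0]; have [If' E] := intP _ If.
  by split; [exact: If'|rewrite /P [LHS]E If0 mule0].
- have Iw : mu.-integrable setT (fun z : BT => (M - w z)%:E).
    apply: intmu.
      by move=> z; apply: cvgB; [exact: cvg_cst|exact: cw].
    have -> : (fun z => M - w z) = fun z => -1 * w z + M by apply/funext => z; ring.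
    exact: dominated_lin.
  by case: (intP _ Iw).
- have Iw : mu.-integrable setT (fun z : BT => (M - w z)%:E).
    apply: intmu.
      by move=> z; apply: cvgB; [exact: cvg_cst|exact: cw].
    have -> : (fun z => M - w z) = fun z => -1 * w z + M by apply/funext => z; ring.
    exact: dominated_lin.
  have [_ ->] := intP _ Iw.
  (* As [∫ up <= L up] and [L up - L un <= - del], the right side is at least
     [(rho - del) theta + del], which is at least [rho theta] because [theta <= 1]. Dividing by
     [theta] gives the claim. *)
  have IE : (\int[mu]_z (M - w z)%:E = ((rho - del) * theta + L un)%:E - \int[mu]_z (up z)%:E)%E.
    have Icst : mu.-integrable setT (EFin \o (fun=> rho - del)).
      by apply: intmu; [exact: cst_continuous|exact: E1].
    have Iun' : mu.-integrable setT (EFin \o un) by exact: intmu.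
    have Iup' : mu.-integrable setT (EFin \o up) by exact: intmu.
    rewrite EFinD EFinM -thetaE -integral_cst// -Iun.
    rewrite -integralD//; first rewrite -integralB//.
    - apply: eq_integral => z _ /=; rewrite -!EFinD; congr (_%:E).
      by have := upn z; rewrite /u; lra.
    - exact: integrableD.
  have Iup0 : (0 <= \int[mu]_z (up z)%:E)%E by apply: integral_ge0 => z _; rewrite lee_fin.
  rewrite IE; case: (\int[mu]_z (up z)%:E)%E Iup Iup0 => [I| |] // Iup _.
  rewrite -EFinB -EFinM lee_fin -ler_pdivrMl ?invr_gt0// invrK.
  rewrite lee_fin in Iup.
  have th1 : theta <= 1 by rewrite -lee_fin -thetaE.
  nra.
Qed.

End ExistsOccupationProbability.

(** * Continuity and growth of A f and R *)

Section ContinuityOnZ.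
Context {R : realType} {d m : nat} {K : pseudoPMetricType R}.
Variables (b : 'rV[R]_d -> K -> 'rV[R]_d) (S : 'rV[R]_d -> 'M[R]_(d, m)) (c : 'rV[R]_d -> K -> R).
Local Notation Z := ('rV[R]_d * K * 'rV[R]_d)%type.
Hypotheses (A1 : assumption_A1 b S) (A2 : assumption_A2 c).

Lemma continuous_zx_comp (U : topologicalType) (h : 'rV[R]_d -> U) : continuous h ->
  continuous (fun z : Z => h (zx z)).
Proof.
move=> ch z; apply: (@continuous_comp _ _ _ (fun z : Z => z.1.1) h); last exact: ch.
by apply: (@continuous_comp _ _ _ (fun z : Z => z.1) fst); exact: cvg_fst.
Qed.

Lemma continuous_zy_comp (U : topologicalType) (h : 'rV[R]_d -> U) : continuous h ->
  continuous (fun z : Z => h (zy z)).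
Proof.
move=> ch z; apply: (@continuous_comp _ _ _ (fun z : Z => z.2) h); last exact: ch.
exact: cvg_snd.
Qed.

Lemma continuous_zxxi_comp (h : 'rV[R]_d * K -> R) : continuous h ->
  continuous (fun z : Z => h (zx z, zxi z)).
Proof.
move=> ch z.
have -> : (fun z : Z => h (zx z, zxi z)) = (fun z : Z => h z.1).
  by apply/funext => -[[x xi] y].
apply: (@continuous_comp _ _ _ (fun z : Z => z.1) h); last exact: ch.
exact: cvg_fst.
Qed.

Lemma sigma_continuous i j : continuous (fun x => S x i j).
Proof.
suff main (x : 'rV[R]_d) : (fun y : 'rV[R]_d => S y i j) @ nbhs x --> S x i j.
  by move=> x; exact: main.
have [_ H _] := A1.
have R0 : 0 < enorm x + 1 by rewrite ltr_wpDl// enorm_ge0.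
have [CR [CR0 [Hl _]]] := H _ R0.
apply/cvgrPdist_lt => e e0.
have xb : oball (enorm x + 1) x by rewrite /oball/= ltrDl.
have ce : continuous (fun y : 'rV[R]_d => CR * enorm (x - y)).
  apply: continuous_mulf; first exact: cst_continuous.
  apply: continuous_enorm_comp => k; under eq_fun do rewrite !mxE.
  apply: continuous_addf; first exact: cst_continuous.
  by move=> y; apply: continuousN; exact: coord_continuous.
have c0 := ce x; rewrite /continuous_at subrr enorm0 mulr0 in c0.
have H1 : nbhs x [set y | CR * enorm (x - y) < e] by apply: (cvgr_lt _ c0 _ e0).
have H2 : nbhs x (oball (enorm x + 1)) by apply: open_nbhs_nbhs; split => //; exact: open_oball.
apply: filterS (filterI H1 H2) => y /= [ye yb].
(* (A1) bounds the increments of [b] and [S] together, for every control; [point] is an arbitrary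
   choice. *)
apply: le_lt_trans ye; apply: le_trans (Hl x y point xb yb).
have -> : S x i j - S y i j = (S x - S y) i j by rewrite !mxE.
by apply: le_trans (fnorm_ge_coord _ _ _) _; rewrite lerDr enorm_ge0.
Qed.

Lemma diffm_continuous i j : continuous (fun x => diffm S x i j).
Proof.
under eq_fun do rewrite mxE.
apply: continuous_sum => k; under eq_fun do rewrite mxE.
by apply: continuous_mulf; exact: sigma_continuous.
Qed.

Lemma grad_coord_continuous g i : C2on setT g -> continuous (fun x : 'rV[R]_d => grad g x ord0 i).
Proof. by move=> Cg; under eq_fun do rewrite mxE; exact: C2_continuous_partial. Qed.

Lemma half_tr_continuous g : C2on setT g -> continuous (half_tr S g).
Proof.
move=> Cg; apply: continuous_mulf; first exact: cst_continuous.
apply: continuous_sum => i; apply: continuous_sum => j.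
by apply: continuous_mulf; [exact: diffm_continuous|exact: C2_continuous_partial2].
Qed.

Lemma Lop_continuous g : C2on setT g -> continuous (fun p : 'rV[R]_d * K => Lop b S g p.1 p.2).
Proof.
move=> Cg; have [cb _ _] := A1.
have cfst (h : 'rV[R]_d -> R) : continuous h ->
    continuous (fun p : 'rV[R]_d * K => h p.1).
  by move=> ch p; apply: (@continuous_comp _ _ _ fst h); [exact: cvg_fst|exact: ch].
apply: continuous_addf; first exact: (cfst _ (half_tr_continuous Cg)).
apply: continuous_edot => i; last exact: (cfst (fun x => grad g x ord0 i) (grad_coord_continuous Cg)).
exact: (continuous_coord_comp cb).
Qed.

Lemma Gam_continuous (T : topologicalType) (f g : T -> 'rV[R]_d) (h : T -> 'rV[R]_d) :
  (forall i, continuous (fun x => f x ord0 i)) -> (forall i, continuous (fun x => g x ord0 i)) ->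
  continuous h -> continuous (fun t => Gam (S (h t)) (f t) (g t)).
Proof.
move=> cf cg ch.
have cS i j : continuous (fun t => S (h t) i j).
  by move=> t; apply: (@continuous_comp _ _ _ h (fun x => S x i j));
    [exact: ch|exact: sigma_continuous].
by apply: continuous_edot => i; exact: continuous_mulmx_coord.
Qed.

Lemma Gam_grad_continuous f g : C2on setT f -> C2on setT g ->
  continuous (fun x => Gam (S x) (grad f x) (grad g x)).
Proof.
move=> Cf Cg; apply: Gam_continuous => [i|i|x]; [exact: grad_coord_continuous|exact: grad_coord_continuous|].
exact: cvg_id.
Qed.

Lemma zy_coord_continuous i : continuous (fun z : Z => zy z ord0 i).
Proof. by apply: (continuous_zy_comp (h := fun y => y ord0 i)); exact: coord_continuous. Qed.

Lemma Aop_continuous g : C2on setT g -> continuous (fun z : Z => Aop b S g z).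
Proof.
move=> Cg; under eq_fun do rewrite AopE.
apply: continuous_addf; first exact: (continuous_zxxi_comp (Lop_continuous Cg)).
apply: Gam_continuous => [i|i|].
- exact: zy_coord_continuous.
- exact: (continuous_zx_comp (grad_coord_continuous Cg)).
- by apply: (continuous_zx_comp (h := id)) => x; exact: cvg_id.
Qed.

Lemma Gam_zy_continuous : continuous (fun z : Z => Gam (S (zx z)) (zy z) (zy z)).
Proof.
apply: Gam_continuous => [i|i|]; [exact: zy_coord_continuous|exact: zy_coord_continuous|].
by apply: (continuous_zx_comp (h := id)) => x; exact: cvg_id.
Qed.

Lemma Rfun_continuous : continuous (fun z : Z => Rfun S c z).
Proof.
have [cc _ _ _] := A2.
rewrite /Rfun; under eq_fun do rewrite enorm_mulmx_sqr.
apply: continuous_addf; first exact: (continuous_zxxi_comp cc).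
have cq := @continuous_mulf R Z (fun=> - 2^-1) _ (@cst_continuous _ _ (- 2^-1 : R)) Gam_zy_continuous.
by under eq_fun do rewrite -mulNr.
Qed.

Lemma partial_eq0 (f : 'rV[R]_d -> R) (U : set 'rV[R]_d) i x :
  open U -> (forall y, U y -> f y = 0) -> U x -> partial i f x = 0.
Proof.
move=> oU f0 Ux; rewrite /partial -(derive_cst (0 : R) x (evec i)).
apply: near_eq_derive; apply: filterS (open_nbhs_nbhs (conj oU Ux)) => y Uy.
exact: f0.
Qed.

(** Derivatives are seen to vanish only on the open set [r < |x|], hence the larger radius. *)
Lemma C2c_support g : C2c g -> exists r, [/\ 0 < r,
  forall x, r <= enorm x -> grad g x = 0 & forall x xi, r <= enorm x -> Lop b S g x xi = 0].
Proof.
move=> [Cg [r gr]].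
pose U : set 'rV[R]_d := [set x | r < enorm x].
have oU : open U.
  rewrite /U (_ : [set _ | _] = enorm @^-1` [set t | r < t])//.
  by apply: open_comp; [move=> x _; exact: continuous_enorm|exact: open_gt].
have g0 y : U y -> g y = 0 by move=> /ltW; exact: gr.
have g1 i y : U y -> partial i g y = 0 by exact: partial_eq0 g0.
have g2 i j y : U y -> partial j (partial i g) y = 0 by apply: partial_eq0 => //; exact: g1.
exists (`|r| + 1).
have rU x : `|r| + 1 <= enorm x -> U x by rewrite /U/=; have := ler_norm r; lra.
have gr0 x : `|r| + 1 <= enorm x -> grad g x = 0.
  by move=> /rU Ux; apply/rowP => i; rewrite !mxE g1.
split => //.
move=> x xi xr; rewrite /Lop gr0// edot0r addr0 /half_tr big1 ?mulr0// => i _.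
by rewrite big1// => j _; rewrite g2 ?mulr0//; exact: rU.
Qed.

Lemma compact_bounded_above (T : topologicalType) (A : set T) (f : T -> R) :
  compact A -> continuous f -> exists M, forall x, A x -> f x <= M.
Proof.
move=> cA cf; have [A0|/set0P A0] := eqVneq A set0.
  by exists 0 => x; rewrite A0.
have [x0 _ xmax] := @compact_EVT_max _ R f A A0 cA (continuous_subspaceT cf).
by exists (f x0) => x Ax; apply: xmax; rewrite inE.
Qed.

Hypothesis cK : compact [set: K].

Lemma C2c_bounds g : C2c g -> exists M, 0 <= M /\
  (forall x xi, `|Lop b S g x xi| <= M) /\ (forall x, Gam (S x) (grad g x) (grad g x) <= M).
Proof.
move=> Cg; have [Cg2 _] := Cg; have [r [r0 gr Lr]] := C2c_support Cg.
have cA : compact (cball r `*` [set: K] : set ('rV[R]_d * K)).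
  by apply: compact_setX => //; exact: compact_cball.
have cL : continuous (fun p : 'rV[R]_d * K => `|Lop b S g p.1 p.2|).
  by apply: continuous_compf (Lop_continuous Cg2) _ => p; exact: norm_continuous.
have [M1 H1] := compact_bounded_above cA cL.
have [M2 H2] := compact_bounded_above (@compact_cball R d r) (Gam_grad_continuous Cg2 Cg2).
exists (`|M1| + `|M2|); split; first exact: addr_ge0.
split=> [x xi|x].
  have [/Lr ->|xr] := leP r (enorm x); first by rewrite normr0 addr_ge0.
  apply: (@le_trans _ _ M1); first by apply: (H1 (x, xi)); split => //=; exact: ltW.
  by apply: le_trans (ler_norm _) _; rewrite lerDl.
have [/gr ->|xr] := leP r (enorm x); first by rewrite Gam0r addr_ge0.
apply: (@le_trans _ _ M2); first by apply: H2; exact: ltW.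
by apply: le_trans (ler_norm _) _; rewrite lerDr.
Qed.

(** Young's inequality: A g is affine in y with bounded coefficients, and any small multiple of the
    quadratic term dominates it. *)
Lemma C2c_Aop_small g : C2c g -> forall del, 0 < del -> exists C, forall z : Z,
  `|Aop b S g z| <= C + del * (2^-1 * Gam (S (zx z)) (zy z) (zy z)).
Proof.
move=> Cg del del0; have [M [M0 [ML MG]]] := C2c_bounds Cg.
exists (M + del^-1 * M) => z; rewrite AopE.
apply: le_trans (ler_normD _ _) _; rewrite -addrA; apply: lerD; first exact: ML.
set u := zy z; set v := grad g (zx z); set s := S (zx z).
(* Here [e] is a sign, so one computation gives both sides of the absolute value. *)
have key (e : R) : e ^+ 2 = 1 -> e * Gam s u v <= del^-1 * M + del * (2^-1 * Gam s u u).
  move=> e2; have := Gam_ge0 s (del *: u - e *: v).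
  rewrite GamDl !GamDr !GamNl !GamNr !GamZl !GamZr (GamC _ v u) !mulrA.
  rewrite -[e * e]expr2 e2 mul1r.
  have := MG (zx z); rewrite -/v -/s => h1 h2.
  have d0 : 0 < del^-1 by rewrite invr_gt0.
  have h3 : del^-1 * (del * del * Gam s u u - 2 * del * e * Gam s u v + M) =
      del * Gam s u u - 2 * (e * Gam s u v) + del^-1 * M.
    by move: (Gam s u u) (Gam s u v) => p q; field; rewrite gt_eqF.
  have h4 : 0 <= del^-1 * (del * del * Gam s u u - 2 * del * e * Gam s u v + M).
    rewrite mulr_ge0 ?(ltW d0)//; move: (Gam s u u) (Gam s u v) (Gam s v v) h1 h2 => p q t h1 h2.
    lra.
  rewrite h3 in h4.
  have h5 : 0 <= del^-1 * M by rewrite mulr_ge0// ltW.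
  move: (Gam s u u) (Gam s u v) h4 => p q h4; lra.
have k1 := key 1 (expr1n _ _).
have k2 : -1 * Gam s u v <= del^-1 * M + del * (2^-1 * Gam s u u).
  by apply: key; rewrite sqrrN expr1n.
by rewrite ler_norml; apply/andP; split; lra.
Qed.

End ContinuityOnZ.

Section TestFunctions.
Context {R : realType} {d m : nat} {K : ptopologicalType}.
Variables (b : 'rV[R]_d -> K -> 'rV[R]_d) (S : 'rV[R]_d -> 'M[R]_(d, m)).

Lemma C2c_lin (a : R) (f g : 'rV[R]_d -> R) : C2c f -> C2c g -> C2c (fun x => a * f x + g x).
Proof.
move=> [Cf [r fr]] [Cg [s gs]]; split; first by case: (C2D (C2Z a Cf) Cg).
exists (Num.max r s) => x; rewrite ge_max => /andP[rx sx].
by rewrite fr// gs// mulr0 addr0.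
Qed.

Lemma C2c_cst0 : C2c (fun=> 0 : R) (d := d).
Proof. by split; [case: (@C2_cst R d 0)|exists 0]. Qed.

Lemma Aop_lin (a : R) (f g : 'rV[R]_d -> R) z : C2on setT f -> C2on setT g ->
  Aop b S (fun x => a * f x + g x) z = a * Aop b S f z + Aop b S g z.
Proof.
move=> Cf Cg; have Caf := C2Z a Cf.
rewrite !AopE (LopD b S _ _ Caf Cg) (LopZ b S a _ _ Cf) (gradD _ Caf Cg) (gradZ a _ Cf).
rewrite GamDr GamZr.
move: (Lop _ _ _ _ _) (Lop _ _ _ _ _) (Gam _ _ _) (Gam _ _ _) => p1 p2 p3 p4; ring.
Qed.

Lemma Aop_cst0 (z : Zsp R d K) : Aop b S (fun=> 0) z = 0.
Proof.
by rewrite AopE (Lop_cst b S 0) [grad _ _](grad_cst 0) Gam0r addr0.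
Qed.

End TestFunctions.

Section ProductSpace.
Context {R : realType} {d : nat} {K : pseudoPMetricType R}.
Local Notation Z := ('rV[R]_d * K * 'rV[R]_d)%type.

(* Packing the metric structure of the product by hand keeps its topology convertible, by
   mere unfolding, to the canonical product topology of [ZB]. *)
Let P : pseudoPMetricType R :=
  HB.pack Z (Pointed.class (Z : pointedType)) (PseudoMetric.class (Z : pseudoMetricType R)).

Lemma exists_occupation_probability_Z (e w : Z -> R) (A : set (Z -> R)) (M rho : R) :
  continuous e -> continuous w -> (forall z, 0 <= e z) -> (forall z, 1 <= w z) ->
  (forall r : R, compact [set z | e z <= r /\ w z <= r]) ->
  A (fun=> 0) ->
  (forall (a : R) f g, A f -> A g -> A (fun z => a * f z + g z)) ->
  (forall f, A f -> continuous f) ->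
  (forall f, A f -> exists r, forall z, r <= e z -> f z = 0) ->
  (forall f, A f -> forall del, 0 < del -> exists C, forall z, `|f z| <= C + del * w z) ->
  (forall f Q, A f -> (forall z, f z + (M - w z) <= Q) -> rho <= Q) ->
  (exists del r0, 0 < del /\ forall z, r0 <= e z -> M - w z <= rho - del) ->
  exists mu : probability (ZB R d K) R,
  [/\ forall f, A f -> mu.-integrable setT (fun z : ZB R d K => (f z)%:E) /\ (\int[mu]_z (f z)%:E = 0)%E,
    mu.-integrable setT (fun z : ZB R d K => (M - w z)%:E) &
    (rho%:E <= \int[mu]_z (M - w z)%:E)%E].
Proof.
exact: (@exists_occupation_probability R P e w A M rho).
Qed.
End ProductSpace.

Section ExistsOptimal.
Context {R : realType} {d m : nat} {K : pseudoPMetricType R}.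
Variables (b : 'rV[R]_d -> K -> 'rV[R]_d) (S : 'rV[R]_d -> 'M[R]_(d, m)) (c : 'rV[R]_d -> K -> R).
Local Notation Z := ('rV[R]_d * K * 'rV[R]_d)%type.
Hypotheses (A1 : assumption_A1 b S) (A2 : assumption_A2 c) (cK : compact [set: K]).
Variable rho : R.
Hypotheses (dual : forall g Q, C2c g -> (forall z : Z, Aop b S g z + Rfun S c z <= Q) -> rho <= Q)
  (infty : exists del r0, 0 < del /\ forall x xi, r0 <= enorm x -> c x xi <= rho - del).

Lemma continuous_zx_enorm : continuous (fun z : Z => enorm (zx z)).
Proof. by apply: (continuous_zx_comp (h := @enorm R d)); exact: continuous_enorm. Qed.

Lemma closed_le_fun (T : topologicalType) (f : T -> R) (r : R) :
  continuous f -> closed [set x | f x <= r].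
Proof.
move=> cf; rewrite (_ : [set _ | _] = f @^-1` [set t | t <= r])//.
by apply: closed_comp; [move=> x _; exact: cf|exact: closed_le].
Qed.

(** As [c] is bounded above, a lower bound on R bounds |σᵀy|², and ellipticity on a ball in x turns
    this into a bound on y. *)
Lemma compact_Rfun_superlevel (r t : R) :
  compact [set z : Z | enorm (zx z) <= r /\ t <= Rfun S c z].
Proof.
have [_ HR _] := A1; have [_ _ [M cM] _] := A2.
have [|CR [CR0 [_ ell]]] := HR (`|r| + 1); first by rewrite ltr_wpDl.
(* A bound [B] on |y|² gives |y| <= 1 + B, which avoids a square root. *)
pose r' := 1 + CR * (2 * (M + `|t|)).
apply: (@subclosed_compact _ _ (cball r `*` [set: K] `*` cball r')).
- have -> : [set z : Z | enorm (zx z) <= r /\ t <= Rfun S c z] =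
      [set z | enorm (zx z) <= r] `&` [set z | - Rfun S c z <= - t].
    by apply/seteqP; split => z /= [h1 h2]; split => //; rewrite lerN2 in h2 *.
  apply: closedI; first exact: closed_le_fun continuous_zx_enorm.
  apply: closed_le_fun => z; apply: continuousN.
  exact: (Rfun_continuous A1 A2).
- by apply: compact_setX; [apply: compact_setX => //; exact: compact_cball|exact: compact_cball].
- move=> [[x xi] y] /= [xr tR]; split => //=.
  have xr1 : oball (`|r| + 1) x by rewrite /oball/=; have := ler_norm r; rewrite /zx/= in xr; lra.
  have := ell x y xr1; rewrite edotC edot_diffm => H.
  rewrite /Rfun enorm_mulmx_sqr /zx/= /zxi/= /zy/= in tR.
  have Gy : Gam (S x) y y <= 2 * (M + `|t|).
    by have := cM x xi; have := ler_norm (- t); rewrite normrN; lra.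
  have H1 : enorm y ^+ 2 <= CR * (2 * (M + `|t|)).
    by apply: (@le_trans _ _ (CR * Gam (S x) y y)); rewrite ?ler_pM2l// -ler_pdivrMl.
  rewrite /cball/= /r'; have := sqr_ge0 (enorm y - 1); rewrite sqrrB1; have := enorm_ge0 y; lra.
Qed.

Lemma exists_optimal : exists mu : probability (ZB R d K) R,
  [/\ MA b S mu, mu.-integrable setT (fun z : ZB R d K => (Rfun S c z)%:E) &
    (rho%:E <= \int[mu]_z (Rfun S c z)%:E)%E].
Proof.
have [_ _ [M cM] _] := A2.
(* With [M] an upper bound of [c], the extra 1 gives [w >= 1]. *)
pose w (z : Z) := M + 1 - Rfun S c z.
have wE z : w z - 1 = (M - c (zx z) (zxi z)) + 2^-1 * Gam (S (zx z)) (zy z) (zy z).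
  by rewrite /w /Rfun enorm_mulmx_sqr; ring.
have cw : continuous w.
  apply: continuous_addf; first exact: cst_continuous.
  by move=> z; apply: continuousN; exact: (Rfun_continuous A1 A2).
have w1 z : 1 <= w z.
  rewrite -subr_ge0 wE addr_ge0//; first by rewrite subr_ge0.
  by rewrite mulr_ge0// ?invr_ge0// Gam_ge0.
have wR z : M + 1 - w z = Rfun S c z by rewrite /w; ring.
pose A : set (Z -> R) := [set f | exists2 g, C2c g & f = Aop b S g].
have [||||||||mu [H1 H2 H3]] := @exists_occupation_probability_Z R d K (fun z : Z => enorm (zx z)) w A (M + 1) rho
  continuous_zx_enorm cw (fun z => enorm_ge0 _) w1.
- move=> r; rewrite (_ : [set _ | _] = [set z : Z | enorm (zx z) <= r /\ M + 1 - r <= Rfun S c z]).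
    exact: compact_Rfun_superlevel.
  by apply/funext => z /=; apply/propext; rewrite /w; split => -[h1 h2]; split => //; lra.
- by exists (fun=> 0); [exact: C2c_cst0|apply/funext => z; rewrite Aop_cst0].
- move=> a _ _ [f Cf ->] [g Cg ->]; exists (fun x => a * f x + g x); first exact: C2c_lin.
  by apply/funext => z; rewrite Aop_lin; [|case: Cf|case: Cg].
- by move=> _ [g [Cg _] ->]; exact: (Aop_continuous A1 Cg).
- move=> _ [g Cg ->]; have [r [_ gr Lr]] := C2c_support b S Cg.
  by exists r => z rz; rewrite AopE Lr// gr// Gam0r addr0.
- move=> _ [g Cg ->] del del0.
  have [C HC] := C2c_Aop_small A1 cK Cg del0.
  exists C => z; apply: (le_trans (HC z)); rewrite lerD2l ler_pM2l//.
  by have := wE z; have := cM (zx z) (zxi z); lra.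
- by move=> _ Q [g Cg ->] H; apply: (dual Cg) => z; rewrite -wR; exact: H.
- have [del [r0 [del0 Hd]]] := infty; exists del, r0; split => // z rz.
  rewrite wR /Rfun; have := Hd _ (zxi z) rz.
  by have := sqr_ge0 (enorm (zy z *m S (zx z))); lra.
have E : (fun z : Z => M + 1 - w z) = Rfun S c by apply/funext.
exists mu; split.
- by move=> f Cf; apply: H1; exists f.
- by rewrite -E.
- by rewrite -E.
Qed.

End ExistsOptimal.

(** * Upper bound over the stationary measures *)

Section OneDim.
Context {R : realType}.

Lemma is_derive1_ln1D (s : R) : 0 <= s -> is_derive s (1 : R) (fun t => ln (1 + t)) (1 + s)^-1.
Proof.
move=> s0; have s1 : 0 < 1 + s by rewrite ltr_pwDl.
have H : is_derive s (1 : R) (fun t : R => 1 + t) 1.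
  apply: (is_derive_eq (is_deriveD (is_derive_cst (1 : R) s 1) (is_derive_id s 1))).
  by rewrite add0r.
by apply: (is_derive_eq (is_derive_compR H (is_derive1_ln s1))); rewrite mulr1.
Qed.

Lemma is_derive1_affine (a e s : R) : is_derive s (1 : R) (fun t => a + e * t) e.
Proof.
have H := is_deriveD (is_derive_cst a s (1 : R)) (is_deriveZ e (is_derive_id s (1 : R))).
by apply: (is_derive_eq H); rewrite add0r /GRing.scale/= mulr1.
Qed.

Lemma is_derive1_inv1D (s : R) : 0 <= s ->
  is_derive s (1 : R) (fun t => (1 + t)^-1) (- ((1 + s)^-1 ^+ 2)).
Proof.
move=> s0; have s1 : 1 + s != 0 by rewrite gt_eqF// ltr_pwDl.
have H : is_derive s (1 : R) (fun t : R => 1 + t) 1.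
  apply: (is_derive_eq (is_deriveD (is_derive_cst (1 : R) s 1) (is_derive_id s 1))).
  by rewrite add0r.
apply: (is_derive_eq (is_deriveV s1 H)).
by rewrite /GRing.scale/= mulr1 -exprVn.
Qed.

Lemma is_derive1_inv (s : R) : s != 0 -> is_derive s (1 : R) (fun t => t^-1) (- (s^-1 ^+ 2)).
Proof.
move=> s0; pose f (t : R) := t; have n0 : f s != 0 by [].
have H : is_derive s (1 : R) f 1 by exact: is_derive_id.
by apply: (is_derive_eq (is_deriveV n0 H)); rewrite /f /GRing.scale/= mulr1 -exprVn.
Qed.

Lemma continuous_inv_sqr (s : R) : s != 0 -> {for s, continuous (fun t : R => - (t^-1 ^+ 2))}.
Proof.
move=> s0; apply: cvgN.
apply: (@continuous_comp _ _ _ (fun t : R => t^-1) (fun t => t ^+ 2)); last exact: exprn_continuous.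
by apply: cvgV => //; exact: cvg_id.
Qed.

(** At 0 the difference quotient vanishes on the left and tends to [Q' 0 = 0] on the right. Applied
    twice, this gives the second derivatives of the cutoffs below. *)
Lemma is_derive1_pospart (Q Q' : R -> R) :
  (forall s : R, is_derive s (1 : R) Q (Q' s)) -> Q' 0 = 0 ->
  forall s : R, is_derive s (1 : R) (fun t => Q (Num.max 0 t)) (Q' (Num.max 0 s)).
Proof.
move=> dQ Q0 s; have [s0|s0|->] := ltgtP s 0.
- rewrite Q0.
  apply: (near_eq_is_derive _ (is_derive_cst (Q 0) s 1)).
  by near=> t; rewrite /= max_l// ltW//; near: t; exact: lt_nbhsl.
- apply: (near_eq_is_derive _ (dQ s)).
  by near=> t; rewrite /= max_r// ltW//; near: t; exact: lt_nbhsr.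
- rewrite Q0.
  have [dQ0 E0] := dQ 0.
  have HQ : (fun h : R => h^-1 *: (Q (h *: (1 : R) + 0) - Q 0)) @ 0^' --> Q' 0.
    by rewrite -E0 /derive; exact: (dQ0).
  rewrite Q0 in HQ E0.
  have H : (fun h : R => h^-1 *: (Q (Num.max 0 (h *: (1 : R) + 0)) - Q (Num.max 0 0))) @ 0^' --> (0 : R).
    apply/cvgrPdist_lt => e e0; have /cvgrPdist_lt/(_ e e0) := HQ.
    apply: filterS => h; rewrite !sub0r !normrN maxxx.
    have [h0|h0] := leP (0 : R) (h *: (1 : R) + 0 : R) => //.
    by move=> _; rewrite subrr scaler0 normr0.
  split; first by apply/cvg_ex; exists 0.
  exact: cvg_lim H.
Unshelve. all: by end_near. Qed.

Lemma continuous_pospart (Q : R -> R) : continuous Q -> continuous (fun t : R => Q (Num.max 0 t)).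
Proof.
move=> cQ; apply: (@continuous_compf _ _ (fun t : R => Num.max 0 t) Q); last by move=> t; exact: cQ.
under eq_fun do rewrite maxr_absE sub0r normrN add0r.
apply: continuous_mulf; last exact: cst_continuous.
by apply: continuous_addf => t; [exact: cvg_id|exact: norm_continuous].
Qed.

End OneDim.

Section LogNorm.
Context {R : realType} {d m : nat} {K : Type}.
Variables (b : 'rV[R]_d -> K -> 'rV[R]_d) (S : 'rV[R]_d -> 'M[R]_(d, m)).
Variable C0 : R.
Hypothesis growth : forall x xi, enorm (b x xi) ^+ 2 + fnorm (S x) ^+ 2 <= C0 * (1 + enorm x ^+ 2).

Definition log_norm (x : 'rV[R]_d) : R := ln (1 + edot x x).

Lemma log_norm_ge0 x : 0 <= log_norm x.
Proof. by apply: ln_ge0; rewrite lerDl edot_ge0. Qed.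

Lemma log_norm_ge (M : R) x : expR M <= enorm x -> M <= log_norm x.
Proof.
move=> Mx; rewrite -(expRK M) ler_ln ?posrE ?expR_gt0//; last first.
  by rewrite ltr_pwDl// edot_ge0.
apply: (le_trans Mx); rewrite -enorm_sqr; have := sqr_ge0 (enorm x - 1).
by have := enorm_ge0 x; rewrite sqrrB1; lra.
Qed.

Let d1 (x : 'rV[R]_d) : is_derive (edot x x) (1 : R) (fun t => ln (1 + t)) ((1 + edot x x)^-1).
Proof. exact/is_derive1_ln1D/edot_ge0. Qed.
Let d2 (x : 'rV[R]_d) : is_derive (edot x x) (1 : R) (fun t => (1 + t)^-1) (- ((1 + edot x x)^-1 ^+ 2)).
Proof. exact/is_derive1_inv1D/edot_ge0. Qed.
Let c2 (x : 'rV[R]_d) : {for edot x x, continuous (fun t : R => - ((1 + t)^-1 ^+ 2))}.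
Proof.
apply: (@continuousN _ _ _ (fun t : R => (1 + t)^-1 ^+ 2)).
apply: (@continuous_comp _ _ _ (fun t : R => (1 + t)^-1) (fun t => t ^+ 2)); last exact: exprn_continuous.
have [H _] := d2 x; apply: differentiable_continuous; exact/derivable1_diffP.
Qed.

Lemma C2_log_norm : C2on setT log_norm.
Proof. by case: (@C2_sqr R d) => Cs _ _; exact: (C2_compose Cs d1 d2 c2). Qed.

(** The first derivatives of ln (1 + |x|²) decay like 1/|x| and the second ones like 1/|x|², exactly
    what linear growth of [b] and [S] requires. *)
Lemma log_norm_bounds : exists2 C, 0 <= C &
  (forall x xi, `|Lop b S log_norm x xi| <= C) /\
  (forall x (xi : K), Gam (S x) (grad log_norm x) (grad log_norm x) <= C).
Proof.
case: (@C2_sqr R d) => Cs _ _.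
have key x (xi : K) : Gam (S x) (grad log_norm x) (grad log_norm x) <= 4 * `|C0| /\
    `|Lop b S log_norm x xi| <= 1 + 4 * `|C0|.
  have -> := Lop_comp b S Cs d1 d2 c2 x xi.
  have -> : grad log_norm x = (1 + edot x x)^-1 *: (2 *: x).
    by rewrite -grad_sqr; exact: (grad_comp Cs d1 d2 c2 x).
  rewrite Lop_sqr grad_sqr !GamZl !GamZr.
  have := growth x xi; have := Gam_le_fnorm (S x) x; rewrite !enorm_sqr.
  have := edot_le_sqr (b x xi) x; have := edot_le_sqr (- b x xi) x.
  rewrite edotNl !enorm_sqr edotNl edotNr opprK.
  have := Gam_ge0 (S x) x; have := sqr_ge0 (fnorm (S x)); have := edot_ge0 (b x xi).
  have := edot_ge0 x.
  move: (edot (b x xi) (b x xi)) (edot (b x xi) x) (edot x x) (fnorm (S x) ^+ 2) (Gam (S x) x x).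
  move=> be e s F G s0 be0 F0 G0 H1 H2 H3 H4.
  have D0 : 0 < 1 + s by lra.
  have C00 : 0 <= C0 by rewrite -(pmulr_lge0 _ D0); apply: le_trans H4; exact: addr_ge0.
  rewrite (ger0_norm C00); set q := (1 + s)^-1; have q0 : 0 < q by rewrite invr_gt0.
  have qD : q * (1 + s) = 1 by rewrite mulVf// gt_eqF.
  have B1 : q * (F + 2 * e) <= q * ((C0 + 1) * (1 + s)) by rewrite ler_pM2l//; lra.
  have B2 : q * (- (F + 2 * e)) <= q * ((C0 + 1) * (1 + s)) by rewrite ler_pM2l//; lra.
  have B3 : q ^+ 2 * G <= q ^+ 2 * (C0 * (1 + s) ^+ 2).
    rewrite ler_pM2l ?exprn_gt0//; apply: (le_trans H3).
    have B4 : F * s <= F * (1 + s) by apply: ler_wpM2l => //; lra.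
    apply: (le_trans B4); rewrite expr2 mulrA ler_pM2r//; lra.
  rewrite mulrCA qD mulr1 in B1; rewrite mulrCA qD mulr1 mulrN in B2.
  rewrite mulrCA -exprMn qD expr1n mulr1 in B3.
  have q2G : 0 <= q ^+ 2 * G by rewrite mulr_ge0// sqr_ge0.
  set u := (X in X <= _); set v := `|_|.
  have -> : u = 4 * (q ^+ 2 * G) by rewrite /u; ring.
  have -> : v = `|q * (F + 2 * e) - 2 * (q ^+ 2 * G)| by rewrite /v; congr `|_|; field.
  split; first by lra.
  by rewrite ler_norml; lra.
exists (1 + 4 * `|C0|); first by rewrite addr_ge0// mulr_ge0.
split => [x xi|x xi]; first by case: (key x xi).
by case: (key x xi) => H _; apply: (le_trans H); rewrite lerDr.
Qed.

End LogNorm.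

Section Truncation.
Context {R : realType}.
Variable k : R.
Hypothesis k1 : 1 <= k.

Definition trunc (s : R) : R := k * atan (s / k).
Definition trunc1 (s : R) : R := (1 + (s / k) ^+ 2)^-1.
Definition trunc2 (s : R) : R := - (2 * s / k ^+ 2) * trunc1 s ^+ 2.

Let k0 : k != 0. Proof. by rewrite gt_eqF// (lt_le_trans ltr01). Qed.
Let p0 s : 1 + (s / k) ^+ 2 != 0.
Proof. by rewrite gt_eqF// ltr_pwDl// sqr_ge0. Qed.

Lemma is_derive_trunc s : is_derive s (1 : R) trunc (trunc1 s).
Proof.
have H : is_derive s (1 : R) (fun t : R => 0 + k^-1 * t) k^-1 by exact: is_derive1_affine.
have E : (fun t : R => 0 + k^-1 * t) s = s / k by rewrite add0r mulrC.
have H2 : is_derive (0 + k^-1 * s) (1 : R) (@atan R) (1 + (s / k) ^+ 2)^-1.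
  by rewrite E; exact: is_derive1_atan.
have H3 := is_deriveZ k (is_derive_compR H H2).
have E4 : k *: ((1 + (s / k) ^+ 2)^-1 * k^-1) = trunc1 s.
  by rewrite /GRing.scale/= mulrC -mulrA mulVf// mulr1.
apply: (near_eq_is_derive _ (is_derive_eq H3 E4)).
by near=> t; rewrite /trunc !fctE /GRing.scale/= add0r (mulrC k^-1).
Unshelve. all: by end_near. Qed.

Lemma is_derive_trunc1 s : is_derive s (1 : R) trunc1 (trunc2 s).
Proof.
have H : is_derive s (1 : R) (fun t : R => 0 + k^-1 * t) k^-1 by exact: is_derive1_affine.
have := is_deriveD (is_derive_cst (1 : R) s 1) (is_deriveX 2 H).
set f := (X in is_derive _ _ X); have -> : f = (fun t => 1 + (t / k) ^+ 2).
  by apply/funext => t; rewrite /f !fctE/= add0r (mulrC k^-1).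
move=> H1; suff : is_derive s (1 : R) (fun t => (1 + (t / k) ^+ 2)^-1) (trunc2 s) by [].
have H5 : is_derive s (1 : R) (fun t : R => 1 + (t / k) ^+ 2) (2 * (s / k) / k).
  by apply: (is_derive_eq H1); rewrite /GRing.scale/= !add0r expr1 (mulrC k^-1) -mulr_natl mulr1.
pose f2 (t : R) := 1 + (t / k) ^+ 2; have N : f2 s != 0 by exact: p0.
have H6 : is_derive s (1 : R) f2 (2 * (s / k) / k) by exact: H5.
apply: (is_derive_eq (is_deriveV N H6)).
rewrite /f2 /trunc2 /trunc1 /GRing.scale/=; move: (p0 s) => p0s.
rewrite exprVn; set q := (_ ^- 2); field; exact: k0.
Qed.

Lemma continuous_trunc2 : continuous trunc2.
Proof.
have c1 : continuous trunc1.
  by move=> s; have [H _] := is_derive_trunc1 s; apply: differentiable_continuous; exact/derivable1_diffP.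
have -> : trunc2 = fun s => (- (2 / k ^+ 2) * s) * (trunc1 s * trunc1 s).
  by apply/funext => s; rewrite /trunc2 expr2; ring.
apply: continuous_mulf; last exact: continuous_mulf.
by apply: continuous_mulf; [exact: cst_continuous|move=> s; exact: cvg_id].
Qed.

Lemma trunc1_bounds s : 0 <= trunc1 s <= 1.
Proof.
rewrite /trunc1 invr_ge0 addr_ge0 ?sqr_ge0//= invf_le1 ?lerDl ?sqr_ge0//.
by rewrite ltr_pwDl// sqr_ge0.
Qed.

(** From 2|u| <= 1 + u² with u = s/k. The second-order error of the truncation is thereby a fraction
    1/k of the energy weighted by [trunc1]. *)
Lemma trunc2_le s : `|trunc2 s| <= trunc1 s / k.
Proof.
have /andP[t0 _] := trunc1_bounds s; have kp : 0 < k := lt_le_trans ltr01 k1.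
have -> : trunc2 s = - ((2 * (s / k) * trunc1 s) * (trunc1 s / k)).
  by rewrite /trunc2; field.
have tk0 : 0 <= trunc1 s / k by apply: divr_ge0 => //; exact: ltW.
rewrite normrN normrM (ger0_norm tk0); apply: ler_piMl => //.
have q0 : 0 < 1 + (s / k) ^+ 2 by rewrite ltr_pwDl// sqr_ge0.
rewrite normrM (ger0_norm t0) /trunc1 ler_pdivrMr// mul1r.
rewrite ler_norml; have := sqr_ge0 (s / k - 1); have := sqr_ge0 (s / k + 1).
by rewrite sqrrB1 sqrrD1; lra.
Qed.

Lemma trunc_le s : `|trunc s| <= 2 * k.
Proof.
have kp : 0 < k := lt_le_trans ltr01 k1.
rewrite /trunc normrM (gtr0_norm kp) mulrC ler_pM2r// ler_norml.
have := atan_gtNpi2 (s / k); have := atan_ltpi2 (s / k); have := @pihalf_lt2 R.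
by move: (pi / 2) => p; lra.
Qed.

End Truncation.

Section Cutoff.
Context {R : realType} {d m : nat} {K : Type}.
Variables (b : 'rV[R]_d -> K -> 'rV[R]_d) (S : 'rV[R]_d -> 'M[R]_(d, m)).

Definition cut_arg (e : R) (x : 'rV[R]_d) : R := Num.max 0 (1 + - e * log_norm x).
(** The cube is the lowest integer power of a positive part that is twice continuously
    differentiable. *)
Definition cut (e : R) (x : 'rV[R]_d) : R := cut_arg e x ^+ 3.

Let q0 (e t : R) := Num.max 0 (1 + - e * t) ^+ 3.
Let q1 (e t : R) := 3 * Num.max 0 (1 + - e * t) ^+ 2 * - e.
Let q2 (e t : R) := 6 * Num.max 0 (1 + - e * t) * e ^+ 2.

Let p1 (e s : R) : is_derive s (1 : R) (q0 e) (q1 e s).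
Proof.
have H := is_derive1_affine 1 (- e) s.
have dQ (t : R) : is_derive t (1 : R) (fun u : R => u ^+ 3) (3 * t ^+ 2).
  have H3 := is_deriveX 3 (is_derive_id t (1 : R)).
  by apply: (is_derive_eq H3); rewrite /GRing.scale/= mulr1.
have dQ0 : (3 : R) * 0 ^+ 2 = 0 by rewrite expr0n mulr0.
exact: (is_derive_compR H (is_derive1_pospart dQ dQ0 (1 + - e * s))).
Qed.

Let p2 (e s : R) : is_derive s (1 : R) (q1 e) (q2 e s).
Proof.
have H := is_derive1_affine 1 (- e) s.
have dQ (t : R) : is_derive t (1 : R) (fun u : R => 3 * u ^+ 2 * - e) (6 * t * - e).
  have H3 := is_deriveZ (3 * - e) (is_deriveX 2 (is_derive_id t (1 : R))).
  have E : (3 * - e) *: ((2 * t ^+ 1) *: (1 : R)) = 6 * t * - e.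
    by rewrite /GRing.scale/= expr1; ring.
  apply: (near_eq_is_derive _ (is_derive_eq H3 E)).
  by near=> u; rewrite !fctE [LHS](_ : _ = (3 * - e) * (u : R) ^+ 2)//; ring.
have dQ0 : (6 : R) * 0 * - e = 0 by rewrite mulr0 mul0r.
apply: (is_derive_eq (is_derive_compR H (is_derive1_pospart dQ dQ0 (1 + - e * s)))).
by rewrite /q2; ring.
Unshelve. all: by end_near. Qed.

Let c2 (e s : R) : {for s, continuous (q2 e)}.
Proof.
apply: (@continuous_compf _ _ (fun t => 1 + - e * t) (fun t : R => 6 * Num.max 0 t * e ^+ 2)).
  apply: continuous_addf; first exact: cst_continuous.
  by apply: continuous_mulf; [exact: cst_continuous|move=> t; exact: cvg_id].
move=> t; apply: (@continuous_pospart _ (fun t : R => 6 * t * e ^+ 2)).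
apply: continuous_mulf; last exact: cst_continuous.
by apply: continuous_mulf; [exact: cst_continuous|move=> u; exact: cvg_id].
Qed.

Lemma C2_cut e : C2on setT (cut e).
Proof.
exact: (@C2_compose R d _ (q0 e) (q1 e) (q2 e) (@C2_log_norm R d) (fun x => p1 e (log_norm x)) (fun x => p2 e (log_norm x))
  (fun x => @c2 e (log_norm x))).
Qed.

Lemma grad_cut e x : grad (cut e) x = (3 * cut_arg e x ^+ 2 * - e) *: grad log_norm x.
Proof.
exact: (@grad_comp R d _ (q0 e) (q1 e) (q2 e) (@C2_log_norm R d) (fun x => p1 e (log_norm x)) (fun x => p2 e (log_norm x))
  (fun x => @c2 e (log_norm x)) x).
Qed.

Lemma Lop_cut e x xi : Lop b S (cut e) x xi = 3 * cut_arg e x ^+ 2 * - e * Lop b S log_norm x xi +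
  6 * cut_arg e x * e ^+ 2 * (2^-1 * Gam (S x) (grad log_norm x) (grad log_norm x)).
Proof.
exact: (@Lop_comp R d m K b S _ (q0 e) (q1 e) (q2 e) (@C2_log_norm R d)
  (fun x => p1 e (log_norm x)) (fun x => p2 e (log_norm x)) (fun x => @c2 e (log_norm x)) x xi).
Qed.

Lemma cut_arg_bounds e x : 0 <= e -> 0 <= cut_arg e x <= 1.
Proof.
move=> e0; rewrite /cut_arg le_max lexx/= ge_max ler01/= mulNr gerDl oppr_le0.
exact: mulr_ge0 e0 (log_norm_ge0 x).
Qed.

Lemma cut_support e : 0 < e -> exists r, forall x, r <= enorm x -> cut e x = 0.
Proof.
move=> e0; exists (expR e^-1) => x /log_norm_ge H.
rewrite /cut /cut_arg max_l ?expr0n//.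
have : e * e^-1 <= e * log_norm x by rewrite ler_pM2l.
by rewrite mulfV ?gt_eqF// mulNr; lra.
Qed.

End Cutoff.

Section TestFunction.
Context {R : realType} {d m : nat} {K : ptopologicalType}.
Variables (b : 'rV[R]_d -> K -> 'rV[R]_d) (S : 'rV[R]_d -> 'M[R]_(d, m)) (c : 'rV[R]_d -> K -> R).
Variables (phi : 'rV[R]_d -> R) (rho C0 : R).
Hypothesis growth : forall x xi, enorm (b x xi) ^+ 2 + fnorm (S x) ^+ 2 <= C0 * (1 + enorm x ^+ 2).
Hypothesis Cphi : C2on setT phi.
Hypothesis HJ : forall x xi,
  Lop b S phi x xi + 2^-1 * Gam (S x) (grad phi x) (grad phi x) + c x xi <= rho.

(** The truncation is of size [k], so a cutoff of slope [k ^- 2] leaves an error of order 1/k.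
    [test_weight] is the factor with which A φ enters A of this function. *)
Definition test_fun (k : R) (x : 'rV[R]_d) : R := cut (k ^- 2) x * trunc k (phi x).
Definition test_weight (k : R) (x : 'rV[R]_d) : R := cut (k ^- 2) x * trunc1 k (phi x).

Lemma C2_trunc k : 1 <= k -> C2on setT (fun x => trunc k (phi x)).
Proof.
move=> k1; exact: (C2_compose Cphi (fun x => is_derive_trunc k1 (phi x))
  (fun x => is_derive_trunc1 k1 (phi x)) (fun x => @continuous_trunc2 R k k1 (phi x))).
Qed.

Lemma test_fun_C2c k : 1 <= k -> C2c (test_fun k).
Proof.
move=> k1; split; first by case: (C2M (C2_cut (k ^- 2)) (C2_trunc k1)).
have [|r Hr] := @cut_support R d (k ^- 2); first by rewrite invr_gt0 exprn_gt0// (lt_le_trans ltr01).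
by exists r => x /Hr; rewrite /test_fun => ->; rewrite mul0r.
Qed.

Lemma test_weight_bounds k x : 1 <= k -> 0 <= test_weight k x <= 1.
Proof.
move=> k1; rewrite /test_weight /cut.
have /andP[a0 a1] : 0 <= cut_arg (k ^- 2) x <= 1.
  by apply: cut_arg_bounds; rewrite invr_ge0 exprn_ge0// (le_trans ler01).
have /andP[t0 t1] := trunc1_bounds k (phi x).
by rewrite mulr_ge0 ?exprn_ge0//= mulr_ile1 ?exprn_ge0// exprn_ile1.
Qed.

(* Here [q = 1 / k]. The cross term of the gradients of the cutoff and of [phi] carries [w ^+ 2]
   only; AM-GM splits it as [2 w ^+ 2 <u, p> <= w <u, u> + w ^+ 3 <p, p>]. *)
Lemma test_fun_estimate (w t1 t2 T q k C L h Ll gll gyl glp gyp gyy rc : R) :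
  0 <= w <= 1 -> 0 <= t1 <= 1 -> 0 < q -> q <= 1 -> k * q = 1 -> `|t2| <= t1 * q -> `|T| <= 2 * k ->
  0 <= C -> 0 <= h -> `|Ll| <= C -> 0 <= gll -> gll <= C -> `|gyl| <= 2^-1 * (gyy + gll) ->
  - glp * w *+ 2 <= gll + w ^+ 2 * (2 * h) -> 0 <= gyy -> L + h <= rc ->
  w ^+ 3 * (t1 * L + t2 * h) + T * (3 * w ^+ 2 * - q ^+ 2 * (Ll + gyl) + 6 * w * (q ^+ 2) ^+ 2 * (2^-1 * gll)) +
  3 * w ^+ 2 * - q ^+ 2 * (t1 * glp) + w ^+ 3 * (t1 * gyp) <=
  w ^+ 3 * t1 * (rc - h + gyp) + 4 * q * (w ^+ 3 * t1 * h) +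
  21 * (C + 1) * q * (1 + 2^-1 * gyy).
Proof.
move=> /andP[w0 w1] /andP[t0 t11] q0 q1 kq t2b Tb C0' h0 Llb gll0 gllC gylb glpb gyy0 Lrc.
have w30 : 0 <= w ^+ 3 by rewrite exprn_ge0.
have w20 : 0 <= w ^+ 2 by rewrite exprn_ge0.
have w21 : w ^+ 2 <= 1 by rewrite exprn_ile1.
have q20 : 0 <= q ^+ 2 by rewrite exprn_ge0// ltW.
have q2q : q ^+ 2 <= q by rewrite expr2 ler_piMl// ltW.
have B1 : w ^+ 3 * t1 * L <= w ^+ 3 * t1 * (rc - h) by apply: ler_wpM2l; [exact: mulr_ge0|lra].
have B2 : w ^+ 3 * t2 * h <= q * (w ^+ 3 * t1 * h).
  rewrite mulrA; apply: ler_wpM2r => //; rewrite mulrCA; apply: ler_wpM2l => //.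
  by apply: (le_trans (ler_norm _)); rewrite mulrC.
(* The operator A applied to the cutoff: of order [q ^+ 2], it becomes of order [q] after
   multiplication by [T], which is at most [2 k]. *)
pose X := 3 * w ^+ 2 * - q ^+ 2 * (Ll + gyl) + 6 * w * (q ^+ 2) ^+ 2 * (2^-1 * gll).
have Xb : `|X| <= q ^+ 2 * (9 * (C + 1) * (1 + 2^-1 * gyy)).
  have XE : X = q ^+ 2 * (w ^+ 2 * (- 3 * (Ll + gyl)) + w * q ^+ 2 * (3 * gll)) by rewrite /X; field.
  rewrite XE normrM (ger0_norm q20); apply: ler_wpM2l => //.
  apply: le_trans (ler_normD _ _) _.
  have D1 : `|w ^+ 2 * (- 3 * (Ll + gyl))| <= 3 * (C + 2^-1 * (gyy + C)).
    rewrite normrM (ger0_norm w20); apply: (@le_trans _ _ (1 * `|- 3 * (Ll + gyl)|)).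
      exact: ler_wpM2r.
    rewrite mul1r normrM normrN normr_nat; apply: ler_wpM2l => //.
    by apply: le_trans (ler_normD _ _) _; lra.
  have D2 : `|w * q ^+ 2 * (3 * gll)| <= 3 * C.
    have wq : 0 <= w * q ^+ 2 <= 1.
      by rewrite mulr_ge0//= mulr_ile1// (le_trans q2q).
    have g3 : 0 <= 3 * gll by lra.
    rewrite normrM (ger0_norm g3); apply: (@le_trans _ _ (1 * (3 * gll))); last by lra.
    apply: ler_wpM2r => //; case/andP: wq => wq0 wq1; by rewrite ger0_norm.
  have D3 : 0 <= C * (2^-1 * gyy) by apply: mulr_ge0 => //; lra.
  have -> : 9 * (C + 1) * (1 + 2^-1 * gyy) = 9 * C + 9 + 9 * (C * (2^-1 * gyy)) + 9 * (2^-1 * gyy) by ring.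
  by lra.
have B3 : T * X <= 18 * (C + 1) * q * (1 + 2^-1 * gyy).
  apply: (le_trans (ler_norm _)); rewrite normrM.
  have -> : 18 * (C + 1) * q * (1 + 2^-1 * gyy) = 2 * k * (q ^+ 2 * (9 * (C + 1) * (1 + 2^-1 * gyy))).
    have -> : 2 * k * (q ^+ 2 * (9 * (C + 1) * (1 + 2^-1 * gyy))) = (k * q) * (18 * (C + 1) * q * (1 + 2^-1 * gyy)) by ring.
    by rewrite kq mul1r.
  exact: ler_pM.
(* The cross term gives three of the four parts in [4 q], the other one being [B2], and raises the
   constant from 18 to 21. *)
have B4 : 3 * w ^+ 2 * - q ^+ 2 * (t1 * glp) <= 3 * q * (w ^+ 3 * t1 * h) + 3 * (C + 1) * q * (1 + 2^-1 * gyy).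
  have E1 : w * (- glp * w *+ 2) <= w * (gll + w ^+ 2 * (2 * h)) by apply: ler_wpM2l.
  have E2 : w * gll <= C by apply: le_trans gllC; apply: ler_piMl.
  have E3 : - (w ^+ 2 * glp) <= 2^-1 * C + w ^+ 3 * h.
    have -> : - (w ^+ 2 * glp) = 2^-1 * (w * (- glp * w *+ 2)) by field.
    have F1 : w * (gll + w ^+ 2 * (2 * h)) = w * gll + 2 * (w ^+ 3 * h) by ring.
    by rewrite F1 in E1; lra.
  have -> : 3 * w ^+ 2 * - q ^+ 2 * (t1 * glp) = 3 * q ^+ 2 * (t1 * - (w ^+ 2 * glp)) by ring.
  have E4 : t1 * - (w ^+ 2 * glp) <= t1 * (2^-1 * C + w ^+ 3 * h) by apply: ler_wpM2l.
  have wh0 : 0 <= w ^+ 3 * h by rewrite mulr_ge0.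
  have E5 : t1 * (2^-1 * C + w ^+ 3 * h) <= 2^-1 * C + w ^+ 3 * t1 * h.
    have F2 : t1 * (2^-1 * C) <= 2^-1 * C by apply: ler_piMl => //; lra.
    have -> : w ^+ 3 * t1 * h = t1 * (w ^+ 3 * h) by ring.
    lra.
  have wth0 : 0 <= w ^+ 3 * t1 * h by rewrite !mulr_ge0.
  have E6 : q ^+ 2 * (t1 * - (w ^+ 2 * glp)) <= q ^+ 2 * (2^-1 * C + w ^+ 3 * t1 * h).
    by apply: ler_wpM2l => //; lra.
  have E7 : q ^+ 2 * (2^-1 * C + w ^+ 3 * t1 * h) <= q * (2^-1 * C + w ^+ 3 * t1 * h).
    by apply: ler_wpM2r => //; lra.
  have F3 : 0 <= q * C by apply: mulr_ge0 => //; exact: ltW.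
  have F4 : 0 <= q * (C + 1) * (2^-1 * gyy) by rewrite !mulr_ge0//; lra.
  have -> : 3 * (C + 1) * q * (1 + 2^-1 * gyy) = 3 * (q * C) + 3 * q + 3 * (q * (C + 1) * (2^-1 * gyy)) by ring.
  rewrite -mulrA; have -> : 3 * q * (w ^+ 3 * t1 * h) = 3 * (q * (w ^+ 3 * t1 * h)) by ring.
  have F5 : q * (2^-1 * C + w ^+ 3 * t1 * h) = 2^-1 * (q * C) + q * (w ^+ 3 * t1 * h) by ring.
  by rewrite F5 in E7; lra.
have -> : w ^+ 3 * (t1 * L + t2 * h) + T * X + 3 * w ^+ 2 * - q ^+ 2 * (t1 * glp) + w ^+ 3 * (t1 * gyp) =
  w ^+ 3 * t1 * L + w ^+ 3 * t2 * h + T * X + 3 * w ^+ 2 * - q ^+ 2 * (t1 * glp) + w ^+ 3 * t1 * gyp.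
  by ring.
have -> : w ^+ 3 * t1 * (rc - h + gyp) = w ^+ 3 * t1 * (rc - h) + w ^+ 3 * t1 * gyp by ring.
have -> : 21 * (C + 1) * q * (1 + 2^-1 * gyy) = 18 * (C + 1) * q * (1 + 2^-1 * gyy) + 3 * (C + 1) * q * (1 + 2^-1 * gyy) by ring.
have -> : 4 * q * (w ^+ 3 * t1 * h) = q * (w ^+ 3 * t1 * h) + 3 * q * (w ^+ 3 * t1 * h) by ring.
by lra.
Qed.

(** By completing the square, the first bracket equals ρ - R - ½|σᵀ(y - ∇φ)|². The two error terms
    are kept apart because the one in the energy of φ can only be absorbed, until that energy is
    known to be integrable. *)
Lemma Aop_test_fun_le : exists2 C, 0 <= C & forall k (z : Zsp R d K), 1 <= k ->
  let x := zx z in let y := zy z in let p := grad phi x in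
  Aop b S (test_fun k) z <=
  test_weight k x * (rho - c x (zxi z) - 2^-1 * Gam (S x) p p + Gam (S x) y p) +
  4 / k * (test_weight k x * (2^-1 * Gam (S x) p p)) +
  C / k * (1 + 2^-1 * Gam (S x) y y).
Proof.
have [C C0' [HL HG]] := log_norm_bounds growth.
exists (21 * (C + 1)); first by lra.
move=> k [[x xi] y] k1 /=; rewrite AopE /test_fun /test_weight /cut /zx /zxi /zy/=.
have k0 : 0 < k := lt_le_trans ltr01 k1.
have Cc := C2_cut (k ^- 2) (R := R) (d := d); have Ct := C2_trunc k1.
rewrite (LopM b S x xi Cc Ct) (gradM x Cc Ct) !GamDr !GamZr grad_cut !GamZl !GamZr Lop_cut.
have -> := Lop_comp b S Cphi (fun x => is_derive_trunc k1 (phi x))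
  (fun x => is_derive_trunc1 k1 (phi x)) (fun x => @continuous_trunc2 R k k1 (phi x)) x xi.
have -> := grad_comp Cphi (fun x => is_derive_trunc k1 (phi x))
  (fun x => is_derive_trunc1 k1 (phi x)) (fun x => @continuous_trunc2 R k k1 (phi x)) x.
rewrite !GamZr /cut.
have p0 := Gam_ge0 (S x) (grad phi x); have y0 := Gam_ge0 (S x) y.
have l0 := Gam_ge0 (S x) (grad log_norm x).
have lC := HG x xi; have LC := HL x xi; have HJx := HJ x xi.
have G1 := Gam_le_sqr (S x) y (grad log_norm x).
have G2 := Gam_le_sqr (S x) (- y) (grad log_norm x).
(* The sign of the multiple of ∇φ is the one that bounds the cross term from the side needed. *)
have G3 := Gam_le_sqr (S x) (grad log_norm x) (- cut_arg (k ^- 2) x *: grad phi x).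
rewrite !(GamNl, GamNr) opprK in G2; rewrite !(GamZl, GamZr) in G3.
have wb : 0 <= cut_arg (k ^- 2) x <= 1.
  by apply: cut_arg_bounds; rewrite invr_ge0 exprn_ge0// ltW.
have tb := trunc1_bounds k (phi x); have t2b := trunc2_le k1 (phi x); have Tb := trunc_le k1 (phi x).
have q0 : 0 < k^-1 by rewrite invr_gt0.
have q1 : k^-1 <= 1 by rewrite invf_le1.
have kq : k * k^-1 = 1 by rewrite mulfV// gt_eqF.
move: G1 G2 G3 p0 y0 l0 lC LC HJx wb tb t2b Tb; rewrite -!exprVn.
move: (cut_arg _ x) (trunc1 k _) (trunc2 k _) (trunc k _) (Lop _ _ log_norm _ _) (Lop _ _ phi _ _)
  (c x xi) (Gam _ (grad log_norm x) (grad phi x)) (Gam _ (grad log_norm x) (grad log_norm x))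
  (Gam _ (grad phi x) (grad phi x)) (Gam _ y (grad log_norm x)) (Gam _ y (grad phi x)) (Gam _ y y).
move=> w t1 t2 T Ll L cx glp gll gpp gyl gyp gyy G1 G2 G3 p0 y0 l0 lC LC HJx wb tb t2b Tb.
have h0 : 0 <= 2^-1 * gpp by lra.
have gylb : `|gyl| <= 2^-1 * (gyy + gll) by rewrite ler_norml; lra.
have glpb : - glp * w *+ 2 <= gll + w ^+ 2 * (2 * (2^-1 * gpp)).
  have -> : gll + w ^+ 2 * (2 * (2^-1 * gpp)) = gll + - w * (- w * gpp) by field.
  by have -> : - glp * w *+ 2 = 2 * (- w * glp) by ring.
have Lrc : L + 2^-1 * gpp <= rho - cx by lra.
have := test_fun_estimate gyp wb tb q0 q1 kq t2b Tb C0' h0 LC l0 lC gylb glpb y0 Lrc.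
by congr (_ <= _); ring.
Qed.
End TestFunction.

(** * Integration against a probability measure *)

Section ProbabilityIntegral.
Context {d : measure_display} {T : measurableType d} {R : realType}.
Variable mu : probability T R.
Implicit Types (f h r W : T -> R).

Lemma integral_cst_probability (M : R) : (\int[mu]_x (M%:E) = M%:E)%E.
Proof. have m1 : (mu : {measure set T -> \bar R}) setT = 1%E by exact: probability_setT.
by have := @integral_cst _ _ _ mu setT measurableT M%:E; rewrite m1 mule1. Qed.

Lemma integrable_cst_probability (M : R) : mu.-integrable setT (fun=> M%:E).
Proof.
apply/integrableP; split; first exact: measurable_cst.
by rewrite integral_cst_probability ltry.
Qed.

Lemma integral_funepos_le f (M : R) : measurable_fun setT f -> (forall x, f x <= M) ->
  (\int[mu]_x ((fun x => (f x)%:E)^\+ x) <= `|M|%:E)%E.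
Proof.
move=> mf fM; rewrite -(integral_cst_probability `|M|); apply: ge0_le_integral => //.
- by apply: measurable_funepos; exact/measurable_EFinP.
- move=> x _; rewrite funeposE -EFin_max lee_fin ge_max normr_ge0 andbT.
  exact: le_trans (ler_norm M).
Qed.

(** The positive part has a finite integral, so a value above -oo forces the negative part to have
    one too. *)
Lemma integrable_bounded_above f (M : R) : measurable_fun setT f -> (forall x, f x <= M) ->
  (-oo < \int[mu]_x (f x)%:E)%E -> mu.-integrable setT (fun x => (f x)%:E).
Proof.
move=> mf fM; have mfE : measurable_fun setT (fun x => (f x)%:E) by exact/measurable_EFinP.
have H := integral_funepos_le mf fM.
rewrite integralE => fi; apply/integrableP; split => //.
under eq_integral do rewrite -/((abse \o (fun x => (f x)%:E)) _) fune_abse.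
rewrite ge0_integralD//; [|exact: measurable_funepos|exact: measurable_funeneg].
apply: lte_add_pinfty; first exact: le_lt_trans H (ltry _).
move: fi; case: (\int[mu]_x _^\- x)%E => [s| |] //.
  by rewrite ltry.
by rewrite addeC/=.
Qed.

(* A non-integrable function bounded above has integral -oo, so the bound holds for it too. *)
Lemma integral_le_bound f (M : R) : measurable_fun setT f -> (forall x, f x <= M) ->
  (\int[mu]_x (f x)%:E <= M%:E)%E.
Proof.
move=> mf fM; have [->|] := eqVneq (\int[mu]_x (f x)%:E)%E -oo%E; first by rewrite leNye.
rewrite -ltNye => /(integrable_bounded_above mf fM) fi.
rewrite -(integral_cst_probability M); apply: le_integral => //; first exact: integrable_cst_probability.
by move=> x _; rewrite lee_fin.
Qed.

(** The zero-mean functions [F n] drop out, so the weighted integrals of [h] are all at most the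
    integral of [W]; Fatou's lemma then removes the weights. *)
Lemma fatou_bound (h W : T -> R) (chi F : nat -> T -> R) :
  measurable_fun setT h -> (forall x, 0 <= h x) ->
  (forall n, measurable_fun setT (chi n)) -> (forall n x, 0 <= chi n x) ->
  (forall x, chi n x @[n --> \oo] --> (1 : R)) ->
  (forall n, mu.-integrable setT (fun x => (F n x)%:E)) -> (forall n, \int[mu]_x (F n x)%:E = 0)%E ->
  mu.-integrable setT (fun x => (W x)%:E) ->
  (forall n x, chi n x * h x <= W x - F n x) -> (\int[mu]_x (h x)%:E < +oo)%E.
Proof.
move=> mh h0 mchi chi0 chi1 iF F0 iW le.
have mf n : measurable_fun setT (fun x => (chi n x * h x)%:E).
  by apply/measurable_EFinP; exact: measurable_funM.
have f0 n x : setT x -> (0 <= (chi n x * h x)%:E)%E by move=> _; rewrite lee_fin mulr_ge0.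
have Wfin : (\int[mu]_x (W x)%:E \is a fin_num)%E by exact: integrable_fin_num.
have iWF n : mu.-integrable setT (fun x => (W x - F n x)%:E).
  by under eq_fun do rewrite EFinB; exact: integrableB.
have le2 n : (\int[mu]_x (chi n x * h x)%:E <= \int[mu]_x (W x)%:E)%E.
  have -> : (\int[mu]_x (W x)%:E = \int[mu]_x (W x - F n x)%:E)%E.
    rewrite -[LHS]sube0 -(F0 n) -integralB//.

  apply: ge0_le_integral => //.
  - by move=> x _; exact: f0.
  - by case/integrableP: (iWF n).
  - by move=> x _; rewrite lee_fin.
have := fatou mu measurableT mf f0.
have -> : (\int[mu]_x limn_einf (fun n => (chi n x * h x)%:E) = \int[mu]_x (h x)%:E)%E.
  apply: eq_integral => x _; apply: (cvg_limn_einf_sup _).1.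
  apply: cvg_EFin; first by apply: nearW.
  rewrite -[X in _ --> X]mul1r; apply: cvgM; [exact: chi1|exact: cvg_cst].
move=> H; apply: (le_lt_trans H).
apply: (@le_lt_trans _ _ (\int[mu]_x (W x)%:E)%E); last by rewrite ltey_eq Wfin.
apply: le_trans (limn_einf_sup _) _.
have -> : (\int[mu]_x (W x)%:E)%E = limn_esup (fun=> \int[mu]_x (W x)%:E)%E.
  by rewrite (cvg_limn_einf_sup (cvg_cst _)).2.
rewrite !limn_esup_lim; apply: lee_lim; [exact: is_cvg_esups|exact: is_cvg_esups|].
apply: nearW => n; apply: ge_ereal_sup => _ [k /= nk <-]; apply: (le_trans (le2 k)).
by apply: ereal_sup_ubound; exists k.
Qed.

(** The error is a vanishing multiple of one integrable function [W], and [|rho - r|] dominates the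
    weighted terms. *)
Lemma dct_bound (r W : T -> R) (rho : R) (chi F : nat -> T -> R) :
  mu.-integrable setT (fun x => (r x)%:E) ->
  (forall n, measurable_fun setT (chi n)) -> (forall n x, 0 <= chi n x <= 1) ->
  (forall x, chi n x @[n --> \oo] --> (1 : R)) ->
  (forall n, mu.-integrable setT (fun x => (F n x)%:E)) -> (forall n, \int[mu]_x (F n x)%:E = 0)%E ->
  mu.-integrable setT (fun x => (W x)%:E) ->
  (forall n x, F n x <= chi n x * (rho - r x) + n.+1%:R^-1 * W x) ->
  (\int[mu]_x (r x)%:E <= rho%:E)%E.
Proof.
move=> ir mchi chi01 chi1 iF F0 iW le.
pose g x := rho - r x.
have ig : mu.-integrable setT (fun x => (g x)%:E).
  by under eq_fun do rewrite EFinB; apply: integrableB => //; exact: integrable_cst_probability.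
have mg : measurable_fun setT g by case/integrableP: ig => /measurable_EFinP.
have mchig n : measurable_fun setT (fun x => (chi n x * g x)%:E).
  by apply/measurable_EFinP; exact: measurable_funM.
have bnd n x : setT x -> (`|(chi n x * g x)%:E| <= `|(g x)%:E|)%E.
  move=> _; rewrite lee_fin normrM; have /andP[c0 c1] := chi01 n x.
  by rewrite (ger0_norm c0) ler_piMl.
have cv : (\int[mu]_x (chi n x * g x)%:E @[n --> \oo] --> \int[mu]_x (g x)%:E)%E.
  apply: (@dominated_cvg _ _ _ mu setT measurableT _ _ (fun x => `|(g x)%:E|)%E) => //.
  - move=> x _; apply: cvg_EFin; first exact: nearW.
    rewrite -[X in _ --> X]mul1r; apply: cvgM; [exact: chi1|exact: cvg_cst].
  - exact: integrable_abse.
have ichi n : mu.-integrable setT (fun x => (chi n x * g x)%:E).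
  by apply: le_integrable ig => // x _; exact: bnd.
have iWn n : mu.-integrable setT (fun x => (n.+1%:R^-1 * W x)%:E).
  by under eq_fun do rewrite EFinM; exact: integrableZl.
have key n : (0 <= \int[mu]_x (chi n x * g x)%:E + (n.+1%:R^-1)%:E * \int[mu]_x (W x)%:E)%E.
  rewrite -(F0 n) -integralZl// -integralD//.
    apply: le_integral => //.
      by apply: integrableD => //; exact: iWn.
    by move=> x _; rewrite -EFinM -EFinD lee_fin.
  exact: iWn.
have Wfin : (\int[mu]_x (W x)%:E \is a fin_num)%E by exact: integrable_fin_num.
have H : (0 <= \int[mu]_x (g x)%:E)%E.
  have : ((fun n => \int[mu]_x (chi n x * g x)%:E + (n.+1%:R^-1)%:E * \int[mu]_x (W x)%:E) @ \oo -->
      \int[mu]_x (g x)%:E + 0)%E.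
    apply: cvgeD => //; first by rewrite fin_num_adde_defl.
    rewrite -(fineK Wfin); under eq_fun do rewrite -EFinM.
    apply: cvg_EFin; first exact: nearW.
    rewrite -[X in _ --> X](mul0r (fine (\int[mu]_x (W x)%:E))); apply: cvgM; last exact: cvg_cst.
    exact: cvg_harmonic.
  rewrite adde0 => cvS; rewrite -(cvg_lim _ cvS)//; apply: lime_ge; last exact: nearW.
  by apply/cvg_ex; exists (\int[mu]_x (g x)%:E)%E.
have rfin : (\int[mu]_x (r x)%:E \is a fin_num)%E by exact: integrable_fin_num.
move: H; under eq_integral do rewrite EFinB.
rewrite integralB//; last exact: integrable_cst_probability.
by rewrite integral_cst_probability sube_ge0// rfin.
Qed.

End ProbabilityIntegral.

Section Measurability.
Context {R : realType} {d : nat} {K : pseudoPMetricType R}.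
Local Notation Z := ('rV[R]_d * K * 'rV[R]_d)%type.

Let P : ptopologicalType :=
  HB.pack Z (Pointed.class (Z : pointedType)) (Topological.class (Z : topologicalType)).

Lemma continuous_measurable_ZB (f : Z -> R) : continuous f ->
  measurable_fun setT (f : ZB R d K -> R).
Proof. exact: (@continuous_measurable_fun_open R P f). Qed.
End Measurability.

Section TestWeightLimit.
Context {R : realType} {d : nat}.

(** The shift keeps k at least 16, so the error factor 4 / k is at most 1/4 in the energy bound. The
    limit is continuity in q = 1/k at q = 0. *)
Lemma cvg_test_weight (phi : 'rV[R]_d -> R) x :
  test_weight phi (n + 15).+1%:R x @[n --> \oo] --> (1 : R).
Proof.
pose G (q : R) := Num.max 0 (1 + - q ^+ 2 * log_norm x) ^+ 3 * (1 + (phi x * q) ^+ 2)^-1.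
have cid : continuous (fun q : R => q) by move=> q; exact: cvg_id.
have ccst (a : R) : continuous (fun _ : R => a) by exact: cst_continuous.
have cG1 : continuous (fun q : R => Num.max 0 (1 + - q ^+ 2 * log_norm x) ^+ 3).
  apply: (@continuous_compf _ R (fun q : R => 1 + - q ^+ 2 * log_norm x) (fun t : R => Num.max 0 t ^+ 3)).
    apply: continuous_addf => //; apply: continuous_mulf => //.
    by move=> q; apply: cvgN; exact: exprn_continuous.
  by move=> t; apply: (@continuous_pospart _ (fun t : R => t ^+ 3)); exact: exprn_continuous.
have cG2 : continuous (fun q : R => 1 + (phi x * q) ^+ 2).
  apply: continuous_addf => //; apply: (@continuous_compf _ R (fun q : R => phi x * q) (fun t : R => t ^+ 2)).
    exact: continuous_mulf.
  by move=> t; exact: exprn_continuous.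
have c0 : {for (0 : R), continuous G}.
  apply: cvgM; first exact: cG1.
  by apply: cvgV; [rewrite mulr0 expr0n addr0 oner_eq0|exact: cG2].
have G0 : G 0 = 1.
  by rewrite /G mulr0 !expr0n oppr0 mul0r !addr0 invr1 mulr1 max_r// expr1n.
have cq : (n + 15).+1%:R^-1 @[n --> \oo] --> (0 : R).
  by rewrite (cvg_shiftn 15 (fun n => n.+1%:R^-1 : R)); exact: cvg_harmonic.
have := cvg_comp _ _ cq c0; rewrite G0; apply: cvg_trans.
apply: near_eq_cvg; apply: nearW => n /=.
rewrite /G /test_weight /cut /cut_arg /trunc1; congr (Num.max 0 (1 + - _ * _) ^+ 3 * _).
by rewrite -exprVn.
Qed.
End TestWeightLimit.

Section MAMeasures.
Context {R : realType} {d m : nat} {K : pseudoPMetricType R}.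
Variables (b : 'rV[R]_d -> K -> 'rV[R]_d) (S : 'rV[R]_d -> 'M[R]_(d, m)) (c : 'rV[R]_d -> K -> R).
Hypotheses (A1 : assumption_A1 b S) (A2 : assumption_A2 c).
Local Notation Z := ('rV[R]_d * K * 'rV[R]_d)%type.

Lemma measurable_Rfun : measurable_fun setT (Rfun S c : ZB R d K -> R).
Proof. by apply: continuous_measurable_ZB; exact: (Rfun_continuous A1 A2). Qed.

Lemma Rfun_bounded_above : exists M, forall z : Z, Rfun S c z <= M /\ c (zx z) (zxi z) <= M.
Proof.
have [_ _ [M cM] _] := A2; exists M => z; split => //; rewrite /Rfun.
by have := cM (zx z) (zxi z); have := sqr_ge0 (enorm (zy z *m S (zx z))); lra.
Qed.

Variable mu : probability (ZB R d K) R.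
Hypothesis iR : mu.-integrable setT (fun z : ZB R d K => (Rfun S c z)%:E).

Let le_M_R (f : Z -> R) (a e : R) : continuous f ->
  (forall z, `|f z| <= a - e * Rfun S c z) -> mu.-integrable setT (fun z : ZB R d K => (f z)%:E).
Proof.
move=> cf fb.
have i2 : mu.-integrable setT (fun z : ZB R d K => (a - e * Rfun S c z)%:E).
  under eq_fun do rewrite EFinB EFinM.
  by apply: integrableB => //; [exact: integrable_cst_probability|exact: integrableZl].
apply: le_integrable i2 => //; first by apply/measurable_EFinP; exact: continuous_measurable_ZB.
by move=> z _; rewrite lee_fin; apply: (le_trans (fb z)); exact: ler_norm.
Qed.

Lemma integrable_Gam_zy :
  mu.-integrable setT (fun z : ZB R d K => (2^-1 * Gam (S (zx z)) (zy z) (zy z))%:E).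
Proof.
have [M HM] := Rfun_bounded_above.
apply: (@le_M_R _ M 1).
  by apply: continuous_mulf; [exact: cst_continuous|exact: (Gam_zy_continuous A1)].
move=> z; rewrite ger0_norm; last by rewrite mulr_ge0// ?invr_ge0// Gam_ge0.
have [_] := HM z; rewrite /Rfun enorm_mulmx_sqr; move: (Gam _ _ _) => g; lra.
Qed.

Lemma integrable_abs_cost :
  mu.-integrable setT (fun z : ZB R d K => (`|c (zx z) (zxi z)|)%:E).
Proof.
have [M HM] := Rfun_bounded_above; have [cc _ _ _] := A2.
apply: (@le_M_R _ (2 * `|M|) 1).
  apply: (@continuous_compf _ _ (fun z : Z => c (zx z) (zxi z)) (fun t => `|t|)).
    exact: (continuous_zxxi_comp cc).
  by move=> t; exact: norm_continuous.
move=> z; have [_] := HM z; rewrite /Rfun enorm_mulmx_sqr; have := Gam_ge0 (S (zx z)) (zy z).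
move: (Gam _ _ _) (c _ _) => g t g0 tM; have Ma := ler_norm M; have M0 := normr_ge0 M.
by rewrite ger0_norm// ler_norml; lra.
Qed.

Variables (phi : 'rV[R]_d -> R) (rho : R).
Hypothesis Cphi : C2on setT phi.
Hypothesis HJ : forall x xi,
  Lop b S phi x xi + 2^-1 * Gam (S x) (grad phi x) (grad phi x) + c x xi <= rho.
Hypothesis muMA : MA b S mu.
Let h (z : Z) := 2^-1 * Gam (S (zx z)) (grad phi (zx z)) (grad phi (zx z)).
Let yy (z : Z) := 2^-1 * Gam (S (zx z)) (zy z) (zy z).

Let mh : measurable_fun setT (h : ZB R d K -> R).
Proof.
apply: continuous_measurable_ZB; apply: continuous_mulf; first exact: cst_continuous.
exact: (continuous_zx_comp (Gam_grad_continuous A1 Cphi Cphi)).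
Qed.
Let h0 z : 0 <= h z. Proof. by rewrite mulr_ge0// ?invr_ge0// Gam_ge0. Qed.
Let yy0 z : 0 <= yy z. Proof. by rewrite mulr_ge0// ?invr_ge0// Gam_ge0. Qed.
Let k (n : nat) : R := (n + 15).+1%:R.
Let k1 n : 1 <= k n. Proof. by rewrite ler1n. Qed.
Let chi n (z : Z) := test_weight phi (k n) (zx z).
Let mchi n : measurable_fun setT (chi n : ZB R d K -> R).
Proof.
apply: continuous_measurable_ZB; apply: (continuous_zx_comp (h := test_weight phi (k n))).
apply: continuous_mulf; first exact: C2_continuous (C2_cut _).
apply: (@continuous_compf _ _ phi (trunc1 (k n))); first exact: C2_continuous Cphi.
move=> x; have [H _] := is_derive_trunc1 (k1 n) (phi x).
by apply: differentiable_continuous; exact/derivable1_diffP.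
Qed.
Let iyy : mu.-integrable setT (fun z : ZB R d K => (yy z)%:E).
Proof. exact: integrable_Gam_zy. Qed.
Let i1yy : mu.-integrable setT (fun z : ZB R d K => (1 + yy z)%:E).
Proof.
under eq_fun do rewrite EFinD.
by apply: integrableD => //; exact: integrable_cst_probability.
Qed.

(** The energy of φ enters the test-function estimate with a negative sign; since A of the test
    function has mean zero, the remaining terms, controlled by R, bound it. *)
Lemma MA_integrable_energy : mu.-integrable setT (fun z : ZB R d K => (h z)%:E).
Proof.
have [_ _ [C0 growth]] := A1.
have [C C0' HC] := Aop_test_fun_le growth Cphi HJ.
pose F n (z : Z) := Aop b S (test_fun phi (k n)) z.
pose W (z : Z) := (`|rho| + `|c (zx z) (zxi z)|) + (2 * yy z + C * (1 + yy z)).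
have iW : mu.-integrable setT (fun z : ZB R d K => (W z)%:E).
  rewrite /W; under eq_fun do rewrite !EFinD EFinM (EFinM C).
  apply: integrableD => //; apply: integrableD => //.
  - exact: integrable_cst_probability.
  - exact: integrable_abs_cost.
  - exact: integrableZl.
  - exact: integrableZl.
have H := fatou_bound (h := fun z : ZB R d K => 4^-1 * h z) (chi := chi) (F := F) (W := W) (mu := mu).
have fin : (\int[mu]_z (4^-1 * h z)%:E < +oo)%E.
  apply: H => //.
  - by apply: measurable_funM.
  - by move=> z; rewrite mulr_ge0// invr_ge0.
  - by move=> n z; case/andP: (test_weight_bounds phi (zx z) (k1 n)).
  - by move=> z; exact: cvg_test_weight.
  - by move=> n; case: (muMA (test_fun_C2c Cphi (k1 n))).
  - by move=> n; case: (muMA (test_fun_C2c Cphi (k1 n))).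
  move=> n z; have := HC (k n) z (k1 n); cbv zeta.
  have /andP[] := test_weight_bounds phi (zx z) (k1 n).
  (* The factor 2 gives <σᵀy, σᵀ∇φ> <= |σᵀy|² + ½ h, so half of the energy [h] survives. The error 4
     / k takes at most a quarter, which explains the factor [4^-1] in front of [h]. *)
  have := Gam_le_sqr (S (zx z)) (2 *: zy z) (grad phi (zx z)); rewrite !(GamZl, GamZr).
  have := h0 z; have := yy0 z; rewrite /W /F /h /yy /chi.
  have k16 : (k n)^-1 <= 16^-1.
    by rewrite lef_pV2 ?posrE /k ?ltr0n// ler_nat -addnS leq_addl.
  have kp : 0 <= (k n)^-1 by rewrite invr_ge0.
  move: k16 kp; move: (k n)^-1 (test_weight _ _ _) (Aop _ _ _ _) (c _ _).
  move: (Gam _ (zy z) (zy z)) (Gam _ (zy z) (grad _ _)) (Gam _ (grad _ _) _).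
  move=> gyy g gpp q x A ct k16 kp gyy0 gpp0 H1 x0 x1 H2.
  have B0 : 0 <= `|rho| + `|ct| + gyy by rewrite !addr_ge0//; lra.
  have B1 : x * (rho - ct - 2^-1 * gpp + g) <= x * (`|rho| + `|ct| + gyy - 4^-1 * gpp).
    apply: ler_wpM2l => //; have := ler_norm rho; have := ler_norm (- ct); rewrite normrN; lra.
  have B2 : x * (`|rho| + `|ct| + gyy) <= `|rho| + `|ct| + gyy by apply: ler_piMl.
  have xg0 : 0 <= x * (2^-1 * gpp) by apply: mulr_ge0.
  have B3 : q * (4 * (x * (2^-1 * gpp))) <= 16^-1 * (4 * (x * (2^-1 * gpp))).
    by apply: ler_wpM2r => //; lra.
  have B4 : q * (C * (1 + 2^-1 * gyy)) <= C * (1 + 2^-1 * gyy).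
    by apply: ler_piMl; [apply: mulr_ge0 => //|]; lra.
  have E1 : x * (`|rho| + `|ct| + gyy - 4^-1 * gpp) = x * (`|rho| + `|ct| + gyy) - 2^-1 * (x * (2^-1 * gpp)) by field.
  have E2 : 4 * q * (x * (2^-1 * gpp)) = q * (4 * (x * (2^-1 * gpp))) by ring.
  have E3 : C * q * (1 + 2^-1 * gyy) = q * (C * (1 + 2^-1 * gyy)) by ring.
  have E4 : x * (4^-1 * (2^-1 * gpp)) = 4^-1 * (x * (2^-1 * gpp)) by ring.
  rewrite E4; rewrite E2 E3 in H2; rewrite E1 in B1; lra.
have i4 : mu.-integrable setT (fun z : ZB R d K => (4^-1 * h z)%:E).
  apply/integrableP; split; first by apply/measurable_EFinP; exact: measurable_funM.
  apply: le_lt_trans fin; rewrite le_eqVlt; apply/orP; left; apply/eqP.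
  by apply: eq_integral => z _; rewrite gee0_abs// lee_fin mulr_ge0// invr_ge0.
rewrite (_ : (fun z : ZB R d K => (h z)%:E) = (fun z => 4%:E * (4^-1 * h z)%:E)%E).
  exact: integrableZl.
by apply/funext => z; rewrite -EFinM mulrA mulfV ?mul1r.
Qed.

(** Now [h] is integrable and its error term tends to 0. The symmetric form of AM-GM, which uses up
    all of [h], leaves exactly ρ - R in the bracket. *)
Lemma MA_Rfun_le : (\int[mu]_z (Rfun S c z)%:E <= rho%:E)%E.
Proof.
have [_ _ [C0 growth]] := A1.
have [C C0' HC] := Aop_test_fun_le growth Cphi HJ.
have ih := MA_integrable_energy.
pose F n (z : Z) := Aop b S (test_fun phi (k n)) z.
pose W (z : Z) := 4 * h z + C * (1 + yy z).
have iW : mu.-integrable setT (fun z : ZB R d K => (W z)%:E).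
  rewrite /W; under eq_fun do rewrite EFinD EFinM (EFinM C).
  by apply: integrableD => //; exact: integrableZl.
apply: (dct_bound (r := Rfun S c : ZB R d K -> R) (chi := chi) (F := F) (W := W)) => //.
- by move=> n z; exact: test_weight_bounds.
- by move=> z; exact: cvg_test_weight.
- by move=> n; case: (muMA (test_fun_C2c Cphi (k1 n))).
- by move=> n; case: (muMA (test_fun_C2c Cphi (k1 n))).
move=> n z; apply: (le_trans (HC (k n) z (k1 n))); cbv zeta.
have /andP[] := test_weight_bounds phi (zx z) (k1 n).
have := Gam_le_sqr (S (zx z)) (zy z) (grad phi (zx z)).
have := h0 z; have := yy0 z; rewrite /W /Rfun enorm_mulmx_sqr /h /yy /chi.
have kn : (k n)^-1 <= n.+1%:R^-1.
  by rewrite lef_pV2 ?posrE /k ?ltr0n// ler_nat ltnS leq_addr.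
have kp : 0 <= (k n)^-1 by rewrite invr_ge0.
move: kn kp; move: (k n)^-1 (test_weight _ _ _) (c _ _) n.+1%:R^-1.
move: (Gam _ (zy z) (zy z)) (Gam _ (zy z) (grad _ _)) (Gam _ (grad _ _) _).
move=> gyy g gpp q x ct q' kn kp gyy0 gpp0 H1 x0 x1.
have B1 : x * (rho - ct - 2^-1 * gpp + g) <= x * (rho - (ct - 2^-1 * gyy)).
  by apply: ler_wpM2l => //; lra.
have B2 : x * (2^-1 * gpp) <= 2^-1 * gpp by apply: ler_piMl.
have B3 : q * (4 * (x * (2^-1 * gpp))) <= q * (4 * (2^-1 * gpp)) by apply: ler_wpM2l => //; lra.
have B4 : q * (4 * (2^-1 * gpp) + C * (1 + 2^-1 * gyy)) <= q' * (4 * (2^-1 * gpp) + C * (1 + 2^-1 * gyy)).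
  apply: ler_wpM2r => //; apply: addr_ge0; first by lra.
  by apply: mulr_ge0 => //; lra.
have E2 : 4 * q * (x * (2^-1 * gpp)) = q * (4 * (x * (2^-1 * gpp))) by ring.
have E3 : C * q * (1 + 2^-1 * gyy) = q * (C * (1 + 2^-1 * gyy)) by ring.
by rewrite E2 E3; rewrite (mulrDr q) in B4; lra.
Qed.
End MAMeasures.

Section StationaryMeasures.
Context {R : realType} {d m : nat} {K : pseudoPMetricType R}.
Variables (b : 'rV[R]_d -> K -> 'rV[R]_d) (S : 'rV[R]_d -> 'M[R]_(d, m)) (c : 'rV[R]_d -> K -> R).
Hypotheses (A1 : assumption_A1 b S) (A2 : assumption_A2 c) (cK : compact [set: K]).
Implicit Type mu : probability (ZB R d K) R.

Lemma Pcirc_integrable mu : Pcirc S c mu -> mu.-integrable setT (fun z : ZB R d K => (Rfun S c z)%:E).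
Proof.
have [M HM] := Rfun_bounded_above S A2.
apply: (integrable_bounded_above (M := M) (measurable_Rfun A1 A2)) => z.
by case: (HM z).
Qed.

Lemma C2c_integrable mu f : mu.-integrable setT (fun z : ZB R d K => (Rfun S c z)%:E) -> C2c f ->
  mu.-integrable setT (fun z : ZB R d K => (Aop b S f z)%:E).
Proof.
move=> iR Cf; have iy := integrable_Gam_zy A1 A2 iR.
have [C HC] := C2c_Aop_small A1 cK Cf ltr01.
have i1 : mu.-integrable setT (fun z : ZB R d K => (C + 2^-1 * Gam (S (zx z)) (zy z) (zy z))%:E).
  under eq_fun do rewrite EFinD.
  by apply: integrableD => //; exact: integrable_cst_probability.
apply: le_integrable i1 => //.
  apply/measurable_EFinP; apply: continuous_measurable_ZB; apply: (Aop_continuous A1); by case: Cf.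
move=> z _; rewrite lee_fin; apply: le_trans (ler_norm _); have := HC z.
by rewrite mul1r.
Qed.

Variables (phi : 'rV[R]_d -> R) (rho : R).
Hypothesis Cphi : C2on setT phi.
Hypothesis HJ : forall x xi,
  Lop b S phi x xi + 2^-1 * Gam (S x) (grad phi x) (grad phi x) + c x xi <= rho.

Lemma MA_integral_Rfun_le mu : MA b S mu -> (\int[mu]_z (Rfun S c z)%:E <= rho%:E)%E.
Proof.
move=> muMA; have [->|] := eqVneq (\int[mu]_z (Rfun S c z)%:E)%E -oo%E; first by rewrite leNye.
rewrite -ltNye => /Pcirc_integrable iR.
exact: (MA_Rfun_le A1 A2 iR Cphi HJ muMA).
Qed.

Lemma Ffun_cst0 mu : Ffun b S c (fun=> 0) mu = (\int[mu]_z (Rfun S c z)%:E)%E.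
Proof. by apply: eq_integral => z _; rewrite Aop_cst0 add0r. Qed.

(* If mu is not in M_A, some f has nonzero mean a := \int A f, and F(t f, mu) = t a + \int R
   takes every real value. *)
Lemma ereal_inf_Ffun_le mu : (ereal_inf [set Ffun b S c g mu | g in C2c] <= rho%:E)%E.
Proof.
have inf0 : (ereal_inf [set Ffun b S c g mu | g in C2c] <= \int[mu]_z (Rfun S c z)%:E)%E.
  apply: ereal_inf_lbound; exists (fun=> 0); first exact: C2c_cst0.
  exact: Ffun_cst0.
have [|] := eqVneq (\int[mu]_z (Rfun S c z)%:E)%E -oo%E.
  by move=> E; apply: (le_trans inf0); rewrite E leNye.
rewrite -ltNye => /Pcirc_integrable iR.
have [muMA|] := pselect (MA b S mu); first exact: le_trans inf0 (MA_integral_Rfun_le muMA).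
move=> /existsNP[f /not_implyP[Cf nf]].
have iA := C2c_integrable iR Cf.
have a0 : (\int[mu]_z (Aop b S f z)%:E != 0)%E by apply/eqP => E; apply: nf.
have afin : (\int[mu]_z (Aop b S f z)%:E \is a fin_num)%E by exact: integrable_fin_num.
have rfin : (\int[mu]_z (Rfun S c z)%:E \is a fin_num)%E by exact: integrable_fin_num.
move: a0 afin rfin.
case aE : (\int[mu]_z (Aop b S f z)%:E)%E => [a| |] //; rewrite eqe => a0 _.
case rE : (\int[mu]_z (Rfun S c z)%:E)%E => [r| |] // _.
pose t := (rho - r) / a.
apply: ereal_inf_lbound; exists (fun x => t * f x + 0).
  have C20 : C2c (fun _ : 'rV[R]_d => 0 : R) by exact: C2c_cst0.
  exact: (C2c_lin t Cf C20).
have Cf2 : C2on setT f by case: Cf.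
have C0 : C2on setT (fun _ : 'rV[R]_d => 0 : R) by case: (@C2_cst R d 0).
rewrite /Ffun; under eq_integral do rewrite (Aop_lin b S t _ Cf2 C0) Aop_cst0 addr0 EFinD EFinM.
rewrite integralD//; last exact: integrableZl.
by rewrite integralZl// aE rE -EFinM -EFinD /t mulfVK// subrK.
Qed.

End StationaryMeasures.

(** * Compactly supported supersolutions *)

Section LogTruncation.
Context {R : realType}.
Variable e : R.
Hypothesis e0 : 0 < e.
Let en0 : e != 0. Proof. by rewrite gt_eqF. Qed.

(* [log_trunc] has derivative [- w ^+ 2] with [w] the positive part of [1 - e ln r];
   [log_trunc_prim] is the corresponding primitive, written in the variable [w]. *)
Definition log_trunc_prim (w : R) : R := expR (e^-1 + - e^-1 * w) * (w ^+ 2 + 2 * e * w + 2 * e ^+ 2).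
Definition log_trunc_arg (r : R) : R := Num.max 0 (1 + - e * ln r).
Definition log_trunc (r : R) : R := log_trunc_prim 0 - log_trunc_prim (log_trunc_arg r).
Definition log_trunc1 (r : R) : R := - log_trunc_arg r ^+ 2.
Definition log_trunc2 (r : R) : R := 2 * e * log_trunc_arg r / r.

Let dprim (w : R) : is_derive w (1 : R) log_trunc_prim (- (expR (e^-1 + - e^-1 * w) * w ^+ 2 / e)).
Proof.
have H1 : is_derive w (1 : R) (fun t : R => e^-1 + - e^-1 * t) (- e^-1) by exact: is_derive1_affine.
have H2 := is_derive_compR H1 (is_derive_expR (e^-1 + - e^-1 * w)).
have H3 : is_derive w (1 : R) (fun t : R => t ^+ 2 + 2 * e * t + 2 * e ^+ 2) (2 * w + 2 * e).
  have H4 := is_deriveD (is_deriveX 2 (is_derive_id w (1 : R)))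
    (is_deriveD (is_deriveZ (2 * e) (is_derive_id w (1 : R))) (is_derive_cst (2 * e ^+ 2) w (1 : R))).
  have E : (2 * w ^+ 1) *: (1 : R) + ((2 * e) *: (1 : R) + 0) = 2 * w + 2 * e.
    by rewrite /GRing.scale/= expr1 !mulr1 addr0.
  apply: (near_eq_is_derive _ (is_derive_eq H4 E)).
  by near=> t; rewrite !fctE addrA.
apply: (is_derive_eq (is_deriveM H2 H3)).
rewrite /GRing.scale/=; move: (expR _) => E; field; exact: en0.
Unshelve. all: by end_near. Qed.

Let darg (r : R) : 0 < r -> is_derive r (1 : R) (fun t : R => 1 + - e * ln t) (- e / r).
Proof.
move=> r0; have H := is_derive_compR (is_derive1_ln r0) (is_derive1_affine 1 (- e) (ln r)).
by apply: (is_derive_eq H).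
Qed.

Lemma is_derive_log_trunc (r : R) : 0 < r -> is_derive r (1 : R) log_trunc (log_trunc1 r).
Proof.
move=> r0.
have d0 : - (expR (e^-1 + - e^-1 * 0) * 0 ^+ 2 / e) = 0 by rewrite expr0n mulr0 mul0r oppr0.
have H1 := is_derive_compR (darg r0) (is_derive1_pospart dprim d0 (1 + - e * ln r)).
have H2 := is_deriveB (is_derive_cst (log_trunc_prim 0) r (1 : R)) H1.
apply: (is_derive_eq H2); rewrite sub0r /log_trunc1; congr (- _).
rewrite -/(log_trunc_arg r) /log_trunc_arg.
have [w0|w0] := leP 0 (1 + - e * ln r); last by rewrite expr0n mulr0 mul0r oppr0 mul0r.
have -> : e^-1 + - e^-1 * (1 + - e * ln r) = ln r by field.
by rewrite lnK ?posrE//; field; rewrite en0 gt_eqF.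
Qed.

Lemma is_derive_log_trunc1 (r : R) : 0 < r -> is_derive r (1 : R) log_trunc1 (log_trunc2 r).
Proof.
move=> r0.
have dQ (t : R) : is_derive t (1 : R) (fun u : R => - u ^+ 2) (- (2 * t)).
  have H3 := is_deriveN (is_deriveX 2 (is_derive_id t (1 : R))).
  by apply: (is_derive_eq H3); rewrite /GRing.scale/= mulr1 expr1.
have dQ0 : - ((2 : R) * 0) = 0 by rewrite mulr0 oppr0.
have H1 := is_derive_compR (darg r0) (is_derive1_pospart dQ dQ0 (1 + - e * ln r)).
apply: (is_derive_eq H1); rewrite -/(log_trunc_arg r) /log_trunc2; field.
by rewrite gt_eqF.
Qed.

Lemma continuous_log_trunc2 (r : R) : 0 < r -> {for r, continuous log_trunc2}.
Proof.
move=> r0; apply: cvgM; last by apply: cvgV; [rewrite gt_eqF|exact: cvg_id].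
apply: cvgM; first exact: cvg_cst.
apply: (@continuous_comp _ _ _ (fun t : R => 1 + - e * ln t) (fun t : R => Num.max 0 t)).
  have [H _] := darg r0; apply: differentiable_continuous; exact/derivable1_diffP.
have cid : continuous (fun q : R => q) by move=> q; exact: cvg_id.
exact: (continuous_pospart cid).
Qed.

Lemma log_trunc_arg_bounds (r : R) : 1 <= r -> 0 <= log_trunc_arg r <= 1.
Proof.
move=> r1; rewrite /log_trunc_arg le_max lexx/= ge_max ler01/= mulNr gerDl oppr_le0.
by rewrite mulr_ge0 ?ln_ge0// ltW.
Qed.

(** Measures how far the slope of the truncation is from - 1: on a bounded range of [r] the defect
    is O(e). *)
Lemma log_trunc_arg_sqr_ge (r : R) : 1 - log_trunc_arg r ^+ 2 <= 2 * e * ln r.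
Proof.
rewrite /log_trunc_arg; have [w0|w0] := leP 0 (1 + - e * ln r).
  have -> : 1 - (1 + - e * ln r) ^+ 2 = 2 * e * ln r - (e * ln r) ^+ 2 by ring.
  by rewrite gerBl sqr_ge0.
by rewrite expr0n subr0; lra.
Qed.

Lemma log_trunc_eq0 (r : R) : expR e^-1 <= r -> log_trunc r = 0.
Proof.
move=> er; rewrite /log_trunc /log_trunc_arg max_l ?subrr//.
have : e * e^-1 <= e * ln r.
  by rewrite ler_pM2l// -(expRK e^-1) ler_ln ?posrE ?expR_gt0// (lt_le_trans (expR_gt0 _) er).
by rewrite mulfV// mulNr; lra.
Qed.

End LogTruncation.

(** * Smooth maximum of two functions *)

Section LogSumExp.
Context {R : realType} {d m : nat} {K : ptopologicalType}.
Variables (b : 'rV[R]_d -> K -> 'rV[R]_d) (S : 'rV[R]_d -> 'M[R]_(d, m)).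
Variables (f g : 'rV[R]_d -> R).
Hypotheses (Cf : C2on setT f) (Cg : C2on setT g).

Definition sum_exp (x : 'rV[R]_d) : R := expR (f x) + expR (g x).
Definition log_sum_exp (x : 'rV[R]_d) : R := ln (sum_exp x).
Definition exp_weight (x : 'rV[R]_d) : R := expR (g x) / sum_exp x.

Lemma sum_exp_gt0 x : 0 < sum_exp x. Proof. by rewrite addr_gt0 ?expR_gt0. Qed.

Lemma exp_weight_bounds x : 0 <= exp_weight x <= 1.
Proof.
have s0 := sum_exp_gt0 x; apply/andP; split; first by apply: divr_ge0; [exact: expR_ge0|exact: ltW].
by rewrite /exp_weight ler_pdivrMr// mul1r /sum_exp lerDr expR_ge0.
Qed.

Lemma exp_weightC x : 1 - exp_weight x = expR (f x) / sum_exp x.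
Proof.
have s0 := sum_exp_gt0 x; rewrite /exp_weight -[X in X - _](@mulfV _ (sum_exp x)) ?gt_eqF//.
by rewrite -mulrBl /sum_exp addrK.
Qed.

Lemma exp_weight_le x : exp_weight x <= expR (g x - f x).
Proof.
have s0 := sum_exp_gt0 x; have f0 := expR_gt0 (f x); have g0 := expR_gt0 (g x).
rewrite /exp_weight expRD expRN; apply: ler_wpM2l; first exact: ltW.
by rewrite lef_pV2// /sum_exp lerDl ltW.
Qed.

Lemma log_sum_exp_gel x : f x <= log_sum_exp x.
Proof. by rewrite -{1}(expRK (f x)) ler_ln ?posrE ?expR_gt0 ?sum_exp_gt0// lerDl expR_ge0. Qed.

Lemma log_sum_exp_ger x : g x <= log_sum_exp x.
Proof. by rewrite -{1}(expRK (g x)) ler_ln ?posrE ?expR_gt0 ?sum_exp_gt0// lerDr expR_ge0. Qed.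

Let Csum : C2on setT sum_exp.
Proof. by case: (C2D (C2_exp Cf) (C2_exp Cg)). Qed.

Let inv_sqr (t : R) : R := - (t^-1 ^+ 2).
Let d1 (x : 'rV[R]_d) : is_derive (sum_exp x) (1 : R) (@ln R) ((fun t => t^-1) (sum_exp x)).
Proof. exact/is_derive1_ln/sum_exp_gt0. Qed.
Let d2 (x : 'rV[R]_d) : is_derive (sum_exp x) (1 : R) (fun t => t^-1) (inv_sqr (sum_exp x)).
Proof. by apply: is_derive1_inv; rewrite gt_eqF// sum_exp_gt0. Qed.
Let c2 (x : 'rV[R]_d) : {for sum_exp x, continuous inv_sqr}.
Proof. by apply: continuous_inv_sqr; rewrite gt_eqF// sum_exp_gt0. Qed.

Lemma C2_log_sum_exp : C2on setT log_sum_exp.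
Proof. exact: (@C2_compose R d _ _ _ _ Csum d1 d2 (fun x => @c2 x)). Qed.

Lemma grad_log_sum_exp x : grad log_sum_exp x =
  (1 - exp_weight x) *: grad f x + exp_weight x *: grad g x.
Proof.
have -> : grad log_sum_exp x = (sum_exp x)^-1 *: grad sum_exp x.
  exact: (@grad_comp R d _ _ _ _ Csum d1 d2 (fun x => @c2 x) x).
rewrite (gradD x (C2_exp Cf) (C2_exp Cg)).
have e1 (h : 'rV[R]_d -> R) : C2on setT h -> grad (fun y => expR (h y)) x = expR (h x) *: grad h x.
  move=> Ch; exact: (@grad_comp R d _ _ _ _ Ch (fun x => is_derive_expR (h x))
    (fun x => is_derive_expR (h x)) (fun x => @continuous_expR R (h x)) x).
rewrite (e1 _ Cf) (e1 _ Cg) scalerDr !scalerA exp_weightC /exp_weight.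
by rewrite ![_^-1 * _]mulrC.
Qed.

(** The operator f ↦ L f + ½|σᵀ∇f|² is exp(- f) L exp(f). As L is linear on the sum of exponentials,
    this operator averages with the weights [1 - exp_weight] and [exp_weight]. *)
Lemma Lop_log_sum_exp x xi : Lop b S log_sum_exp x xi =
  (1 - exp_weight x) * (Lop b S f x xi + 2^-1 * Gam (S x) (grad f x) (grad f x)) +
  exp_weight x * (Lop b S g x xi + 2^-1 * Gam (S x) (grad g x) (grad g x)) -
  2^-1 * Gam (S x) (grad log_sum_exp x) (grad log_sum_exp x).
Proof.
have G : grad log_sum_exp x = (sum_exp x)^-1 *: grad sum_exp x.
  exact: (@grad_comp R d _ _ _ _ Csum d1 d2 (fun x => @c2 x) x).
have -> := @Lop_comp R d m K b S _ _ _ _ Csum d1 d2 (fun x => @c2 x) x xi.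
rewrite G GamZl GamZr (LopD b S x xi (C2_exp Cf) (C2_exp Cg)) (Lop_exp b S x xi Cf) (Lop_exp b S x xi Cg).
rewrite exp_weightC /exp_weight /inv_sqr.
move: (Gam _ (grad sum_exp x) _) (Lop _ _ f _ _) (Lop _ _ g _ _) (Gam _ (grad f x) _) (Gam _ (grad g x) _)
  (expR (f x)) (expR (g x)) (sum_exp x)^-1 => p1 p2 p3 p4 p5 p6 p7 p8; ring.
Qed.

(** Convexity of the quadratic form, the gradient being a convex combination. *)
Lemma Gam_log_sum_exp_le x : Gam (S x) (grad log_sum_exp x) (grad log_sum_exp x) <=
  (1 - exp_weight x) * Gam (S x) (grad f x) (grad f x) + exp_weight x * Gam (S x) (grad g x) (grad g x).
Proof.
rewrite grad_log_sum_exp !(GamDl, GamDr, GamZl, GamZr) (GamC _ (grad g x) (grad f x)).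
have /andP[q0 q1] := exp_weight_bounds x.
have H := Gam_le_sqr (S x) (grad f x) (grad g x).
move: q0 q1 H; move: (exp_weight x) (Gam _ (grad f x) (grad f x)) (Gam _ (grad f x) (grad g x))
  (Gam _ (grad g x) (grad g x)) => q a h e q0 q1 H.
have B : 0 <= (1 - q) * q * (a + e - 2 * h) by rewrite mulr_ge0// ?mulr_ge0//; lra.
rewrite -subr_ge0; apply: (le_trans B); rewrite le_eqVlt; apply/orP; left; apply/eqP; ring.
Qed.

End LogSumExp.

Section Supersolution.
Context {R : realType} {d m : nat} {K : ptopologicalType}.
Variables (b : 'rV[R]_d -> K -> 'rV[R]_d) (S : 'rV[R]_d -> 'M[R]_(d, m)) (c : 'rV[R]_d -> K -> R).
Variables (phi : 'rV[R]_d -> R) (rho C0 M del r0 Ch : R).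
Hypothesis growth : forall x xi, enorm (b x xi) ^+ 2 + fnorm (S x) ^+ 2 <= C0 * (1 + enorm x ^+ 2).
Hypothesis Cphi : C2on setT phi.
Hypothesis HJ : forall x xi,
  Lop b S phi x xi + 2^-1 * Gam (S x) (grad phi x) (grad phi x) + c x xi <= rho.
Hypothesis cM : forall x xi, c x xi <= M.
Hypothesis del0 : 0 < del.
Hypothesis infty : forall x xi, r0 <= enorm x -> c x xi <= rho - del.
Hypothesis energy : forall x, 2^-1 * Gam (S x) (grad phi x) (grad phi x) <= Ch * (1 + `|phi x|).

(* The left side is the value at a point of [Lop g + c + 2^-1 * Gam (grad g) (grad g)] for
   [g = log_trunc e (1 + N)], [N] a log-sum-exp with weights [p], [q] and energy [h], and
   [w = log_trunc_arg e (1 + N)]. *)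
Lemma truncated_estimate (p q w e r k L H cx h Ll gl Cl : R) :
  p = 1 - q -> 0 <= q <= 1 -> 0 <= w <= 1 -> 0 <= e -> 1 <= r -> 0 <= k <= 1 ->
  `|Ll| <= Cl -> gl <= Cl -> 0 <= gl -> 0 <= H -> 0 <= h ->
  h <= p * H + q * (2^-1 * (k * (k * gl))) -> L + H + cx <= rho ->
  - w ^+ 2 * (p * (- L + H) + q * (k * Ll + 2^-1 * (k * (k * gl))) - h) +
    2 * e * w / r * h + cx + w ^+ 2 * (w ^+ 2 * h) <=
  rho + (1 - w ^+ 2 * p) * (cx - rho) + w ^+ 2 * (q * (2 * k * Cl)) + 2 * e * (h / r).
Proof.
move=> pE /andP[q0 q1] /andP[w0 w1] e0 r1 /andP[k0 k1] LlC glC gl0 H0 h0 hle Lle.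
have p0 : 0 <= p by lra.
have w20 : 0 <= w ^+ 2 by rewrite sqr_ge0.
have w21 : w ^+ 2 <= 1 by rewrite exprn_ile1.
have A1 : w ^+ 2 * (w ^+ 2 * h) <= w ^+ 2 * h by apply: ler_wpM2l => //; exact: ler_piMl.
have hr0 : 0 <= 2 * e * (h / r) by rewrite !mulr_ge0// invr_ge0; lra.
have A2 : w * (2 * e * (h / r)) <= 2 * e * (h / r) by apply: ler_piMl.
have kLl : - (k * Ll) <= k * Cl.
  rewrite -mulrN; apply: ler_wpM2l => //; apply: le_trans LlC; rewrite -normrN; exact: ler_norm.
have kgl : k * (k * gl) <= k * Cl.
  by apply: ler_wpM2l => //; apply: le_trans glC; apply: ler_piMl.
have A3 : q * - (k * Ll) <= q * (k * Cl) by apply: ler_wpM2l.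
have A4 : q * (k * (k * gl)) <= q * (k * Cl) by apply: ler_wpM2l.
have A5 : p * (L + H) <= p * (rho - cx) by apply: ler_wpM2l => //; lra.
have kgl0 : 0 <= q * (k * (k * gl)) by rewrite !mulr_ge0.
(* Twice the bound on [h] turns [- p H] into [+ p H], so that the supersolution inequality for φ
   applies although [N] is built from - φ. *)
have A6 : - (p * (- L + H) + q * (k * Ll + 2^-1 * (k * (k * gl))) - h) + h <= p * (rho - cx) + q * (2 * k * Cl).
  have E1 : p * (- L + H) + q * (k * Ll + 2^-1 * (k * (k * gl))) =
    - (p * (L + H)) + 2 * (p * H) - q * - (k * Ll) + 2^-1 * (q * (k * (k * gl))) by ring.
  have E2 : q * (2^-1 * (k * (k * gl))) = 2^-1 * (q * (k * (k * gl))) by ring.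
  have E3 : q * (2 * k * Cl) = 2 * (q * (k * Cl)) by ring.
  rewrite E1 E3; rewrite E2 in hle; lra.
have A7 := ler_wpM2l w20 A6.
have E4 : 2 * e * w / r * h = w * (2 * e * (h / r)) by ring.
have E5 : rho + (1 - w ^+ 2 * p) * (cx - rho) = cx + w ^+ 2 * (p * (rho - cx)) by ring.
rewrite E4 E5; rewrite !mulrDr mulrN -mulNr in A7.
move: A7; set X := (X in X <= _ -> _); have -> : X = - w ^+ 2 * (p * (- L + H) + q * (k * Ll + 2^-1 * (k * (k * gl))) - h) + w ^+ 2 * h.
  by rewrite /X; ring.
lra.
Qed.

(** [N] is a smooth maximum of C - φ and κ ln (1 + |x|²), and [log_trunc e (1 + N)] behaves like a
    constant minus [N] until [N] is of order exp (1 / e), where it becomes 0. The barrier makes [N]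
    tend to +oo, which gives compact support. *)
Lemma exists_supersolution (eta : R) : 0 < eta -> exists2 g, C2c g &
  forall z : Zsp R d K, Aop b S g z + Rfun S c z <= rho + eta.
Proof.
move=> eta0.
have [Cl Cl0 [HLl HGl]] := log_norm_bounds growth.
(* Small enough that the cost [2 k Cl] of the barrier fits into the gap [del]. *)
pose k := Num.min 1 (del / (2 * (Cl + 1))).
have Cl1 : 0 < 2 * (Cl + 1) by lra.
have k0 : 0 < k by rewrite lt_min ltr01 divr_gt0.
have k01 : 0 <= k <= 1 by rewrite ltW//= ge_min lexx.
have kCl : 2 * k * Cl <= del.
  have : k <= del / (2 * (Cl + 1)) by rewrite ge_min lexx orbT.
  rewrite ler_pdivlMr// => H.
  have E : k * (2 * (Cl + 1)) = 2 * k * Cl + 2 * k by ring.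
  by rewrite E in H; lra.
have Cln := @C2_log_norm R d.
have cln := C2_continuous Cln; have cphi := C2_continuous Cphi.
have [B HB] : exists B, forall x : 'rV[R]_d, cball r0 x -> k * log_norm x + phi x <= B.
  have cf : continuous (fun x : 'rV[R]_d => k * log_norm x + phi x).
    by apply: continuous_addf => //; apply: continuous_mulf => //; exact: cst_continuous.
  exact: (compact_bounded_above (@compact_cball R d r0) cf).
pose Mb := `|M - rho| + del.
have Mb0 : 0 < Mb by rewrite ltr_wpDl.
have eM : 0 < eta / (3 * Mb) by rewrite divr_gt0// mulr_gt0.
pose C := Num.max 0 (B - ln (eta / (3 * Mb))).
have C00 : 0 <= C by rewrite le_max lexx.
have BC : expR (B - C) * Mb <= eta / 3.
  have H1 : expR (B - C) <= eta / (3 * Mb).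
    rewrite -[leRHS]lnK ?posrE// ler_expR.
    have : B - ln (eta / (3 * Mb)) <= C by rewrite le_max lexx orbT.
    lra.
  have -> : eta / 3 = eta / (3 * Mb) * Mb by field; rewrite gt_eqF.
  by rewrite ler_pM2r.
pose v1 (x : 'rV[R]_d) := C + -1 * phi x.
pose v2 (x : 'rV[R]_d) := k * log_norm x.
have Cc : C2on setT (fun _ : 'rV[R]_d => C) by case: (@C2_cst R d C).
have Cm := C2Z (-1) Cphi.
have Cv1 : C2on setT v1 by case: (C2D Cc Cm).
have Cv2 : C2on setT v2 by exact: C2Z.
pose N := log_sum_exp v1 v2.
have CN : C2on setT N by exact: C2_log_sum_exp.
have cN := C2_continuous CN.
have N0 x : 0 <= N x.
  apply: le_trans (log_sum_exp_ger v1 v2 x); rewrite /v2 mulr_ge0 ?log_norm_ge0//; exact: ltW.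
have [NB HNB] := compact_bounded_above (@compact_cball R d r0) cN.
pose q x := exp_weight v1 v2 x.
pose h x := 2^-1 * Gam (S x) (grad N x) (grad N x).
have gv1 x : grad v1 x = - grad phi x.
  by rewrite (gradD x Cc Cm) [grad (fun=> C) x]grad_cst add0r (gradZ _ x Cphi) scaleN1r.
have gv2 x : grad v2 x = k *: grad log_norm x by exact: gradZ.
have Lv1 x xi : Lop b S v1 x xi = - Lop b S phi x xi.
  by rewrite (LopD b S x xi Cc Cm) (Lop_cst b S C) add0r (LopZ b S _ x xi Cphi) mulN1r.
have Lv2 x xi : Lop b S v2 x xi = k * Lop b S log_norm x xi by exact: LopZ.
have h0 x : 0 <= h x by rewrite mulr_ge0 ?invr_ge0// Gam_ge0.
have hle x : h x <= (1 - q x) * (2^-1 * Gam (S x) (grad phi x) (grad phi x)) +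
    q x * (2^-1 * (k * (k * Gam (S x) (grad log_norm x) (grad log_norm x)))).
  have := Gam_log_sum_exp_le S Cv1 Cv2 x; rewrite gv1 gv2 GamNl GamNr opprK GamZl GamZr /h /q -/N.
  move: (exp_weight _ _ _) (Gam _ (grad N x) _) (Gam _ (grad phi x) _) (Gam _ (grad log_norm x) _) => s t u v Hs.
  have -> : (1 - s) * (2^-1 * u) + s * (2^-1 * (k * (k * v))) = 2^-1 * ((1 - s) * u + s * (k * (k * v))) by ring.
  by rewrite ler_pM2l ?invr_gt0.
pose Ca := `|Ch| * (1 + expR C) + Cl.
have Ca0 : 0 <= Ca by rewrite addr_ge0// mulr_ge0// addr_ge0// expR_ge0.
have hr x : h x / (1 + N x) <= Ca.
  have N1 : 0 < 1 + N x by rewrite ltr_pwDl.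
  rewrite ler_pdivrMr//; apply: (le_trans (hle x)).
  have /andP[q0 q1] := exp_weight_bounds v1 v2 x; rewrite -/(q x) in q0 q1.
  have X1 := energy x; have X2 := HGl x (point : K); have X3 := Gam_ge0 (S x) (grad log_norm x).
  have vN : v1 x <= N x by exact: log_sum_exp_gel.
  (* If φ < 0, then |φ| <= C - φ <= N. If φ >= 0, the weight [1 - q x] is at most exp(C - φ), which
     outweighs the linear growth of φ. *)
  have pphi : (1 - q x) * `|phi x| <= N x + expR C.
    have [p0|p0] := leP 0 (phi x); last first.
      apply: (@le_trans _ _ `|phi x|); first by apply: ler_piMl => //; lra.
      by rewrite ltr0_norm//; have := expR_ge0 C; rewrite /v1 in vN; lra.
    rewrite exp_weightC ler_wpDl// mulrC mulrA ler_pdivrMr ?sum_exp_gt0//.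
    have s1 : 1 <= sum_exp v1 v2 x.
      rewrite /sum_exp -[leLHS]add0r; apply: lerD; first exact: expR_ge0.
      by rewrite -expR0 ler_expR /v2 mulr_ge0 ?log_norm_ge0// ltW.
    apply: (@le_trans _ _ (expR C)); last by rewrite ler_peMr// expR_ge0.
    rewrite /v1 mulN1r expRB mulrCA ler_piMr ?expR_ge0//.
    by rewrite ler_pdivrMr ?expR_gt0// mul1r; have := expR_ge1Dx (phi x); rewrite (ger0_norm p0); lra.
  have pE : (1 - q x) * (2^-1 * Gam (S x) (grad phi x) (grad phi x)) <= `|Ch| * (1 + N x + expR C).
    apply: (@le_trans _ _ ((1 - q x) * (`|Ch| * (1 + `|phi x|)))).
      apply: ler_wpM2l; first by lra.
      by apply: (le_trans X1); apply: ler_wpM2r; [rewrite addr_ge0|exact: ler_norm].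
    rewrite mulrCA; apply: ler_wpM2l => //; rewrite mulrDr mulr1; lra.
  have qE : q x * (2^-1 * (k * (k * Gam (S x) (grad log_norm x) (grad log_norm x)))) <= Cl.
    case/andP: k01 => k00 k11.
    have Y1 : k * (k * Gam (S x) (grad log_norm x) (grad log_norm x)) <= Cl.
      apply: le_trans X2; apply: (@le_trans _ _ (k * Gam (S x) (grad log_norm x) (grad log_norm x))).
        by apply: ler_piMl => //; exact: mulr_ge0.
      exact: ler_piMl.
    have Y0 : 0 <= k * (k * Gam (S x) (grad log_norm x) (grad log_norm x)) by rewrite !mulr_ge0.
    move: (k * (k * _)) Y0 Y1 => t Y0 Y1.
    apply: (@le_trans _ _ (2^-1 * t)); last by lra.
    by apply: ler_piMl => //; lra.
  apply: (le_trans (lerD pE qE)).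
  have Nx := N0 x; have Z1 : 0 <= `|Ch| * (expR C * N x) by rewrite !mulr_ge0// expR_ge0.
  have Z2 : 0 <= Cl * N x by exact: mulr_ge0.
  have -> : Ca * (1 + N x) = `|Ch| * (1 + N x + expR C) + Cl + `|Ch| * (expR C * N x) + Cl * N x.
    by rewrite /Ca; ring.
  by lra.
(* The first entry makes the error of the second derivative at most [eta / 3]; the second does so
   for the slope defect on the ball, where [N <= NB]. The added ones keep the denominators
   positive. *)
pose e := Num.min (eta / (6 * (Ca + 1))) (eta / (6 * (`|NB| * `|M - rho| + 1))).
have De1 : 0 < 6 * (Ca + 1) by lra.
have De2 : 0 < 6 * (`|NB| * `|M - rho| + 1) by rewrite mulr_gt0// ltr_wpDl// mulr_ge0.
have e0 : 0 < e by rewrite lt_min !divr_gt0.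
have eCa : 2 * e * Ca <= eta / 3.
  have : e <= eta / (6 * (Ca + 1)) by rewrite ge_min lexx.
  rewrite ler_pdivlMr// => H.
  have E : e * (6 * (Ca + 1)) = 3 * (2 * e * Ca) + 6 * e by ring.
  by rewrite E in H; lra.
have eNB : 2 * e * (`|NB| * `|M - rho|) <= eta / 3.
  have : e <= eta / (6 * (`|NB| * `|M - rho| + 1)) by rewrite ge_min lexx orbT.
  rewrite ler_pdivlMr//; move: (`|NB| * `|M - rho|) => t H.
  have E : e * (6 * (t + 1)) = 3 * (2 * e * t) + 6 * e by ring.
  by rewrite E in H; lra.
pose r (x : 'rV[R]_d) := 1 + N x.
have r1 x : 1 <= r x by rewrite lerDl.
have rp x : 0 < r x := lt_le_trans ltr01 (r1 x).
have C1 : C2on setT (fun _ : 'rV[R]_d => 1 : R) by case: (@C2_cst R d 1).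
have Cr : C2on setT r by case: (C2D C1 CN).
have gr x : grad r x = grad N x by rewrite (gradD x C1 CN) [grad (fun=> 1) x]grad_cst add0r.
have Lr x xi : Lop b S r x xi = Lop b S N x xi.
  by rewrite (LopD b S x xi C1 CN) (Lop_cst b S 1) add0r.
have d1 x := is_derive_log_trunc e0 (rp x).
have d2 x := is_derive_log_trunc1 e (rp x).
have c2 x := @continuous_log_trunc2 R e (r x) (rp x).
exists (fun x => log_trunc e (r x)).
  split; first exact: (@C2_compose R d r _ _ _ Cr d1 d2 c2).
  exists (expR (k^-1 * expR e^-1)) => x xr; apply: (log_trunc_eq0 e0).
  have := log_norm_ge xr; have := log_sum_exp_ger v1 v2 x; rewrite -/(N x) /v2 /r => H1 H2.
  have : k * (k^-1 * expR e^-1) <= k * log_norm x by rewrite ler_pM2l.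
  by rewrite mulrA mulfV ?gt_eqF// mul1r; lra.
move=> [[x xi] y]; rewrite AopE /Rfun enorm_mulmx_sqr /zx /zxi /zy/=.
have -> := @Lop_comp R d m K b S r _ _ _ Cr d1 d2 c2 x xi.
have -> : grad (fun x => log_trunc e (r x)) x = log_trunc1 e (r x) *: grad r x.
  exact: (@grad_comp R d r _ _ _ Cr d1 d2 c2 x).
rewrite Lr gr.
(* Completing the square in [y]: the largest value of A g + R is attained at y = ∇g. *)
have Gy := Gam_le_sqr (S x) y (log_trunc1 e (r x) *: grad N x).
rewrite !(GamZl, GamZr) in Gy; rewrite GamZr.
have LN := Lop_log_sum_exp b S Cv1 Cv2 x xi.
rewrite Lv1 Lv2 gv1 gv2 GamNl GamNr opprK GamZl GamZr -/(q x) -/N -/(h x) in LN.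
have wb := log_trunc_arg_bounds e0 (r1 x).
have w2 := log_trunc_arg_sqr_ge e (r x).
have qb := exp_weight_bounds v1 v2 x.
have H0 : 0 <= 2^-1 * Gam (S x) (grad phi x) (grad phi x) by rewrite mulr_ge0 ?invr_ge0// Gam_ge0.
have main := truncated_estimate (erefl (1 - q x)) qb wb (ltW e0) (r1 x) k01 (HLl x xi) (HGl x xi)
  (Gam_ge0 (S x) (grad log_norm x)) H0 (h0 x) (hle x) (HJ x xi).
rewrite -LN in main.
have hrx := hr x.
have lh : Lop b S N x xi * log_trunc1 e (r x) + log_trunc2 e (r x) * h x + c x xi +
    log_trunc1 e (r x) * (log_trunc1 e (r x) * h x) <= rho + eta.
  have -> : Lop b S N x xi * log_trunc1 e (r x) + log_trunc2 e (r x) * h x + c x xi +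
      log_trunc1 e (r x) * (log_trunc1 e (r x) * h x) =
      - log_trunc_arg e (r x) ^+ 2 * Lop b S N x xi + 2 * e * log_trunc_arg e (r x) / r x * h x + c x xi +
      log_trunc_arg e (r x) ^+ 2 * (log_trunc_arg e (r x) ^+ 2 * h x).
    by rewrite /log_trunc1 /log_trunc2; move: (Lop _ _ _ _ _) (h x) (log_trunc_arg _ _) => ? ? ?; ring.
  apply: (le_trans main).
  have eh : 2 * e * (h x / r x) <= 2 * e * Ca by rewrite ler_pM2l// mulr_gt0.
  rewrite -/(q x) in qb *; case/andP: qb => q0 q1; case/andP: wb => w0 w1.
  have w21 : log_trunc_arg e (r x) ^+ 2 <= 1 by rewrite exprn_ile1.
  have w20 : 0 <= log_trunc_arg e (r x) ^+ 2 by rewrite sqr_ge0.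
  move: (log_trunc_arg e (r x) ^+ 2) w2 w20 w21 => w w2 w20 w21.
  have qk : q x * (2 * k * Cl) <= q x * del by apply: ler_wpM2l.
  have wqk := ler_wpM2l w20 qk.
  have a0 : 0 <= 1 - w * (1 - q x).
    by rewrite subr_ge0; apply: mulr_ile1 => //; lra.
  have aE : 1 - w * (1 - q x) = (1 - w) + w * q x by ring.
  have wq0 : 0 <= w * q x by rewrite mulr_ge0.
  (* Far out, [c - rho <= - del] absorbs the cost of the barrier. On the ball, the slope defect and
     the barrier's weight cost [eta / 3] each, besides the [eta / 3] of [eh]. *)
  have [xr|xr] := leP r0 (enorm x).
    have B1 : (1 - w * (1 - q x)) * (c x xi - rho) <= (1 - w * (1 - q x)) * - del.
      by apply: ler_wpM2l => //; have := infty xi xr; lra.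
    have B2 : 0 <= (1 - w) * del by apply: mulr_ge0; [rewrite subr_ge0|exact: ltW].
    have E1 : (1 - w * (1 - q x)) * - del = - ((1 - w) * del) - w * (q x * del) by ring.
    by rewrite E1 in B1; lra.
  have xb : cball r0 x by exact: ltW.
  have lnr : ln (r x) <= NB.
    have := HNB x xb; have := expR_ge1Dx (N x); rewrite -/(r x) => R1.
    have : ln (r x) <= N x by rewrite -[leRHS]expRK ler_ln ?posrE ?expR_gt0.
    lra.
  have ln0 : 0 <= ln (r x) by exact: ln_ge0.
  have cb : c x xi - rho <= `|M - rho| by have := cM x xi; have := ler_norm (M - rho); lra.
  have B1 : (1 - w * (1 - q x)) * (c x xi - rho) <= (1 - w * (1 - q x)) * `|M - rho|.
    exact: ler_wpM2l.
  have B2 : (1 - w) * `|M - rho| <= 2 * e * (`|NB| * `|M - rho|).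
    rewrite mulrA; apply: ler_wpM2r => //; apply: (le_trans w2).
    by rewrite ler_pM2l ?mulr_gt0//; apply: (le_trans lnr); exact: ler_norm.
  have qs : q x <= expR (B - C).
    apply: (le_trans (exp_weight_le v1 v2 x)); rewrite ler_expR /v1 /v2.
    by have := HB x xb; lra.
  have B3 : q x * Mb <= eta / 3 by apply: le_trans BC; apply: ler_wpM2r => //; exact: ltW.
  have B4 : w * (q x * Mb) <= q x * Mb by apply: ler_piMl => //; rewrite mulr_ge0// ltW.
  have E2 : w * (q x * Mb) = w * q x * `|M - rho| + w * (q x * del) by rewrite /Mb; ring.
  have E3 : (1 - w * (1 - q x)) * `|M - rho| = (1 - w) * `|M - rho| + w * q x * `|M - rho| by ring.
  by rewrite E3 in B1; rewrite E2 in B4; lra.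
move: Gy lh; rewrite /h.
move: (Lop _ _ _ _ _) (Gam _ (grad N x) _) (Gam _ y (grad N x)) (Gam _ y y) (log_trunc1 _ _) (log_trunc2 _ _) (c _ _).
move=> t1 t2 t3 t4 t5 t6 t7 Gy lh.
have E : t5 * (t5 * (2^-1 * t2)) = 2^-1 * (t5 * (t5 * t2)) by ring.
by rewrite E in lh; rewrite (mulrC t5 t1); lra.
Qed.

End Supersolution.

(** * The duality formulas *)

Lemma limn_esup_le_near {R : realType} (u : nat -> \bar R) (l : \bar R) (n : nat) :
  (forall k, (n <= k)%N -> (u k <= l)%E) -> (limn_esup u <= l)%E.
Proof.
move=> ul; rewrite limn_esup_lim (cvg_lim _ (@cvg_esups_inf _ u))//.
apply: (@le_trans _ _ (esups u n)); first by apply: ereal_inf_lbound; exists n.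
by apply: ge_ereal_sup => _ [k /= nk <-]; exact: ul.
Qed.

(** The suprema decrease, so their limit is an infimum and one of them is already strictly below
    [rho]. *)
Lemma c_sup_outside_lt {R : realType} {d : nat} {K : Type} (c : 'rV[R]_d -> K -> R) (rho : R) :
  (lim (c_sup_outside c @ \oo) < rho%:E)%E ->
  exists del r0, 0 < del /\ forall x xi, r0 <= enorm x -> c x xi <= rho - del.
Proof.
have ni : nonincreasing_seq (c_sup_outside c).
  move=> n k nk; apply: ereal_sup_le => _ [x xk [xi _ <-]]; exists x; last by exists xi.
  by move: xk; rewrite /oball/= => H1 H2; apply: H1; apply: (lt_le_trans H2); rewrite ler_nat.
rewrite (cvg_lim _ (ereal_nonincreasing_cvgn ni))// => /ereal_inf_lt[_ [n _ <-]] H.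
have ub x xi : n%:R <= enorm x -> ((c x xi)%:E <= c_sup_outside c n)%E.
  move=> nx; apply: ereal_sup_ubound; exists x; last by exists xi.
  by rewrite /oball/=; apply/negP; rewrite -leNgt.
move: ub H; case: (c_sup_outside c n) => [s| |] ub //.
- rewrite lte_fin => sr; exists (rho - s), n%:R; split; first by rewrite subr_gt0.
  by move=> x xi /(ub x xi); rewrite lee_fin; lra.
(* A supremum -oo means that no point lies outside the ball, so any gap will do. *)
- by move=> _; exists 1, n%:R; split => // x xi /(ub x xi).
Qed.

Section HJB.
Context {R : realType} {d m : nat} {K : ptopologicalType}.
Variables (b : 'rV[R]_d -> K -> 'rV[R]_d) (S : 'rV[R]_d -> 'M[R]_(d, m)) (c : 'rV[R]_d -> K -> R).
Variables (Phi : 'rV[R]_d -> R) (rho : R).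
Hypotheses (CPhi : C2on setT Phi) (Phi0 : forall x, 0 < Phi x).
Hypothesis HJB : forall x xi, Lop b S Phi x xi + c x xi * Phi x <= rho * Phi x.

Lemma C2_ln : C2on setT (fun x => ln (Phi x)).
Proof.
have d1 (x : 'rV[R]_d) : is_derive (Phi x) (1 : R) (@ln R) ((fun t => t^-1) (Phi x)).
  exact/is_derive1_ln/Phi0.
pose inv_sqr (t : R) : R := - (t^-1 ^+ 2).
have d2 (x : 'rV[R]_d) : is_derive (Phi x) (1 : R) (fun t => t^-1) (inv_sqr (Phi x)).
  by apply: is_derive1_inv; rewrite gt_eqF// Phi0.
have c2 (x : 'rV[R]_d) : {for Phi x, continuous inv_sqr}.
  by apply: continuous_inv_sqr; rewrite gt_eqF// Phi0.
exact: (@C2_compose R d _ _ _ _ CPhi d1 d2 (fun x => @c2 x)).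
Qed.

Lemma HJB_ln x xi :
  Lop b S (fun y => ln (Phi y)) x xi +
  2^-1 * Gam (S x) (grad (fun y => ln (Phi y)) x) (grad (fun y => ln (Phi y)) x) + c x xi <= rho.
Proof.
have E : Phi = (fun x => expR (ln (Phi x))) by apply/funext => y; rewrite lnK ?posrE.
have H : Lop b S Phi x xi = Phi x * (Lop b S (fun y => ln (Phi y)) x xi +
    2^-1 * Gam (S x) (grad (fun y => ln (Phi y)) x) (grad (fun y => ln (Phi y)) x)).
  by rewrite {1}E (Lop_exp b S x xi C2_ln) lnK ?posrE.
have := HJB x xi; rewrite H [c x xi * _]mulrC -mulrDr mulrC ler_pM2r//.
Qed.

End HJB.

Section Assembly.
Context {R : realType} {d m : nat} {K : pseudoPMetricType R}.
Variables (b : 'rV[R]_d -> K -> 'rV[R]_d) (S : 'rV[R]_d -> 'M[R]_(d, m)) (c : 'rV[R]_d -> K -> R).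
Variables (rho : nat -> R) (rhostar : R).
Hypotheses (A1 : assumption_A1 b S) (A2 : assumption_A2 c) (cK : compact [set: K]).
Hypothesis eig : forall n : nat, neumann_eigen b S c n.+1%:R (rho n).
Hypothesis rhoE : limn_esup (fun n => (rho n)%:E) = rhostar%:E.
Local Notation Z := ('rV[R]_d * K * 'rV[R]_d)%type.

Lemma rhostar_le g Q : C2c g -> (forall z : Z, Aop b S g z + Rfun S c z <= Q) -> rhostar <= Q.
Proof.
move=> [Cg [r gr]] gQ; have [_ _ [C0 growth]] := A1.
rewrite -lee_fin -rhoE; apply: (@limn_esup_le_near _ _ _ (Num.bound `|r|)) => k rk.
rewrite lee_fin; apply: (neumann_eigen_le growth _ _ (eig k) Cg gr gQ); first by rewrite ltr0n.
apply: (le_lt_trans (ler_norm r)); apply: (lt_le_trans (archi_boundP (normr_ge0 r))).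
by rewrite ler_nat; exact: leqW.
Qed.

Lemma measurable_Aop_Rfun g : C2on setT g ->
  measurable_fun setT ((fun z => Aop b S g z + Rfun S c z) : ZB R d K -> R).
Proof.
move=> Cg; apply: continuous_measurable_ZB.
by apply: continuous_addf; [exact: (Aop_continuous A1)|exact: (Rfun_continuous A1 A2)].
Qed.

Lemma Ffun_dirac g (z : ZB R d K) : C2on setT g -> Ffun b S c g (\d_z) = (Aop b S g z + Rfun S c z)%:E.
Proof.
move=> Cg; rewrite /Ffun integral_dirac ?diracT ?mul1e//.
by apply/measurable_EFinP; exact: measurable_Aop_Rfun.
Qed.

Lemma rhostar_le_sup_Ffun g : C2c g ->
  (rhostar%:E <= ereal_sup [set Ffun b S c g mu | mu in [set: probability (ZB R d K) R]])%E.
Proof.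
move=> Cg; have Cg2 : C2on setT g by case: Cg.
set s := ereal_sup _.
have key (z : ZB R d K) : ((Aop b S g z + Rfun S c z)%:E <= s)%E.
  by rewrite -(Ffun_dirac z Cg2); apply: ereal_sup_ubound; exists (\d_z).
move: key; case: s => [q| |] key; last by have := key point.
- by rewrite lee_fin; apply: (rhostar_le Cg) => z; rewrite -lee_fin; exact: key.
- exact: leey.
Qed.

Variable Phi : 'rV[R]_d -> R.
Hypotheses (CPhi : C2on setT Phi) (Phi0 : forall x, 0 < Phi x).
Hypothesis HJB : forall x xi, Lop b S Phi x xi + c x xi * Phi x <= rhostar * Phi x.
Hypothesis infty : exists del r0, 0 < del /\ forall x xi, r0 <= enorm x -> c x xi <= rhostar - del.
Let Cphi := C2_ln CPhi Phi0.
Let HJ := HJB_ln CPhi Phi0 HJB.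

Lemma MA_Pcirc_Pstar mu : MA b S mu -> Pcirc S c mu -> Pstar S Phi mu.
Proof.
move=> muMA /(Pcirc_integrable A1 A2) iR.
have /integrableP[_] := MA_integrable_energy A1 A2 iR Cphi HJ muMA.
apply: le_lt_trans; rewrite le_eqVlt; apply/orP; left; apply/eqP.
apply: eq_integral => z _; rewrite /Hfun enorm_mulmx_sqr gee0_abs//.
by rewrite lee_fin mulr_ge0 ?invr_ge0// Gam_ge0.
Qed.

Lemma exists_MA_optimal : exists mu, MA b S mu /\
  (\int[mu]_z (Rfun S c z)%:E = rhostar%:E)%E.
Proof.
have [mu [muMA _ le]] := exists_optimal A1 A2 cK rhostar_le infty.
exists mu; split => //; apply/eqP; rewrite eq_le le andbT.
exact: (MA_integral_Rfun_le A1 A2 Cphi HJ muMA).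
Qed.

(** At an optimal measure F(g, mu) is the same for every [g], because A g has mean zero; this gives
    the lower bound. *)
Lemma sup_inf_Ffun : ereal_sup [set ereal_inf [set Ffun b S c g mu | g in C2c]
  | mu in [set: probability (ZB R d K) R]] = rhostar%:E.
Proof.
apply/eqP; rewrite eq_le; apply/andP; split.
  apply: ge_ereal_sup => _ [mu _ <-].
  exact: (ereal_inf_Ffun_le A1 A2 cK Cphi HJ).
have [mu [muMA muR]] := exists_MA_optimal.
have iR : mu.-integrable setT (fun z : ZB R d K => (Rfun S c z)%:E).
  by apply: (Pcirc_integrable A1 A2); rewrite /Pcirc muR ltNyr.
apply: (@le_trans _ _ (ereal_inf [set Ffun b S c g mu | g in C2c])); last first.
  by apply: ereal_sup_ubound; exists mu.
apply: le_ereal_inf_tmp => _ [g Cg <-]; have [iA A0] := muMA g Cg.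
by rewrite /Ffun; under eq_integral do rewrite EFinD; rewrite integralD// A0 muR add0e.
Qed.

Lemma inf_sup_Ffun : (exists C : R, forall x, Hfun S Phi x <= C * (1 + `|ln (Phi x)|)) ->
  ereal_inf [set ereal_sup [set Ffun b S c g mu | mu in [set: probability (ZB R d K) R]]
  | g in C2c] = rhostar%:E.
Proof.
move=> [Ch energy]; apply/eqP; rewrite eq_le; apply/andP; split; last first.
  by apply: le_ereal_inf_tmp => _ [g Cg <-]; exact: rhostar_le_sup_Ffun.
have [_ _ [C0 growth]] := A1; have [_ _ [M cM] _] := A2.
have [del [r0 [del0 far]]] := infty.
apply/lee_addgt0Pr => eta eta0.
have energy' x : 2^-1 * Gam (S x) (grad (fun y => ln (Phi y)) x) (grad (fun y => ln (Phi y)) x) <=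
    Ch * (1 + `|ln (Phi x)|) by rewrite -enorm_mulmx_sqr; exact: energy.
have [g Cg gle] := exists_supersolution growth Cphi HJ cM del0 far energy' eta0.
apply: (@le_trans _ _ (ereal_sup [set Ffun b S c g mu | mu in [set: probability (ZB R d K) R]])).
  by apply: ereal_inf_lbound; exists g.
apply: ge_ereal_sup => _ [mu _ <-]; rewrite -EFinD.
by apply: (integral_le_bound mu _ gle); apply: measurable_Aop_Rfun; case: Cg.
Qed.

End Assembly.

Theorem theorem4p1 (R : realType) (d m : nat) (K : pseudoPMetricType R)
  (b : 'rV[R]_d -> K -> 'rV[R]_d) (sigma : 'rV[R]_d -> 'M[R]_(d, m))
  (c : 'rV[R]_d -> K -> R) (rho : nat -> R) (rhostar : R) (Phi : 'rV[R]_d -> R) :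
  compact [set: K] -> hausdorff_space K ->
  assumption_A1 b sigma -> assumption_A2 c ->
  (forall n : nat, neumann_eigen b sigma c n.+1%:R (rho n)) ->
  limn_esup (fun n => (rho n)%:E) = rhostar%:E ->
  (lim (c_sup_outside c @ \oo) < rhostar%:E)%E ->
  C2on setT Phi -> (forall x, 0 < Phi x) ->
  (forall x, (forall xi, Lop b sigma Phi x xi + c x xi * Phi x <= rhostar * Phi x) /\
             (exists xi, Lop b sigma Phi x xi + c x xi * Phi x = rhostar * Phi x)) ->
  ((assumption_U sigma /\ (cond_N1 c \/ cond_N2 b)) \/ cond_N3 sigma c Phi ->
     (forall mu : probability (ZB R d K) R,
        MA b sigma mu -> Pcirc sigma c mu -> Pstar sigma Phi mu) /\
     (exists mu : probability (ZB R d K) R,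
        MA b sigma mu /\ (\int[mu]_z ((Rfun sigma c z)%:E))%E = rhostar%:E) /\
     (forall mu : probability (ZB R d K) R,
        MA b sigma mu -> (\int[mu]_z ((Rfun sigma c z)%:E) <= rhostar%:E)%E) /\
     ereal_sup [set ereal_inf [set Ffun b sigma c g mu | g in C2c]
               | mu in [set: probability (ZB R d K) R]] = rhostar%:E) /\
  (assumption_U sigma ->
     (exists C : R, forall x, Hfun sigma Phi x <= C * (1 + `|ln (Phi x)|)) ->
     ereal_inf [set ereal_sup [set Ffun b sigma c g mu
                              | mu in [set: probability (ZB R d K) R]] | g in C2c]
       = rhostar%:E).
Proof.
move=> cK _ A1 A2 eig rhoE cinf CPhi Phi0 HJBeq.
have HJB x xi : Lop b sigma Phi x xi + c x xi * Phi x <= rhostar * Phi x.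
  by case: (HJBeq x).
have infty := c_sup_outside_lt cinf.
split; last by move=> _ H; exact: (inf_sup_Ffun A1 A2 eig rhoE CPhi Phi0 HJB infty H).
move=> _; split; first by move=> mu; exact: (MA_Pcirc_Pstar A1 A2 CPhi Phi0 HJB).
split; first exact: (exists_MA_optimal A1 A2 cK eig rhoE CPhi Phi0 HJB infty).
split; last exact: (sup_inf_Ffun A1 A2 cK eig rhoE CPhi Phi0 HJB infty).
move=> mu; exact: (MA_integral_Rfun_le A1 A2 (C2_ln CPhi Phi0) (HJB_ln CPhi Phi0 HJB)).
Qed.
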